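(* Assume that $\lambda=(\lambda^1,\dots,\lambda^d):[0,1]^d\to\mathbb R^d$ is continuous and uniformly strictly hyperbolic, and fix $(m^1,\dots,m^d)\in \mathrm P(\mathbb R)^d$. Let $(\mathbf x(n))_{n\ge1}$ be a sequence of configurations such that, for all $n\ge1$, $\mathbf x(n)\in D_n^d$, and assume that for every $\gamma\in\{1,\dots,d\}$ the sequence of empirical measures $\frac1n\sum_{k=1}^n\delta_{x_k^\gamma(n)}$ converges weakly to $m^\gamma$. Then from any subsequence of $(\mu[\mathbf x(n)])_{n\ge1}$ one can extract a further subsequence $(\mu[\mathbf x(n_\ell)])_{\ell\ge1}$ converging weakly to some $\bar\mu\in\mathbf M$, and such that the function $\mathbf u=(u^1,\dots,u^d):[0,+\infty)\times\mathbb R\to[0,1]^d$ defined by $$u^\gamma(t,x):=\bar\mu^\gamma_t((-\infty,x]),\qquad \gamma\in\{1,\dots,d\},\ (t,x)\in[0,+\infty)\times\mathbb R,$$ is a probabilistic solution to the system $\partial_tu^\gamma+\lambda^\gamma(\mathbf u)\partial_xu^\gamma=0$, $\gamma\in\{1,\dots,d\}$, with initial data $(u_0^1,\dots,u_0^d)$ given by $u_0^\gamma(x)=m^\gamma((-\infty,x])$.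
   Context: Let $d\ge1$. $\mathrm P(\mathbb R)$ is the set of Borel probability measures on $\mathbb R$. The map $\lambda=(\lambda^1,\dots,\lambda^d):[0,1]^d\to\mathbb R^d$ is uniformly strictly hyperbolic if there is $L_{\mathrm{USH}}\in(0,+\infty)$ with $\inf_{[0,1]^d}\lambda^\gamma-\sup_{[0,1]^d}\lambda^{\gamma+1}\ge L_{\mathrm{USH}}$ for all $\gamma\in\{1,\dots,d-1\}$. Sticky Particle Dynamics (SPD). Let $D_n=\{(x_1,\dots,x_n)\in\mathbb R^n:x_1\le\dots\le x_n\}$, $x\in D_n$ and $\bar\lambda\in\mathbb R^n$. The initial cluster of index $k$ is the largest set of consecutive indices $\{\underline k,\dots,\overline k\}\ni k$ such that $x_{\underline k}=\dots=x_{\overline k}$ and either $\underline k=\overline k$ or, for all $j\in\{\underline k,\dots,\overline k-1\}$, $\frac1{j-\underline k+1}\sum_{k'=\underline k}^j\bar\lambda_{k'}\ge\frac1{\overline k-j}\sum_{k'=j+1}^{\overline k}\bar\lambda_{k'}$. At time $0$ the particles $1,\dots,n$ (at positions $x_1,\dots,x_n$) are grouped into their initial clusters; each cluster travels at constant velocity equal to the average of $\bar\lambda_{k'}$ over the indices $k'$ in it; clusters that meet merge permanently into one cluster. $\phi[\bar\lambda](x;t)\in D_n$ denotes the positions at time $t$. Multitype Sticky Particle Dynamics (MSPD). A configuration is $\mathbf x=(x_k^\gamma)_{1\le\gamma\le d,1\le k\le n}\in D_n^d$, with $x^\gamma=(x^\gamma_1,\dots,x^\gamma_n)\in D_n$;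 $x_k^\gamma$ is the position of particle $\gamma:k$ (of type $\gamma$). Let $R(\mathbf x)$ be the set of pairs of particles $(\alpha:i,\beta:j)$ with $\alpha<\beta$ and $x_i^\alpha<x_j^\beta$. Set $\omega^{\gamma'}_{\gamma:k}(\mathbf x)=\frac1n\#\{k':x_{k'}^{\gamma'}<x_k^\gamma\}$ if $\gamma'<\gamma$ and $\omega^{\gamma'}_{\gamma:k}(\mathbf x)=\frac1n\#\{k':x_{k'}^{\gamma'}\le x_k^\gamma\}$ if $\gamma'>\gamma$, and $$\tilde\lambda_k^\gamma(\mathbf x)=n\int_{(k-1)/n}^{k/n}\lambda^\gamma\big(\omega^1_{\gamma:k}(\mathbf x),\dots,\omega^{\gamma-1}_{\gamma:k}(\mathbf x),w,\omega^{\gamma+1}_{\gamma:k}(\mathbf x),\dots,\omega^d_{\gamma:k}(\mathbf x)\big)dw .$$ Let $\tilde\Phi(\mathbf x;t)$ be the configuration in which, for each $\gamma$, the particles of type $\gamma$ have followed independently the SPD from $x^\gamma$ with initial velocities $(\tilde\lambda_1^\gamma(\mathbf x),\dots,\tilde\lambda_n^\gamma(\mathbf x))$ up to time $t$. Let $t^*(\mathbf x)=+\infty$ if $R(\mathbf x)=\emptyset$, otherwise $t^*(\mathbf x)>0$ is the smallest time at which some pair in $R(\mathbf x)$ meets in $\tilde\Phi(\mathbf x;\cdot)$, and $\mathbf x^*=\tilde\Phi(\mathbf x;t^*(\mathbf x))$ (then $R(\mathbf x^* )\subsetneq R(\mathbf x)$). The MSPD started at $\mathbf x$ is defined recursively by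 $\Phi(\mathbf x;t)=\tilde\Phi(\mathbf x;t)$ for $t<t^*(\mathbf x)$ and $\Phi(\mathbf x;t)=\Phi(\mathbf x^*;t-t^*(\mathbf x))$ for $t\ge t^*(\mathbf x)$. $\mathbf M$ is the set of Borel probability measures on $C([0,+\infty),\mathbb R^d)$ (locally uniform convergence topology), with the weak convergence topology; for $\mu\in\mathbf M$, $\mu^\gamma_t\in\mathrm P(\mathbb R)$ is the law of the $\gamma$-th coordinate at time $t$. The empirical distribution of the MSPD is $\mu[\mathbf x]=\frac1n\sum_{k=1}^n\delta_{(\Phi^1_k(\mathbf x;t),\dots,\Phi^d_k(\mathbf x;t))_{t\ge0}}\in\mathbf M$. Probabilistic solution. A CDF is a nondecreasing right-continuous function $\mathbb R\to[0,1]$ with limits $0$ at $-\infty$ and $1$ at $+\infty$. For measurable $\mathbf u:[0,+\infty)\times\mathbb R\to[0,1]^d$ with each $u^\gamma(t,\cdot)$ a CDF, set $$\lambda^\gamma\{\mathbf u\}(t,x)=\int_0^1\lambda^\gamma\big(u^1(t,x),\dots,(1-\theta)u^\gamma(t,x^-)+\theta u^\gamma(t,x),\dots,u^d(t,x)\big)d\theta$$ (only the $\gamma$-th argument is modified). Such a $\mathbf u$ is a probabilistic solution with initial data $(u_0^1,\dots,u_0^d)$ if for all $\varphi=(\varphi^1,\dots,\varphi^d)$, continuous with compact support in $[0,+\infty)\times\mathbb R$ and continuous time derivative, $$\sum_{\gamma=1}^d\Big(\int_0^{+\infty}\!\!\int_{\mathbb R}\partial_t\varphi^\gamma u^\gamma\,dx\,dt+\int_{\mathbb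 R}\varphi^\gamma(0,x)u_0^\gamma(x)dx\Big)=\sum_{\gamma=1}^d\int_0^{+\infty}\!\!\int_{\mathbb R}\varphi^\gamma(t,x)\lambda^\gamma\{\mathbf u\}(t,x)\,d_xu^\gamma(t,x)\,dt,$$ where $d_xu^\gamma(t,x)$ is the probability measure with CDF $u^\gamma(t,\cdot)$. *)

(* Defs.v *)
From HB Require Import structures.
From mathcomp Require Import all_boot all_order all_algebra.
From mathcomp Require Import all_classical all_reals all_analysis.

Set Implicit Arguments.
Unset Strict Implicit.
Unset Printing Implicit Defensive.

Import Order.TTheory GRing.Theory Num.Theory.
Import numFieldNormedType.Exports.

Local Open Scope classical_set_scope.
Local Open Scope ring_scope.

Section glue.
Context {R : realType}.

Lemma glue_continuous (f g : R -> R) (s : R) :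
  continuous f -> continuous g -> g 0 = f s ->
  continuous (fun t => if t < s then f t else g (t - s)).
Proof.
move=> cf cg gf t.
have cgs : continuous (fun t => g (t - s)).
  by move=> y; apply: continuous_comp; [exact: continuousB cvg_id (cvg_cst _)
                                       | exact: cg].
have [ts|st|->] := ltgtP t s.
- apply: (@cvg_trans _ (f @ t)); last by rewrite ts; exact: cf.
  apply: near_eq_cvg.
  by near=> y; rewrite ifT//; near: y; exact: lt_nbhsl.
- apply: (@cvg_trans _ ((fun t => g (t - s)) @ t)); last first.
    by rewrite ltNge ltW//=; exact: cgs.
  apply: near_eq_cvg.
  near=> y; rewrite ifF//; apply/negbTE; rewrite -leNgt ltW//.
  by near: y; exact: lt_nbhsr.
- apply/cvgrPdist_lt => e e0; rewrite subrr.
  have /cvgrPdist_lt/(_ _ e0) cf' := cf s.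
  have /cvgrPdist_lt/(_ _ e0) cg' := cgs s.
  rewrite subrr in cg'.
  rewrite ltxx; near=> y.
  by case: ifPn => ys; [rewrite gf; near: y|near: y].
Unshelve. all: by end_near. Qed.

Lemma continuous_ext (T U : topologicalType) (f g : T -> U) :
  f = g -> continuous f -> continuous g.
Proof. by move=> ->. Qed.

Lemma mx_continuous m n (T : topologicalType) (f : T -> 'M[R]_(m, n)) :
  (forall i j, continuous (fun t => f t i j)) -> continuous f.
Proof.
move=> cf t A [P /= fP PA].
rewrite /nbhs/=.
have : \forall s \near t, forall ij : 'I_m * 'I_n, P ij.1 ij.2 (f s ij.1 ij.2).
  by apply: filter_forall => -[i j] /=; exact: (cf i j t _ (fP i j)).
by apply: filterS => s Ps; apply: PA => i j; exact: (Ps (i, j)).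
Qed.

End glue.

Section weak_convergence.
Context {R : realType}.

Definition bounded_continuous (X : topologicalType) : set (X -> R) :=
  [set f | continuous f /\ exists M, forall x, `|f x| <= M].

(* [C] is meant to be [bounded_continuous] for the topology whose Borel sets are
   the measurable sets of [T]. *)
Definition weak_cvg d (T : measurableType d) (C : set (T -> R))
    (P_ : nat -> probability T R) (P : probability T R) : Prop :=
  forall f, C f -> (\int[P_ n]_x f x) @[n --> \oo] --> \int[P]_x f x.

Definition empirical d (T : measurableType d) (n : nat) (a : 'I_n.+1 -> T) :
    set T -> \bar R :=
  mscale (n.+1%:R^-1)%:nng (msum (fun k => \d_(a (inord k))) n.+1).

Section empirical_probability.
Context d (T : measurableType d) (n : nat) (a : 'I_n.+1 -> T).

HB.instance Definition _ := Measure.on (empirical a).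

Let empirical_setT : empirical a setT = 1%E.
Proof.
rewrite /empirical /mscale/= /msum.
rewrite (eq_bigr (fun=> 1%:E)); last by move=> k _; exact: diracT.
rewrite sumEFin -EFinM sumr_const card_ord.
by rewrite -mulr_natr mul1r mulVf// pnatr_eq0.
Qed.

HB.instance Definition _ :=
  Measure_isProbability.Build _ _ _ (empirical a) empirical_setT.

End empirical_probability.

End weak_convergence.

Section sticky_particles.
Context {R : realType} {n : nat}.
Implicit Types (x v lb : 'rV[R]_n) (C : {set 'I_n}) (cl : 'I_n -> {set 'I_n}).

Definition ordered x : Prop := forall i j : 'I_n, (i <= j)%N -> x 0 i <= x 0 j.

Definition average lb C : R := (\sum_(k in C) lb 0 k) / #|C|%:R.

Definition stable_block x lb C : bool :=
  [exists a : 'I_n, exists b : 'I_n,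
    [&& C == [set i : 'I_n | (a <= i <= b)%N]%SET,
        [forall i in C, x 0 i == x 0 a] &
        [forall j : 'I_n, (a <= j < b)%N ==>
          (average lb [set i : 'I_n | (j < i <= b)%N]%SET
             <= average lb [set i : 'I_n | (a <= i <= j)%N]%SET)]]].

(* Overlapping stable blocks have a stable union, so the stable block containing
   [k] with the most elements is also the largest one for inclusion. *)
Definition initial_cluster x lb (k : 'I_n) : {set 'I_n} :=
  [arg max_(C > [set k]%SET | stable_block x lb C && (k \in C)) #|C|]%N.

Definition velocity lb cl : 'rV[R]_n := \row_k average lb (cl k).

(* Two initial clusters issued from the same point separate at once, hence the
   condition [0 < s]. *)
Definition collision_time x v cl : \bar R :=
  ereal_inf [set s%:E | s in [set s : R | 0 < s /\ exists k l : 'I_n,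
    cl k != cl l /\ x 0 k + s * v 0 k = x 0 l + s * v 0 l]].

Definition merge x cl (k : 'I_n) : {set 'I_n} :=
  (\bigcup_(l : 'I_n | x 0 l == x 0 k) cl l)%SET.

Fixpoint spd_rec (fuel : nat) lb x cl (t : R) : 'rV[R]_n :=
  let v := velocity lb cl in
  let s := collision_time x v cl in
  match fuel with
  | 0%N => x + t *: v
  | fuel'.+1 =>
    if (t%:E < s)%E then x + t *: v
    else let y := x + fine s *: v in
         spd_rec fuel' lb y (merge y cl) (t - fine s)
  end.

(* The fuel [n] is never exhausted before the last collision: every collision
   decreases the number of clusters, and there are at most [n] of them. *)
Definition spd lb x (t : R) : 'rV[R]_n :=
  spd_rec n lb x (initial_cluster x lb) t.

End sticky_particles.

Section multitype_sticky_particles.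
Context {R : realType} {d : nat}.
Variable lam : 'rV[R]_d -> 'rV[R]_d.

Definition unit_cube : set 'rV[R]_d :=
  [set u | forall g : 'I_d, 0 <= u 0 g <= 1].

Definition uniformly_strictly_hyperbolic : Prop :=
  exists2 L : R, 0 < L & forall g h : 'I_d, h = g.+1 :> nat ->
    (L%:E <= ereal_inf [set (lam u 0 g)%:E | u in unit_cube]
             - ereal_sup [set (lam u 0 h)%:E | u in unit_cube])%E.

Context {n : nat}.
Implicit Types (x : 'M[R]_(d, n)) (g h : 'I_d) (k : 'I_n).

Definition configuration x : Prop := forall g, ordered (row g x).

Definition uncrossed x : {set ('I_d * 'I_n) * ('I_d * 'I_n)} :=
  [set p : ('I_d * 'I_n) * ('I_d * 'I_n) |
    (p.1.1 < p.2.1)%N && (x p.1.1 p.1.2 < x p.2.1 p.2.2)]%SET.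

(* Only used for [h != g]. *)
Definition omega x g k h : R :=
  (if (h < g)%N then #|[set l | (x h l < x g k)%R]|
   else #|[set l | (x h l <= x g k)%R]|)%SET%:R / n%:R.

Definition rank_vector x g k (w : R) : 'rV[R]_d :=
  \row_h (if h == g then w else omega x g k h).

(* Ranks are counted from 0: the particle [k : 'I_n] carries the slice
   [k/n, (k+1)/n]. *)
Definition tlam x : 'M[R]_(d, n) := \matrix_(g, k)
  (n%:R * \int[lebesgue_measure]_(w in `[k%:R / n%:R, k.+1%:R / n%:R])
            lam (rank_vector x g k w) 0 g).

Definition tPhi x (t : R) : 'M[R]_(d, n) :=
  \matrix_(g, k) spd (row g (tlam x)) (row g x) t 0 k.

(* Equal to [+oo] when no uncrossed pair ever meets. *)
Definition meeting_time x : \bar R :=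
  ereal_inf [set t%:E | t in [set t : R | 0 <= t /\ exists2 p,
    p \in uncrossed x & tPhi x t p.1.1 p.1.2 = tPhi x t p.2.1 p.2.2]].

Fixpoint mspd_rec (fuel : nat) x (t : R) : 'M[R]_(d, n) :=
  let s := meeting_time x in
  match fuel with
  | 0%N => tPhi x t
  | fuel'.+1 =>
    if (t%:E < s)%E then tPhi x t
    else mspd_rec fuel' (tPhi x (fine s)) (t - fine s)
  end.

(* Under uniform strict hyperbolicity [uncrossed] decreases strictly at every
   meeting time, and the meeting time is infinite once it is empty, so that the
   fuel is never exhausted before the last meeting. *)
Definition mspd x (t : R) : 'M[R]_(d, n) := mspd_rec #|uncrossed x| x t.

End multitype_sticky_particles.

Section continuity.
Context {R : realType}.

Section spd.
Context {n : nat}.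
Implicit Types (x lb : 'rV[R]_n) (cl : 'I_n -> {set 'I_n}).

Lemma collision_time_ge0 x v cl : (0 <= collision_time x v cl)%E.
Proof.
by apply: le_ereal_inf_tmp => _ /= [s [s0 _] <-]; rewrite lee_fin ltW.
Qed.

Lemma spd_rec0 fuel lb x cl : spd_rec fuel lb x cl 0 = x.
Proof.
elim: fuel x cl => [|fuel IH] x cl /=; first by rewrite scale0r addr0.
case: ifPn => [_|]; first by rewrite scale0r addr0.
rewrite -leNgt => s0; have -> : collision_time x (velocity lb cl) cl = 0%E.
  by apply/eqP; rewrite eq_le s0 collision_time_ge0.
by rewrite /= scale0r addr0 subr0 IH.
Qed.

Lemma spd_rec_continuous fuel lb x cl k :
  continuous (fun t => spd_rec fuel lb x cl t 0 k).
Proof.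
have free y v : continuous (fun t : R => (y + t *: v : 'rV[R]_n) 0 k).
  have -> : (fun t : R => (y + t *: v : 'rV[R]_n) 0 k) =
            (fun t => y 0 k + t * v 0 k).
    by apply/funext => t; rewrite !mxE.
  by move=> t; apply: cvgD; [exact: cvg_cst|apply: cvgM => //; exact: cvg_cst].
elim: fuel x cl => [|fuel IH] x cl /=; first exact: free.
have := collision_time_ge0 x (velocity lb cl) cl.
case E : (collision_time x (velocity lb cl) cl) => [s| |] // _.
- have := glue_continuous (free x (velocity lb cl))
    (IH (x + s *: velocity lb cl) (merge (x + s *: velocity lb cl) cl)).
  move=> /(_ s); rewrite spd_rec0 => /(_ erefl); apply: continuous_ext.
  by apply/funext => t; rewrite lte_fin; case: ifP.
- by under eq_fun do rewrite ltry; exact: free.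
Qed.

Lemma spd0 lb x : spd lb x 0 = x.
Proof. exact: spd_rec0. Qed.

Lemma spd_continuous lb x k : continuous (fun t => spd lb x t 0 k).
Proof. exact: spd_rec_continuous. Qed.

End spd.

Section mspd.
Context {d n : nat} (lam : 'rV[R]_d -> 'rV[R]_d).
Implicit Types (x : 'M[R]_(d, n)) (g : 'I_d) (k : 'I_n).

Lemma tPhi0 x : tPhi lam x 0 = x.
Proof. by apply/matrixP => g k; rewrite !mxE spd0 mxE. Qed.

Lemma tPhi_continuous x g k : continuous (fun t => tPhi lam x t g k).
Proof. by under eq_fun do rewrite mxE; exact: spd_continuous. Qed.

Lemma meeting_time_ge0 x : (0 <= meeting_time lam x)%E.
Proof. by apply: le_ereal_inf_tmp => _ /= [t [t0 _] <-]; rewrite lee_fin. Qed.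

Lemma mspd_rec0 fuel x : mspd_rec lam fuel x 0 = x.
Proof.
elim: fuel x => [|fuel IH] x /=; first exact: tPhi0.
case: ifPn => [_|]; first exact: tPhi0.
rewrite -leNgt => s0; have -> : meeting_time lam x = 0%E.
  by apply/eqP; rewrite eq_le s0 meeting_time_ge0.
by rewrite /= tPhi0 subr0 IH.
Qed.

Lemma mspd_rec_continuous fuel x g k :
  continuous (fun t => mspd_rec lam fuel x t g k).
Proof.
elim: fuel x => [|fuel IH] x /=; first exact: tPhi_continuous.
have := meeting_time_ge0 x.
case E : (meeting_time lam x) => [s| |] // _.
- have := glue_continuous (@tPhi_continuous x g k) (IH (tPhi lam x s)).
  move=> /(_ s); rewrite mspd_rec0 => /(_ erefl); apply: continuous_ext.
  by apply/funext => t; rewrite lte_fin; case: ifP.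
- by under eq_fun do rewrite ltry; exact: tPhi_continuous.
Qed.

End mspd.

End continuity.

Section path_space.
Context (R : realType).

Definition halfline : Type := `[(0 : R), +oo[%classic.
HB.instance Definition _ := Topological.on halfline.
HB.instance Definition _ := SubType.on halfline.

Lemma halfline0P : (0 : R) \in `[(0 : R), +oo[%classic.
Proof. by rewrite inE/= in_itv/= lexx. Qed.

Definition halfline0 : halfline := exist _ 0 halfline0P.

(* Sends negative reals to 0; only evaluated at nonnegative reals. *)
Definition to_halfline (t : R) : halfline := insubd halfline0 t.

Definition trajectory (d : nat) : Type := continuousType halfline 'rV[R]_d.

HB.instance Definition _ d := Choice.on (trajectory d).
HB.instance Definition _ d := isPointed.Build (trajectory d)
  (mkcts (@cst_continuous halfline 'rV[R]_d 0)).
(* Locally uniform convergence, and its Borel sets. *)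
HB.instance Definition _ d := Topological.copy (trajectory d)
  (@initial_topology (trajectory d)
     {family compact, halfline -> 'rV[R]_d} (fun w => w)).
HB.instance Definition _ d := @isMeasurable.Build (sigma_display (@open (trajectory d)))
  (trajectory d) <<s @open (trajectory d) >> (@sigma_algebra0 _ setT _) (@sigma_algebraC _ _)
  (@sigma_algebra_bigcup _ setT _).

End path_space.

Section empirical_path.
Context {R : realType} {d n : nat} (lam : 'rV[R]_d -> 'rV[R]_d).

Definition mspd_fun (x : 'M[R]_(d, n)) (k : 'I_n) (t : halfline R) : 'rV[R]_d :=
  \row_g mspd lam x (\val t) g k.

Lemma mspd_fun_continuous x k : continuous (mspd_fun x k).
Proof.
apply: mx_continuous => i g.
under eq_fun do rewrite mxE.
move=> t; apply: (@continuous_comp _ _ _ (\val : halfline R -> R)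
  (fun t => mspd lam x t g k)).
  exact: initial_continuous.
exact: mspd_rec_continuous.
Qed.

Definition mspd_trajectory (x : 'M[R]_(d, n)) (k : 'I_n) : trajectory R d :=
  mkcts (@mspd_fun_continuous x k).

End empirical_path.

Section marginal.
Context {R : realType} {d : nat}.

Definition coordinate (g : 'I_d) (t : halfline R) (w : trajectory R d) : R :=
  w t 0 g.

Lemma coordinate_continuous g t : continuous (coordinate g t).
Proof.
move=> w.
pose iota (v : trajectory R d) : {family compact, halfline R -> 'rV[R]_d} := v.
have cw : iota @ w --> iota w.
  exact: (@initial_continuous (trajectory R d) _ iota w).
have Fw : Filter (iota @ w).
  exact: (@fmap_filter _ _ iota _ (@nbhs_filter (trajectory R d) w)).
have [ptw _] := @pointwise_cvgP _ _ (iota @ w) (iota w) Fw.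
have wt := ptw (pointwise_cvg_compact_family Fw cw) t.
apply: (@continuous_comp _ _ _ (fun v : trajectory R d => v t)
  (fun M : 'rV[R]_d => M 0 g)); first exact: wt.
exact: coord_continuous.
Qed.

Lemma measurable_coordinate g t : measurable_fun setT (coordinate g t).
Proof.
apply: (@measurability _ _ (trajectory R d) R setT (coordinate g t)
  (@measurable_realfun.RGenOpens.G R)).
  exact: measurable_realfun.RGenOpens.measurableE.
move=> _ [_ [a [b ->]] <-]; rewrite setTI; apply: sub_sigma_algebra.
move/continuousP : (@coordinate_continuous g t); apply.
exact: interval_open.
Qed.

HB.instance Definition _ g t := isMeasurableFun.Build _ _ (trajectory R d) R
  (coordinate g t) (measurable_coordinate g t).

Definition marginal (mu : probability (trajectory R d) R) g t : probability R R :=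
  distribution mu (coordinate g t).

End marginal.

Section distribution_function.
Context {R : realType} (P : probability R R).

(* Packaged as a right-continuous nondecreasing function with limits 0 and 1. *)
Definition distribution_function (x : R) : R := fine (P `]-oo, x]%classic).

Let idR : R -> R := idfun.

#[local] HB.instance Definition _ :=
  @isMeasurableFun.Build _ _ _ _ idR (@measurable_id _ _ setT).

Let X : {RV P >-> R} := idR.

Let distribution_function_nd : nondecreasing distribution_function.
Proof.
move=> x y xy; rewrite fine_le ?fin_num_measure//.
exact: (@cdf_nondecreasing _ _ _ P X).
Qed.

Let distribution_function_rc : right_continuous distribution_function.
Proof.
move=> x; apply: fine_cvg; rewrite fineK ?fin_num_measure//.
exact: (@cdf_right_continuous _ _ _ P X).
Qed.

HB.instance Definition _ := isCumulative.Build R _ R distribution_function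
  distribution_function_nd distribution_function_rc.

Let distribution_functionNy : distribution_function @ -oo --> (0 : R).
Proof. exact/fine_cvg/(@cvg_cdfNy0 _ _ _ P X). Qed.

Let distribution_functiony : distribution_function @ +oo --> (1 : R).
Proof. exact/fine_cvg/(@cvg_cdfy1 _ _ _ P X). Qed.

HB.instance Definition _ := isCumulativeBounded.Build R 0 1
  distribution_function distribution_functionNy distribution_functiony.

End distribution_function.

Section probabilistic_solution.
Context {R : realType} {d : nat}.
Variable lam : 'rV[R]_d -> 'rV[R]_d.
Implicit Types u : 'I_d -> halfline R -> cumulativeBounded (0 : R) (1 : R).

Definition speed u (g : 'I_d) (t : halfline R) (x : R) : R :=
  \int[lebesgue_measure]_(a in `[0, 1])
    lam (\row_h (if h == g then
                   (1 - a) * lim (u g t y @[y --> x^'-]) + a * u g t x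
                 else u h t x)) 0 g.

(* [dphi] is the time derivative of [phi]; at time 0 it is one-sided, since the
   limit is taken in the half-line. *)
Definition test_function (phi dphi : halfline R -> R -> R) : Prop :=
  [/\ continuous (fun z : halfline R * R => phi z.1 z.2),
      compact (closure [set z : halfline R * R | phi z.1 z.2 != 0]),
      forall t x, (phi s x - phi t x) / (\val s - \val t) @[s --> t^'] --> dphi t x
    & continuous (fun z : halfline R * R => dphi z.1 z.2)].

Definition int_halfline (f : halfline R -> R) : R :=
  \int[lebesgue_measure]_(t in `[0, +oo[) f (to_halfline t).

Definition probabilistic_solution (u0 : 'I_d -> R -> R) u : Prop :=
  (forall g, measurable_fun [set z : R * R | 0 <= z.1]
     (fun z : R * R => u g (to_halfline z.1) z.2)) /\
  forall phi dphi : 'I_d -> halfline R -> R -> R,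
    (forall g, test_function (phi g) (dphi g)) ->
    \sum_g (int_halfline (fun t => \int[lebesgue_measure]_x (dphi g t x * u g t x))
            + \int[lebesgue_measure]_x (phi g (halfline0 R) x * u0 g x))
    = \sum_g int_halfline (fun t =>
        \int[lebesgue_stieltjes_measure (u g t)]_x (phi g t x * speed u g t x)).

End probabilistic_solution.

(* Main.v *)
(* Quantile coupling: to [v] in ]0, 1[ attach, for every type, the particle of rank
   [floor (n v)]. Sticky dynamics preserve the order inside a type, so positions are
   nondecreasing in [v], and velocities are bounded uniformly in [n]. Helly's selection
   theorem gives a subsequence along which, for [v] outside a countable set, the
   trajectories attached to [v] converge; the limit measure is the image of the uniform
   law on ]0, 1[ by the limit trajectories.

   Inside a cluster the total momentum is the integral of the speed at the current
   ranks, so the coupled particles satisfy an exact weak identity in which the rank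
   within the own type is [v] and the other ranks are empirical distribution functions.
   These converge at the particle [v] of type [g] at time [t] unless the limit law of
   another type has an atom there. By hyperbolicity two trajectories of different types
   meet at most once, hence by Fubini the exceptional set of [(t, v)] is negligible, and
   the identity passes to the limit. Finally the particles sitting at the same point
   have uniformly distributed ranks, so averaging the speed over them produces the
   integral over [theta] in the definition of a probabilistic solution. *)
Require Import Defs.
From HB Require Import structures.
From mathcomp Require Import all_boot all_order all_algebra.
From mathcomp Require Import all_classical all_reals all_analysis.
From mathcomp Require Import measurable_realfun.
From mathcomp Require Import lra ring zify.

Set Implicit Arguments.
Unset Strict Implicit.
Unset Printing Implicit Defensive.

Import Order.TTheory GRing.Theory Num.Theory.
Import numFieldNormedType.Exports.

(** * Sticky particles *)

Local Open Scope ring_scope.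

Section stable_blocks.
Context {R : realType} {n : nat}.
Implicit Types (x lb : 'rV[R]_n) (cl : 'I_n -> {set 'I_n}).

(** Collisions and meetings are followed only long enough to obtain a statement on a short interval
    to the right of each time: fixed clusters move freely there, and at strictly later times their
    momentum is the characteristic one. Every global fact (speed bounds, separation of types, the
    weak identity) is recovered from this one-sided information by real induction. The weak identity
    is read through tails: the integral of a continuous function against an empirical distribution
    function is the average over the particles of its primitive [tail]. That primitive is
    differentiable in the position, so the chain rule applies although distribution functions jump.
    In the limit, the null set of times at which ranks may fail to converge depends on the particle
    [v]; the flux is therefore integrated in time first, with [v] fixed. Convergence is extracted at
    rational times only, and a common Lipschitz constant carries it to all times and makes it
    locally uniform. In the last averaging, the inverse mass of an atom is unbounded, which forces a
    truncation. *)

Definition block (a b : nat) : {set 'I_n} := [set i : 'I_n | (a <= i < b)%N]%SET.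

(** The value 0 beyond [n] makes prefix sums total on [nat]. Blocks are half-open so that their sums
    are differences of prefix sums. *)
Definition entry lb (i : nat) : R := if insub i is Some k then lb 0 k else 0.

Definition prefix_sum lb (m : nat) : R := \sum_(0 <= i < m) entry lb i.

Lemma entry_ord lb (k : 'I_n) : entry lb k = lb 0 k.
Proof. by rewrite /entry valK. Qed.

Lemma sum_block lb (a b : nat) : (a <= b <= n)%N ->
  \sum_(k in block a b) lb 0 k = prefix_sum lb b - prefix_sum lb a.
Proof.
move=> /andP[ab bn].
rewrite (eq_bigl (fun k : 'I_n => (a <= k < b)%N)); last by move=> k; rewrite inE.
rewrite (eq_bigr (fun k : 'I_n => entry lb k)); last first.
  by move=> k _; rewrite entry_ord.
rewrite -(big_mkord (fun i => (a <= i < b)%N) (entry lb)).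
rewrite {1}/prefix_sum (big_cat_nat (n := a) (p := b))//= -/(prefix_sum lb a).
rewrite [X in _ = X - _]addrC addrK.
by rewrite (big_nat_widenl a 0)// (big_nat_widen _ b n)//.
Qed.

Lemma card_block (a b : nat) : (a <= b <= n)%N -> #|block a b| = (b - a)%N.
Proof.
move=> abn; apply/eqP; rewrite -(eqr_nat R); apply/eqP.
have := @sum_block (const_mx 1) a b abn.
rewrite (eq_bigr (fun=> 1)); last by move=> k _; rewrite mxE.
rewrite sumr_const => ->; move: abn => /andP[ab bn].
have P m : (m <= n)%N -> prefix_sum (const_mx 1 : 'rV[R]_n) m = m%:R.
  move=> mn; rewrite /prefix_sum big_nat (eq_bigr (fun=> 1)); last first.
    move=> i /= im; have ini : (i < n)%N by apply: leq_trans im _.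
    by rewrite -[i]/(nat_of_ord (Ordinal ini)) entry_ord mxE.
  by rewrite -big_nat big_const_nat subn0 iter_addr_0.
by rewrite !P ?natrB// (leq_trans ab).
Qed.

(** The graph of the prefix sums stays above its chord, whose slope [mu] is the average of the
    block. At a given point, the initial clusters are the faces of the greatest convex minorant of
    the prefix sums. *)
Definition above_chord lb (mu : R) (a b : nat) :=
  prefix_sum lb b = prefix_sum lb a + mu * (b%:R - a%:R) /\
  forall j, (a <= j <= b)%N ->
    prefix_sum lb a + mu * (j%:R - a%:R) <= prefix_sum lb j.

Lemma average_block lb mu a b : (a < b <= n)%N -> above_chord lb mu a b ->
  average lb (block a b) = mu.
Proof.
move=> /andP[ab bn] [E _]; rewrite /average sum_block ?bn ?(ltnW ab)//.
rewrite card_block ?bn ?(ltnW ab)// E addrAC subrr add0r natrB ?(ltnW ab)//.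
by rewrite mulfK// subr_eq0 eqr_nat gtn_eqF.
Qed.

(** The long chord has a slope between [mu2] and [mu1]. Issued from the left end of the first chord
    with a smaller slope, it stays below it; traced back from the right end of the second chord with
    a larger slope, it stays below that one too. *)
Lemma above_chord_union lb mu1 mu2 a b c d :
  (a <= c)%N -> (c <= b)%N -> (b <= d)%N -> (a < d)%N ->
  above_chord lb mu1 a b -> above_chord lb mu2 c d -> mu2 <= mu1 ->
  exists mu, above_chord lb mu a d.
Proof.
move=> ac cb bd ad [E1 C1] [E2 C2] mu21.
have ad' : 0 < d%:R - a%:R :> R by rewrite subr_gt0 ltr_nat.
pose mu := (prefix_sum lb d - prefix_sum lb a) / (d%:R - a%:R).
have Emu : prefix_sum lb d = prefix_sum lb a + mu * (d%:R - a%:R).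
  by rewrite /mu divfK ?gt_eqF// addrC subrK.
have acR : (a%:R <= c%:R :> R) by rewrite ler_nat.
have cbR : (c%:R <= b%:R :> R) by rewrite ler_nat.
have bdR : (b%:R <= d%:R :> R) by rewrite ler_nat.
have B2 := C2 b; rewrite cb bd in B2; have {}B2 := B2 isT.
have B1 := C1 c; rewrite ac cb in B1; have {}B1 := B1 isT.
have h1 : mu <= mu1.
  rewrite -(ler_pM2r ad').
  have : mu2 * (d%:R - b%:R) <= mu1 * (d%:R - b%:R) by rewrite ler_wpM2r// subr_ge0.
  lra.
have h2 : mu2 <= mu.
  rewrite -(ler_pM2r ad').
  have : mu2 * (c%:R - a%:R) <= mu1 * (c%:R - a%:R) by rewrite ler_wpM2r// subr_ge0.
  lra.
exists mu; split => // j /andP[aj jd].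
have ajR : (a%:R <= j%:R :> R) by rewrite ler_nat.
have jdR : (j%:R <= d%:R :> R) by rewrite ler_nat.
have [jb|bj] := leqP j b.
  have := C1 j; rewrite aj jb => /(_ isT); apply: le_trans.
  by rewrite lerD2l ler_wpM2r// subr_ge0.
have cj : (c <= j)%N by apply: leq_trans cb (ltnW bj).
have := C2 j; rewrite cj jd => /(_ isT).
have : mu2 * (d%:R - j%:R) <= mu * (d%:R - j%:R) by rewrite ler_wpM2r// subr_ge0.
lra.
Qed.

(** Over the overlap from [c] to [b] the prefix sums grow by at least [mu2] times the length, seen
    from the left end of the second chord, and by at most [mu1] times the length, seen from the
    right end of the first. Mere adjacency gives no such comparison, so adjacent clusters may
    part. *)
Lemma above_chord_overlap lb mu1 mu2 a b c d :
  (a <= c)%N -> (c < b)%N -> (b <= d)%N ->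
  above_chord lb mu1 a b -> above_chord lb mu2 c d -> mu2 <= mu1.
Proof.
move=> ac cb bd [E1 C1] [E2 C2].
have cbR : 0 < b%:R - c%:R :> R by rewrite subr_gt0 ltr_nat.
rewrite -(ler_pM2r cbR).
have B2 := C2 b; rewrite (ltnW cb) bd in B2; have {}B2 := B2 isT.
have B1 := C1 c; rewrite ac (ltnW cb) in B1; have {}B1 := B1 isT.
lra.
Qed.

Definition stable x lb (a b : nat) :=
  [/\ (a < b <= n)%N,
      forall i j : 'I_n, (a <= i < b)%N -> (a <= j < b)%N -> x 0 i = x 0 j
    & exists mu, above_chord lb mu a b].

(** Once denominators are cleared, comparing the two averages at the split [j] amounts to placing
    the point [j] of the graph above the chord; the end points lie on it. *)
Lemma above_chord_average lb (a b : nat) : (a < b <= n)%N ->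
  (exists mu, above_chord lb mu a b) <->
  (forall j, (a < j < b)%N ->
     average lb (block j b) <= average lb (block a j)).
Proof.
move=> /andP[ab bn].
have abR : 0 < b%:R - a%:R :> R by rewrite subr_gt0 ltr_nat.
have avgE p q : (p < q)%N -> (q <= n)%N -> average lb (block p q) =
    (prefix_sum lb q - prefix_sum lb p) / (q%:R - p%:R).
  move=> pq qn; rewrite /average sum_block ?qn ?(ltnW pq)//.
  by rewrite card_block ?qn ?(ltnW pq)// natrB ?(ltnW pq).
have key j : (a < j < b)%N ->
    average lb (block j b) <= average lb (block a j) <->
    (prefix_sum lb b - prefix_sum lb a) * (j%:R - a%:R) <=
    (prefix_sum lb j - prefix_sum lb a) * (b%:R - a%:R).
  move=> /andP[aj jb].
  have ajR : 0 < j%:R - a%:R :> R by rewrite subr_gt0 ltr_nat.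
  have jbR : 0 < b%:R - j%:R :> R by rewrite subr_gt0 ltr_nat.
  rewrite !avgE ?(leq_trans (ltnW jb))//.
  rewrite ler_pdivrMr// mulrAC ler_pdivlMr//.
  by split => H; lra.
split.
- move=> [mu [E C]] j ajb; apply/key => //.
  have := C j; case/andP : ajb => aj jb; rewrite (ltnW aj) (ltnW jb) => /(_ isT) H.
  rewrite E [X in X * _]addrAC subrr add0r mulrAC ler_wpM2r ?(ltW abR)//.
  by rewrite lerBrDl.
- move=> H.
  pose mu := (prefix_sum lb b - prefix_sum lb a) / (b%:R - a%:R).
  have Emu : prefix_sum lb b = prefix_sum lb a + mu * (b%:R - a%:R).
    by rewrite /mu divfK ?gt_eqF// addrC subrK.
  exists mu; split => // j /andP[].
  rewrite leq_eqVlt => /orP[/eqP <- _|aj]; first by rewrite subrr mulr0 addr0.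
  rewrite leq_eqVlt => /orP[/eqP ->|jb]; first by rewrite -Emu.
  have ajb : (a < j < b)%N by rewrite aj.
  have /key := H _ ajb => /(_ ajb).
  rewrite -lerBrDl -(ler_pM2r abR) mulrAC => h.
  apply: le_trans h; rewrite Emu; lra.
Qed.

Lemma stable_blockP x lb (C : {set 'I_n}) k : k \in C -> stable_block x lb C ->
  exists a b : nat, [/\ C = block a b, (a <= k < b)%N & stable x lb a b].
Proof.
move=> kC /existsP[a /existsP[b /and3P[/eqP CE /forallP xc /forallP ac]]].
have CE' : C = block a b.+1 by rewrite CE; apply/setP => i; rewrite !inE.
move: (kC); rewrite CE' inE => akb.
exists a, b.+1; split => //.
have ab1 : (a < b.+1 <= n)%N.
  by rewrite ltn_ord andbT; case/andP : akb => /leq_ltn_trans; apply.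
split => //.
- move=> i j ai aj; have := xc i; have := xc j.
  by rewrite CE' !inE ai aj => /eqP -> /eqP ->.
- apply/above_chord_average => // j /andP[aj jb].
  (* A split after the index [j.-1] for the closed intervals of [stable_block] is a split at [j] for
     half-open blocks. *)
  have jn : (j.-1 < n)%N by have := ltn_ord b; lia.
  have := ac (Ordinal jn) => /implyP /=.
  have -> : (a <= j.-1 < b)%N by lia.
  move=> /(_ isT).
  rewrite (_ : [set i : 'I_n | (j.-1 < i <= b)%N]%SET = block j b.+1); last first.
    by apply/setP => i; rewrite !inE; lia.
  rewrite (_ : [set i : 'I_n | (a <= i <= j.-1)%N]%SET = block a j)//.
  by apply/setP => i; rewrite !inE; lia.
Qed.

Lemma stable_stable_block x lb a b : stable x lb a b -> stable_block x lb (block a b).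
Proof.
move=> [/andP[ab bn] xc /above_chord_average ac].
have abn : (a < b <= n)%N by rewrite ab.
have {}ac := ac abn.
have an : (a < n)%N by apply: leq_trans ab bn.
have b1n : (b.-1 < n)%N by lia.
apply/existsP; exists (Ordinal an); apply/existsP; exists (Ordinal b1n) => /=.
apply/and3P; split.
- by apply/eqP/setP => i; rewrite !inE; lia.
- apply/forallP => i; apply/implyP; rewrite inE => ai; apply/eqP/xc => //=.
  by rewrite leqnn.
- apply/forallP => j; apply/implyP => /andP[aj jb].
  rewrite (_ : [set i : 'I_n | (j < i <= b.-1)%N]%SET = block j.+1 b); last first.
    by apply/setP => i; rewrite !inE; lia.
  rewrite (_ : [set i : 'I_n | (a <= i <= j)%N]%SET = block a j.+1); last first.
    by apply/setP => i; rewrite !inE.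
  by apply: ac; lia.
Qed.

Lemma stable1 x lb (k : 'I_n) : stable x lb k k.+1.
Proof.
split; first by rewrite ltnS leqnn ltn_ord.
- move=> i j; rewrite !ltnS -!eqn_leq => /eqP ki /eqP kj.
  by congr (x 0 _); apply/val_inj; rewrite /= -ki -kj.
- exists (prefix_sum lb k.+1 - prefix_sum lb k); split.
    by rewrite -natrB// subSnn mulr1 addrC subrK.
  move=> j /andP[]; rewrite leq_eqVlt => /orP[/eqP <- _|kj].
    by rewrite subrr mulr0 addr0.
  move=> jk; have -> : j = k.+1 by apply/eqP; rewrite eqn_leq jk.
  by rewrite -natrB// subSnn mulr1 addrC subrK.
Qed.

Lemma stable_overlap x lb a b c d (k : 'I_n) :
  stable x lb a b -> stable x lb c d -> (a <= k < b)%N -> (c <= k < d)%N ->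
  stable x lb (minn a c) (maxn b d).
Proof.
wlog ac : a b c d / (a <= c)%N.
  move=> H sab scd akb ckd; case: (leqP a c) => ac.
    by have := H _ _ _ _ ac sab scd akb ckd; rewrite (minn_idPl ac).
  have := H _ _ _ _ (ltnW ac) scd sab ckd akb.
  by rewrite (minn_idPl (ltnW ac)) maxnC.
move=> sab scd akb ckd; rewrite (minn_idPl ac).
case: (leqP d b) => [//|bd].
case: sab scd => [/andP[ab bn] xab [mu1 c1]] [/andP[cd dn] xcd [mu2 c2]].
split.
- by lia.
- have xk (i : 'I_n) : (a <= i < d)%N -> x 0 i = x 0 k.
    move=> /andP[ai id]; have [ib|bi] := ltnP i b.
      by apply: xab => //; rewrite ai.
    by apply: xcd => //; lia.
  by move=> i j ai aj; rewrite !xk.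
- apply: (@above_chord_union _ mu1 mu2 _ b c) => //; try lia.
  by apply: above_chord_overlap c1 c2; lia.
Qed.

(** The union of a competing stable block with the chosen one is admissible, hence has no more
    elements, which forces the competitor inside. *)
Lemma initial_clusterP x lb (k : 'I_n) : exists a b : nat,
  [/\ initial_cluster x lb k = block a b, (a <= k < b)%N, stable x lb a b
    & forall c d, stable x lb c d -> (c <= k < d)%N -> (a <= c)%N && (d <= b)%N].
Proof.
rewrite /initial_cluster; case: arg_maxnP.
  have -> : [set k]%SET = block k k.+1.
    by apply/setP => i; rewrite !inE ltnS -eqn_leq eq_sym.
  by rewrite stable_stable_block ?inE ?leqnn ?ltnSn//; exact: stable1.
move=> C /andP[sC kC] maxC.
have [a [b [CE akb sab]]] := stable_blockP kC sC.
exists a, b; split => // c d scd ckd.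
have := stable_overlap sab scd akb ckd => su.
have := maxC (block (minn a c) (maxn b d)).
rewrite stable_stable_block// inE.
have -> : (minn a c <= k < maxn b d)%N by lia.
move=> /(_ isT); rewrite CE.
by case: sab su => abn _ _ [] acbd _ _; rewrite /= !card_block; lia.
Qed.

Definition partition_map cl :=
  (forall k, k \in cl k) /\ (forall k l, l \in cl k -> cl l = cl k).

Lemma initial_cluster_partition x lb : partition_map (initial_cluster x lb).
Proof.
split => [k|k l].
  by have [a [b [-> akb _ _]]] := initial_clusterP x lb k; rewrite inE.
have [a [b [-> akb sab maxk]]] := initial_clusterP x lb k.
have [c [d [-> cld scd maxl]]] := initial_clusterP x lb l.
rewrite inE => alb; have := maxl _ _ sab alb => /andP[ca bd].
have ckd : (c <= k < d)%N by lia.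
have := maxk _ _ scd ckd => /andP[ac db].
by congr block; lia.
Qed.

Lemma initial_cluster_pos x lb (k l : 'I_n) :
  l \in initial_cluster x lb k -> x 0 l = x 0 k.
Proof.
have [a [b [-> akb [_ xc _] _]]] := initial_clusterP x lb k.
by rewrite inE => alb; exact: xc.
Qed.

(** If the averages did not increase strictly, [above_chord_union] would join the two adjacent
    blocks into a stable block around [k], against maximality. *)
Lemma initial_cluster_succ x lb (k l : 'I_n) : l = k.+1 :> nat ->
  x 0 k = x 0 l -> initial_cluster x lb k != initial_cluster x lb l ->
  average lb (initial_cluster x lb k) < average lb (initial_cluster x lb l).
Proof.
have [a [b [-> akb sab maxk]]] := initial_clusterP x lb k.
have [c [d [-> cld scd maxl]]] := initial_clusterP x lb l.
move=> lk xkl ne.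
have bl : b = l.
  apply/eqP; rewrite eqn_leq; apply/andP; split; last by lia.
  rewrite leqNgt; apply/negP => lb'.
  have alb : (a <= l < b)%N by lia.
  have /andP[ca bd] := maxl _ _ sab alb.
  have ckd : (c <= k < d)%N by lia.
  have /andP[ac db] := maxk _ _ scd ckd.
  by move/eqP : ne; apply; congr block; lia.
have cl' : c = l.
  apply/eqP; rewrite eqn_leq; apply/andP; split; first by lia.
  rewrite leqNgt; apply/negP => lb'.
  have ckd : (c <= k < d)%N by lia.
  have /andP[ac db] := maxk _ _ scd ckd.
  lia.
have [abn xab [mu1 C1]] := sab; have [cdn xcd [mu2 C2]] := scd.
rewrite (average_block abn C1) (average_block cdn C2) ltNge; apply/negP => mu21.
have sad : stable x lb a d.
  split; first by lia.
  - have xk (i : 'I_n) : (a <= i < d)%N -> x 0 i = x 0 k.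
      move=> /andP[ai id]; have [ib|bi] := ltnP i b.
        by apply: xab => //; rewrite ai.
      by rewrite xkl; apply: xcd => //; lia.
    by move=> i j ai aj; rewrite !xk.
  - by apply: (@above_chord_union _ mu1 mu2 _ b c) => //; lia.
have adk : (a <= k < d)%N by lia.
by have /andP[] := maxk _ _ sad adk; lia.
Qed.

(** As [x] is ordered, all particles between [k] and [l] sit at the same point, and the comparison
    of neighbouring clusters chains. *)
Lemma initial_cluster_lt x lb (k l : 'I_n) : ordered x -> (k < l)%N ->
  x 0 k = x 0 l -> initial_cluster x lb k != initial_cluster x lb l ->
  average lb (initial_cluster x lb k) < average lb (initial_cluster x lb l).
Proof.
move=> ox kl xkl ne.
suff H m (mn : (m < n)%N) : (k <= m)%N -> x 0 (Ordinal mn) = x 0 k ->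
    average lb (initial_cluster x lb k) <
      average lb (initial_cluster x lb (Ordinal mn)) \/
    initial_cluster x lb k = initial_cluster x lb (Ordinal mn).
  have := H l (ltn_ord l) (ltnW kl).
  have -> : Ordinal (ltn_ord l) = l by exact: val_inj.
  by move=> /(_ (esym xkl))[//|] /eqP E; rewrite E in ne.
elim: m mn => [|m IH] mn km xm.
  by right; congr initial_cluster; apply/val_inj => /=; move: km; rewrite leqn0 => /eqP.
have [km'|{}km] : nat_of_ord k = m.+1 \/ (k <= m)%N.
  by move: km; rewrite leq_eqVlt => /orP[/eqP|]; [left|right].
  by right; congr initial_cluster; apply/val_inj.
have mn' : (m < n)%N by exact: ltnW.
have xm' : x 0 (Ordinal mn') = x 0 k.
  apply/eqP; rewrite eq_le; apply/andP; split; last by apply: ox => /=; lia.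
  by rewrite -xm; apply: ox => /=; lia.
have H := IH mn' km xm'.
have [<-//|e] := eqVneq (initial_cluster x lb (Ordinal mn'))
  (initial_cluster x lb (Ordinal mn)).
have lt1 : average lb (initial_cluster x lb (Ordinal mn')) <
    average lb (initial_cluster x lb (Ordinal mn)).
  by apply: initial_cluster_succ => //; rewrite xm xm'.
by left; case: H => [/lt_trans|->]; [apply|].
Qed.

End stable_blocks.

(** * Free motion, collisions and merging of one type *)

Section sticky_dynamics.
Context {R : realType} {n : nat}.
Implicit Types (x lb y : 'rV[R]_n) (cl : 'I_n -> {set 'I_n}).

(** Invariant of the algorithm. Distinct clusters may share a point only if their velocities make
    them part at once in the right order: this happens at time 0, and after a merge the clause is
    vacuous. *)
Definition separated lb x cl := [/\ partition_map cl,
  forall k l, l \in cl k -> x 0 l = x 0 k,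
  forall k l : 'I_n, (k < l)%N -> x 0 k = x 0 l -> cl k != cl l ->
    average lb (cl k) < average lb (cl l)
  & ordered x].

(** A nonzero affine function has at most one root, which leaves a root-free interval just after
    [s]; the point [s] itself is excluded. *)
Lemma affine_root (a b s : R) : a != 0 \/ b != 0 ->
  exists2 e, 0 < e & forall t, s < t < s + e -> a + t * b != 0.
Proof.
move=> ab; have [b0|b0] := eqVneq b 0.
  exists 1 => // t _; rewrite b0 mulr0 addr0.
  by case: ab => //; rewrite b0 eqxx.
have ab0 t : a + t * b = 0 -> t = - a / b.
  by move/eqP; rewrite addr_eq0 => /eqP ->; rewrite opprK mulfK.
have [h|h] := leP (- a / b) s.
  exists 1 => // t /andP[st _]; apply/negP => /eqP/ab0 E.
  by rewrite -E leNgt st in h.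
exists (- a / b - s); first by rewrite subr_gt0.
move=> t /andP[_ ts]; apply/negP => /eqP/ab0 E.
by rewrite -E addrC subrK ltxx in ts.
Qed.

Lemma finite_positive_bound (I : finType) (P : I -> R -> Prop) :
  (forall i, exists2 e, 0 < e & P i e) ->
  (forall i e e', 0 < e' <= e -> P i e -> P i e') ->
  exists2 e, 0 < e & forall i, P i e.
Proof.
move=> H mono.
have /(@boolp.choice _ _ (fun i e => 0 < e /\ P i e)) [f Hf] :
    forall i, exists e, 0 < e /\ P i e.
  by move=> i; have [e e0 Pe] := H i; exists e.
exists (\big[Num.min/1]_i f i).
  by apply: lt_bigmin => // i _; case: (Hf i).
move=> i; have [fi0 Pi] := Hf i; apply: mono Pi.
rewrite bigmin_le_cond// andbT.
by apply: lt_bigmin => // j _; case: (Hf j).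
Qed.

Lemma separated_affine lb x cl (k l : 'I_n) : separated lb x cl ->
  cl k != cl l ->
  x 0 l - x 0 k != 0 \/ average lb (cl l) - average lb (cl k) != 0.
Proof.
move=> [pcl _ strict _] ne; have [e|e] := eqVneq (x 0 l - x 0 k) 0; last by left.
right; have kl : k != l by apply: contraNneq ne => ->.
move/eqP : e; rewrite subr_eq0 => /eqP e; rewrite subr_eq0.
move: kl; rewrite neq_ltn => /orP[kl|lk].
  by rewrite gt_eqF// strict.
by rewrite lt_eqF// strict// eq_sym.
Qed.

(** Each of the finitely many pairs of clusters meets at most once after time 0, so some interval
    just after [s] is free of collisions. An infimum that is not attained would then exceed [s]; in
    particular it cannot be 0. *)
Lemma collision_attained lb x cl s : separated lb x cl ->
  collision_time x (velocity lb cl) cl = s%:E ->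
  0 < s /\ exists k l, cl k != cl l /\
    x 0 k + s * velocity lb cl 0 k = x 0 l + s * velocity lb cl 0 l.
Proof.
move=> sep Es; have s0 : 0 <= s by rewrite -lee_fin -Es collision_time_ge0.
apply: contrapT => ncol.
have [||e e0 He] := @finite_positive_bound ('I_n * 'I_n)%type
  (fun p e => cl p.1 != cl p.2 -> forall t, s < t < s + e ->
    x 0 p.1 + t * velocity lb cl 0 p.1 <> x 0 p.2 + t * velocity lb cl 0 p.2).
- move=> [k l] /=; have [E|ne] := eqVneq (cl k) (cl l).
    by exists 1.
  have [e e0 He] := @affine_root _ _ s (separated_affine sep ne).
  exists e => // _ t ste; have := He _ ste; rewrite !mxE => /eqP h E; apply: h.
  by move: E; rewrite mulrBr; lra.
- move=> [k l] e e' /andP[e'0 ee] /= H ne t /andP[st te]; apply: H => //.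
  by rewrite st (lt_le_trans te)// lerD2l.
have : ((s + e)%:E <= collision_time x (velocity lb cl) cl)%E.
  apply: le_ereal_inf_tmp => _ /= [t [t0 [k [l [ne E]]]] <-].
  have st : s <= t.
    rewrite -lee_fin -Es; apply: ereal_inf_lbound => /=.
    by exists t => //; split => //; exists k, l.
  rewrite lee_fin leNgt; apply/negP => te.
  have [ts|nts] := eqVneq s t.
    by apply: ncol; rewrite ts; split => //; exists k, l.
  by apply: (He (k, l) ne t) => //; rewrite lt_neqAle nts st.
by rewrite Es lee_fin gerDl leNgt e0.
Qed.

Lemma free_ordered lb x cl t : separated lb x cl -> 0 <= t ->
  (t%:E <= collision_time x (velocity lb cl) cl)%E ->
  ordered (x + t *: velocity lb cl).
Proof.
move=> sep t0 ts k l kl; have [pcl same strict ox] := sep; rewrite !mxE.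
have [e|ne] := eqVneq (cl k) (cl l).
  by rewrite e (same l k)// -e; case: pcl.
have {}kl : (k < l)%N.
  by rewrite ltn_neqAle kl andbT; apply: contraNneq ne => /val_inj ->.
rewrite leNgt; apply/negP => lt.
have := ox k l (ltnW kl); rewrite le_eqVlt => /orP[/eqP e|xkl].
  have := strict k l kl e ne => avg; move: lt; rewrite e ltrD2l ltNge.
  by rewrite ler_wpM2l// ltW.
set a := average lb (cl k) in lt *; set b := average lb (cl l) in lt *.
have tgt : 0 < t by rewrite lt_neqAle t0 andbT; apply/eqP => t00; nra.
have ba : 0 < a - b.
  by rewrite -(pmulr_lgt0 _ tgt); lra.
(* If the order is broken at [t], the two clusters crossed at time [r], a collision strictly before
   [t]. *)
pose r := (x 0 l - x 0 k) / (a - b).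
have r0 : 0 < r by rewrite divr_gt0// subr_gt0.
have rt : r < t by rewrite ltr_pdivrMr//; lra.
suff : (collision_time x (velocity lb cl) cl <= r%:E)%E.
  by move=> h; have := le_trans ts h; rewrite lee_fin leNgt rt.
apply: ereal_inf_lbound => /=; exists r => //; split => //; exists k, l; split => //.
rewrite !mxE -/a -/b; have : r * (a - b) = x 0 l - x 0 k.
  by rewrite divfK// gt_eqF.
by rewrite mulrBr; lra.
Qed.

Lemma free_same_position lb x cl t (k l : 'I_n) : separated lb x cl ->
  l \in cl k -> (x + t *: velocity lb cl) 0 l = (x + t *: velocity lb cl) 0 k.
Proof.
by move=> [[_ pcl] same _ _] lk; rewrite !mxE (same k l)// (pcl k l).
Qed.

Lemma mergeE y cl (k : 'I_n) : partition_map cl ->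
  (forall k l, l \in cl k -> y 0 l = y 0 k) ->
  Defs.merge y cl k = [set l | y 0 l == y 0 k]%SET.
Proof.
move=> [p _] same; apply/setP => m; rewrite inE; apply/bigcupP/idP.
  by move=> [l /eqP <- ml]; apply/eqP/same.
by move=> mk; exists m.
Qed.

Lemma merge_separated lb y cl : partition_map cl -> ordered y ->
  (forall k l, l \in cl k -> y 0 l = y 0 k) -> separated lb y (Defs.merge y cl).
Proof.
move=> pcl oy same; split => //.
- split => k; first by rewrite mergeE// inE.
  by move=> l; rewrite !mergeE// inE => /eqP ->.
- by move=> k l; rewrite mergeE// inE => /eqP.
- by move=> k l _ e; rewrite !mergeE// e eqxx.
Qed.

Lemma card_merge y cl (k l : 'I_n) : partition_map cl ->
  (forall k l, l \in cl k -> y 0 l = y 0 k) ->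
  cl k != cl l -> y 0 k = y 0 l ->
  (#|[set Defs.merge y cl i | i : 'I_n]| < #|[set cl i | i : 'I_n]|)%N.
Proof.
move=> pcl same ne ykl.
(* New clusters are the images of old ones under [h], which identifies the clusters of [k] and [l];
   a map that is not injective strictly lowers the cardinal. *)
pose h (C : {set 'I_n}) := (\bigcup_(m in C) Defs.merge y cl m)%SET.
have hE i : h (cl i) = Defs.merge y cl i.
  apply/setP => m; rewrite mergeE// inE; apply/bigcupP/idP.
    by move=> [j ji]; rewrite mergeE// inE => /eqP ->; apply/eqP/same.
  by move=> /eqP mi; exists i; [case: pcl|rewrite mergeE// inE mi].
have -> : [set Defs.merge y cl i | i : 'I_n]%SET = [set h C | C in [set cl i | i : 'I_n]]%SET.
  apply/setP => C; apply/imsetP/imsetP => [[i _ ->]|[_ /imsetP[i _ ->] ->]].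
    by exists (cl i) => //; exact: imset_f.
  by exists i.
rewrite ltn_neqAle leq_imset_card andbT; apply/negP => /imset_injP inj.
move/eqP : ne; apply; apply: inj; rewrite ?imset_f// !hE !mergeE//.
by rewrite ykl.
Qed.

Lemma one_cluster_collision_time lb x cl : (#|[set cl i | i : 'I_n]| <= 1)%N ->
  collision_time x (velocity lb cl) cl = +oo%E.
Proof.
move=> c1; apply/eqP; rewrite -leye_eq.
apply: le_ereal_inf_tmp => _ /= [t [t0 [k [l [ne _]]]] <-].
exfalso; move/eqP : ne; apply.
by have /card_le1_eqP H := c1; rewrite (H (cl k) (cl l)) ?imset_f.
Qed.

(** Looking only to the right of [t] makes the statement insensitive to a collision at [t] itself,
    and independent of the number of past collisions. *)
Definition locally_clustered lb (y : R -> 'rV[R]_n) t :=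
  exists2 e, 0 < e & exists2 cl, partition_map cl &
    (forall k l, l \in cl k -> y t 0 l = y t 0 k) /\
    forall s, 0 <= s <= e -> y (t + s) = y t + s *: velocity lb cl.

Lemma free_locally_clustered lb x cl t : separated lb x cl -> 0 <= t ->
  (t%:E < collision_time x (velocity lb cl) cl)%E ->
  exists2 e, 0 < e & (forall s, 0 <= s <= e ->
    ((t + s)%:E < collision_time x (velocity lb cl) cl)%E).
Proof.
move=> sep t0; case: collision_time => [s| |]//; last first.
  by move=> _; exists 1 => // s _; rewrite ltry.
rewrite lte_fin => ts; exists ((s - t) / 2); first by rewrite divr_gt0// subr_gt0.
by move=> r /andP[r0 rs]; rewrite lte_fin; lra.
Qed.

(** Each collision removes at least one cluster and a single cluster never collides, so [fuel]
    collisions suffice for at most [fuel.+1] clusters. *)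
Lemma spd_rec_local fuel lb x cl t : separated lb x cl ->
  (#|[set cl i | i : 'I_n]| <= fuel.+1)%N -> 0 <= t ->
  ordered (spd_rec fuel lb x cl t) /\ locally_clustered lb (spd_rec fuel lb x cl) t.
Proof.
have free x' cl' t' (y : R -> 'rV[R]_n) : separated lb x' cl' -> 0 <= t' ->
    (t'%:E < collision_time x' (velocity lb cl') cl')%E ->
    (forall t, (t%:E < collision_time x' (velocity lb cl') cl')%E ->
       y t = x' + t *: velocity lb cl') ->
    ordered (y t') /\ locally_clustered lb y t'.
  move=> sep t0 ts yE; split; first by rewrite yE//; exact: free_ordered (ltW ts).
  have [e e0 He] := free_locally_clustered sep t0 ts.
  exists e => //; exists cl'; first by case: sep.
  split; first by move=> k l lk; rewrite yE//; exact: (free_same_position _ sep).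
  by move=> s se; rewrite !yE ?He// scalerDl addrA.
elim: fuel x cl t => [|fuel IH] x cl t sep card_cl t0.
  by apply: (free x cl) => //=; rewrite one_cluster_collision_time// ltry.
have [ts|st] := ltP t%:E (collision_time x (velocity lb cl) cl).
  by apply: (free x cl) => //= r ->.
case Es : collision_time st => [s| |]//; last first.
  by have := collision_time_ge0 x (velocity lb cl) cl; rewrite Es.
rewrite lee_fin => st.
have [s0 [k [l [ne kl]]]] := collision_attained sep Es.
set y := x + s *: velocity lb cl.
have oy : ordered y by apply: free_ordered; rewrite ?Es// ltW.
have same i j : j \in cl i -> y 0 j = y 0 i by exact: free_same_position.
have pcl : partition_map cl by case: sep.
have card_m : (#|[set Defs.merge y cl i | i : 'I_n]| <= fuel.+1)%N.
  rewrite -ltnS; apply: leq_trans card_cl; apply: (card_merge (k := k) (l := l)) => //.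
  by move: kl; rewrite !mxE.
have ts0 : 0 <= t - s by rewrite subr_ge0.
have [IH1 IH2] := IH _ _ _ (merge_separated lb pcl oy same) card_m ts0.
have recE r : s <= r ->
    spd_rec fuel.+1 lb x cl r = spd_rec fuel lb y (Defs.merge y cl) (r - s).
  by move=> sr /=; rewrite Es lte_fin ltNge sr.
rewrite recE//; split => //.
have [e e0 [cl' pcl' [same' mv]]] := IH2.
exists e => //; exists cl' => //; split; first by move=> i j ij; rewrite recE//; exact: same'.
move=> r /andP[r0 re]; rewrite !recE//; last by rewrite ler_wpDr.
by rewrite addrAC mv// r0.
Qed.

Lemma initial_cluster_separated lb x : ordered x ->
  separated lb x (initial_cluster x lb).
Proof.
move=> ox; split => //; first exact: initial_cluster_partition.
- exact: initial_cluster_pos.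
- by move=> k l; exact: initial_cluster_lt.
Qed.

Lemma spd_local lb x t : ordered x -> 0 <= t ->
  ordered (spd lb x t) /\ locally_clustered lb (spd lb x) t.
Proof.
move=> ox t0; apply: spd_rec_local => //; first exact: initial_cluster_separated.
by rewrite leqW// (leq_trans (leq_imset_card _ _))// card_ord.
Qed.

End sticky_dynamics.

(** * The multitype dynamics is locally characteristic *)

Local Open Scope classical_set_scope.
Local Open Scope ring_scope.

(** * Global extension of the speeds and gaps between types *)

Section hyperbolic_extension.
Context {R : realType} {d : nat}.
Implicit Types (u : 'rV[R]_d) (lam : 'rV[R]_d -> 'rV[R]_d).

(** Projection onto the cube, coordinate by coordinate. Composing [lam] with it gives functions
    continuous on the whole space that take only values of [lam] on the cube, so that bounds need no
    side condition. *)
Definition clamp u : 'rV[R]_d := \row_h Num.min 1 (Num.max 0 (u 0 h)).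

Lemma clamp_cube u : @unit_cube R d (clamp u).
Proof.
by move=> g; rewrite mxE le_min ler01 le_max lexx/= ge_min lexx.
Qed.

Lemma clamp_id u : unit_cube u -> clamp u = u.
Proof.
move=> cu; apply/rowP => h; rewrite mxE; have /andP[u0 u1] := cu h.
by rewrite (max_idPr u0) (min_idPr u1).
Qed.

Lemma clamp_continuous : continuous clamp.
Proof.
apply: mx_continuous => i j; under eq_fun do rewrite mxE.
apply: (@min_fun_continuous _ _ R (fun=> 1) (fun u => Num.max 0 (u 0 j))).
  exact: cst_continuous.
apply: (@max_fun_continuous _ _ R (fun=> 0) (fun u => u 0 j)).
  exact: cst_continuous.
exact: coord_continuous.
Qed.

Lemma clamp_extension lam : {within unit_cube, continuous lam} ->
  forall g, continuous (fun u => lam (clamp u) 0 g).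
Proof.
move=> lc g u.
apply: (@continuous_comp _ _ _ (lam \o clamp) (fun v : 'rV[R]_d => v 0 g)).
  move=> A /= Alam; have /subspace_continuousP/(_ _ (clamp_cube u)) := lc.
  move=> /(_ _ Alam); rewrite /nbhs/= /within/= => H.
  have := @clamp_continuous u _ H => H'.
  by apply: (@filterS _ (nbhs u) _ _ _ _ H') => v /=; apply; exact: clamp_cube.
exact: coord_continuous.
Qed.

Lemma unit_cube_compact : compact (@unit_cube R d).
Proof.
have := @rV_compact R d (fun=> `[0, 1]%classic) (fun=> @segment_compact R 0 1).
congr compact; apply/seteqP; split => u H i; have := H i; by rewrite /= in_itv.
Qed.

Lemma unit_cube0 : @unit_cube R d 0.
Proof. by move=> g; rewrite mxE lexx ler01. Qed.

(** Compactness of the cube makes the extrema real numbers. The gap, assumed for consecutive types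
    only, propagates to all [g < h] because each intermediate infimum is below the corresponding
    supremum. *)
Lemma hyperbolic_bounds lam : {within unit_cube, continuous lam} ->
  uniformly_strictly_hyperbolic lam ->
  exists (A B : 'I_d -> R) (L : R), [/\ 0 < L,
    forall g u, unit_cube u -> A g <= lam u 0 g <= B g
  & forall g h : 'I_d, (g < h)%N -> B h + L <= A g].
Proof.
move=> lc [L L0 ush].
have bnd g : bounded_set [set lam (clamp u) 0 g | u in @unit_cube R d].
  apply: (@compact_bounded R R^o); apply: continuous_compact; last exact: unit_cube_compact.
  by apply: continuous_subspaceT; exact: clamp_extension.
have /choice[M HM] : forall g, exists M, forall u, unit_cube u -> `|lam u 0 g| <= M.
  move=> g; have [M [_ HM]] := bnd g; exists (M + 1) => u cu.
  by apply: HM; [rewrite ltrDl|exists u => //; rewrite clamp_id].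
pose S g := [set lam u 0 g | u in @unit_cube R d].
have hs g : has_sup (S g).
  split; first by exists (lam 0 0 g); exists 0 => //; exact: unit_cube0.
  by exists (M g) => _ [u cu <-]; apply: le_trans (HM g u cu); exact: ler_norm.
have hi g : has_inf (S g).
  split; first by exists (lam 0 0 g); exists 0 => //; exact: unit_cube0.
  by exists (- M g) => _ [u cu <-]; rewrite lerNl (le_trans _ (HM g u cu))// -normrN ler_norm.
have AB g u : unit_cube u -> inf (S g) <= lam u 0 g <= sup (S g).
  move=> cu; apply/andP; split.
    by apply: ge_inf; [case: (hi g)|exists u].
  by apply: sup_upper_bound => //; exists u.
have step (g h : 'I_d) u u' : h = g.+1 :> nat -> unit_cube u -> unit_cube u' ->
    lam u' 0 h + L <= lam u 0 g.
  move=> hg cu cu'; have := ush g h hg.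
  set a := ereal_inf _; set b := ereal_sup _ => Lab.
  have ha : (a <= (lam u 0 g)%:E)%E by apply: ereal_inf_lbound; exists u.
  have hb : ((lam u' 0 h)%:E <= b)%E by apply: ereal_sup_ubound; exists u'.
  have := le_trans Lab (leeB ha hb).
  by rewrite -EFinB lee_fin lerBrDr addrC.
have stepS (g h : 'I_d) : h = g.+1 :> nat -> sup (S h) + L <= inf (S g).
  move=> hg; rewrite -lerBrDr; apply: ge_sup; first by case: (hs h).
  move=> _ [u' cu' <-]; rewrite lerBrDr; apply: lb_le_inf; first by case: (hi g).
  by move=> _ [u cu <-]; exact: step.
exists (fun g => inf (S g)), (fun g => sup (S g)), L; split => //.
move=> g h; move: h => [m md] /=; elim: m md => [//|m IH] md gm.
have md' : (m < d)%N by exact: ltnW.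
have := @stepS (Ordinal md') (Ordinal md) erefl => H.
have [gm'|gm'] : nat_of_ord g = m \/ (g < m)%N.
  by move: gm; rewrite ltnS leq_eqVlt => /orP[/eqP|]; [left|right].
  by have -> : g = Ordinal md' by apply/val_inj.
have := IH md' gm'; apply: le_trans; apply: (le_trans H).
have /andP[h1 h2] := AB (Ordinal md') 0 unit_cube0.
by apply: le_trans h1 (le_trans h2 _); rewrite lerDl ltW.
Qed.

End hyperbolic_extension.

Section real_induction.
Context {R : realType}.

(* Real induction: the set of times up to which the inequality holds is closed,
   and open to the right. *)
Lemma right_slope_increasing (f : R -> R) (c a b : R) : continuous f -> a <= b ->
  (forall t, a <= t < b -> exists2 e, 0 < e &
     forall s, 0 <= s <= e -> f t + c * s <= f (t + s)) ->
  f a + c * (b - a) <= f b.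
Proof.
move=> cf ab loc.
pose S := [set t | a <= t <= b /\ forall r, a <= r <= t -> f a + c * (r - a) <= f r].
have Sa : S a.
  split; first by rewrite lexx ab.
  move=> r /andP[ar ra]; have -> : r = a by apply/eqP; rewrite eq_le ar ra.
  by rewrite subrr mulr0 addr0.
have hs : has_sup S by split; [exists a|exists b => t [/andP[]]].
have aS : a <= sup S by exact: sup_upper_bound.
have Sb : sup S <= b by apply: ge_sup; [exists a|move=> t [/andP[]]].
have below r : a <= r < sup S -> f a + c * (r - a) <= f r.
  move=> /andP[ar rS]; have [t [_ Ht] rt] := sup_gt hs.1 rS.
  by apply: Ht; rewrite ar ltW.
have SS : f a + c * (sup S - a) <= f (sup S).
  rewrite leNgt; apply/negP => lt.
  have aS' : a < sup S.
    by rewrite lt_neqAle aS andbT; apply: contraTneq lt => <-; rewrite subrr mulr0 addr0 ltxx.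
  pose h r := f r - (f a + c * (r - a)).
  have ch : {for sup S, continuous h}.
    apply: cvgB; first exact: cf.
    apply: cvgD; first exact: cvg_cst.
    apply: cvgM; first exact: cvg_cst.
    by apply: cvgB; [exact: cvg_id|exact: cvg_cst].
  have h0 : h (sup S) < 0 by rewrite subr_lt0.
  have : \forall r \near sup S, h r < 0.
    exact: (cvgr_lt (h (sup S)) ch).
  move=> /nbhs_ballP[e /= e0 He].
  pose r := Num.max a (sup S - e / 2).
  have rS : r < sup S by rewrite gt_max aS'/= ltrBlDr ltrDl divr_gt0.
  have ar : a <= r by rewrite le_max lexx.
  have := below r; rewrite ar rS => /(_ isT); apply/negP; rewrite -ltNge -subr_lt0.
  apply: He; rewrite /ball/= ger0_norm ?subr_ge0 ?(ltW rS)//.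
  have : sup S - e / 2 <= r by rewrite le_max lexx orbT.
  lra.
have [<-//|ne] := eqVneq (sup S) b.
have Sb' : sup S < b by rewrite lt_neqAle ne.
have := loc (sup S); rewrite aS Sb' => /(_ isT)[e e0 He].
pose e' := Num.min e (b - sup S).
have e'0 : 0 < e' by rewrite lt_min e0 subr_gt0.
suff : S (sup S + e').
  move=> /(sup_upper_bound hs); rewrite gerDl leNgt.
  by rewrite e'0.
split.
  rewrite ler_wpDr ?(ltW e'0)//=.
  have : e' <= b - sup S by rewrite ge_min lexx orbT.
  lra.
move=> r /andP[ar re]; have [rS|Sr] := ltP r (sup S); first by apply: below; rewrite ar.
have := He (r - sup S).
have -> : 0 <= r - sup S <= e.
  rewrite subr_ge0 Sr/=.
  have : e' <= e by rewrite ge_min lexx.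
  lra.
by move=> /(_ isT); rewrite [sup S + _]addrC subrK; lra.
Qed.

End real_induction.

Section interval_average.
Context {R : realType}.
Notation mu := (@lebesgue_measure R).

Lemma continuous_itv_integrable (f : R -> R) (a b : R) : continuous f ->
  mu.-integrable `[a, b] (EFin \o f).
Proof.
move=> cf; apply: continuous_compact_integrable; first exact: segment_compact.
exact: continuous_subspaceT.
Qed.

Lemma itv_integral_bounds (f : R -> R) (a b A B : R) : continuous f -> a <= b ->
  (forall w, w \in `[a, b] -> A <= f w <= B) ->
  A * (b - a) <= \int[mu]_(w in `[a, b]) f w <= B * (b - a).
Proof.
move=> cf ab bd.
have cst c : \int[mu]_(w in `[a, b]) c = c * (b - a).
  rewrite Rintegral_cst//= lebesgue_measure_itv/= lte_fin.
  by case: ltP => // ba; rewrite /= (le_anti (introT andP (conj ab ba))) subrr.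
rewrite -(cst A) -(cst B); apply/andP; split; apply: le_Rintegral => //.
- by apply: continuous_itv_integrable => ?; exact: cvg_cst.
- exact: continuous_itv_integrable.
- by move=> w /bd/andP[].
- exact: continuous_itv_integrable.
- by apply: continuous_itv_integrable => ?; exact: cvg_cst.
- by move=> w /bd/andP[].
Qed.

Lemma slice_bounds (f : R -> R) n (k : 'I_n) (A B : R) : continuous f ->
  (forall w, A <= f w <= B) ->
  A <= n%:R * \int[mu]_(w in `[k%:R / n%:R, k.+1%:R / n%:R]) f w <= B.
Proof.
move=> cf fAB.
have n0 : 0 < n%:R :> R by rewrite ltr0n; exact: leq_ltn_trans (ltn_ord k).
set a := k%:R / n%:R; set b := k.+1%:R / n%:R.
have ba : n%:R * (b - a) = 1.
  by rewrite /b /a -mulrBl -natrB// subSnn mulrC divfK ?gt_eqF.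
have ab : a <= b by rewrite ler_pM2r ?invr_gt0// ler_nat.
have /andP[] := itv_integral_bounds cf ab (fun w _ => fAB w).
set J := Rintegral _ _ _; move=> h1 h2; apply/andP; split.
  by move: h1; rewrite -(ler_pM2l n0) mulrCA ba mulr1.
by move: h2; rewrite -(ler_pM2l n0) mulrCA ba mulr1.
Qed.

End interval_average.

(** * Separation of types, ranks and momentum along the multitype dynamics *)

Section multitype_dynamics.
Context {R : realType} {d : nat}.
Variables (lam : 'rV[R]_d -> 'rV[R]_d) (F : 'I_d -> 'rV[R]_d -> R).
Variables (A B : 'I_d -> R) (L : R).
Hypothesis F_cont : forall g, continuous (F g).
Hypothesis F_lam : forall g u, unit_cube u -> F g u = lam u 0 g.
Hypothesis F_bd : forall g u, A g <= F g u <= B g.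
Hypothesis L0 : 0 < L.
Hypothesis AB_sep : forall g h : 'I_d, (g < h)%N -> B h + L <= A g.
Context {n : nat}.
Implicit Types (x y : 'M[R]_(d, n)) (g h : 'I_d) (k l : 'I_n).
Notation mu := (@lebesgue_measure R).

(** Ties are counted for every type, as a distribution function does, whereas [omega] counts them
    only for the slower types. The two conventions agree after a positive time, see [omega_rank]. *)
Definition rank y (z : R) h : R := #|[set l | (y h l <= z)%R]%SET|%:R / n%:R.

Definition ranks y g (z w : R) : 'rV[R]_d :=
  \row_h (if h == g then w else rank y z h).

Definition char_speed y g k : R :=
  n%:R * \int[mu]_(w in `[k%:R / n%:R, k.+1%:R / n%:R]) F g (ranks y g (y g k) w).

Lemma row_continuous (f : R -> 'rV[R]_d) :
  (forall h, continuous (fun w => f w 0 h)) -> continuous f.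
Proof. by move=> H; apply: mx_continuous => i j; rewrite (ord1 i). Qed.

Lemma replace_continuous g (r : 'I_d -> R) :
  continuous (fun w => \row_h (if h == g then w else r h) : 'rV[R]_d).
Proof.
apply: row_continuous => h; under eq_fun do rewrite mxE.
by case: (h == g) => w; [exact: cvg_id|exact: cvg_cst].
Qed.

Lemma F_replace_continuous g g' (r : 'I_d -> R) :
  continuous (fun w => F g (\row_h (if h == g' then w else r h))).
Proof.
by move=> w; apply: continuous_comp; [exact: replace_continuous|exact: F_cont].
Qed.

Lemma tlamE x g k :
  tlam lam x g k = n%:R * \int[mu]_(w in `[k%:R / n%:R, k.+1%:R / n%:R])
    F g (rank_vector x g k w).
Proof.
rewrite mxE; congr (_ * _); apply: eq_Rintegral => w /set_mem /=.
rewrite in_itv/= => /andP[w0 w1]; rewrite F_lam// => h; rewrite mxE.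
have n0 : 0 < n%:R :> R by rewrite ltr0n; exact: leq_ltn_trans (ltn_ord k).
case: eqP => _.
  rewrite (le_trans _ w0) ?divr_ge0//= (le_trans w1)//.
  by rewrite ler_pdivrMr// mul1r ler_nat.
have card01 (C : {set 'I_n}) : 0 <= (#|C|%:R / n%:R : R) <= 1.
  rewrite divr_ge0//= ler_pdivrMr// mul1r ler_nat.
  by rewrite -[leqRHS]card_ord max_card.
by rewrite /omega; case: ifP.
Qed.

Lemma tlam_bounds x g k : A g <= tlam lam x g k <= B g.
Proof. by rewrite tlamE; apply: slice_bounds => //; exact: F_replace_continuous. Qed.

Lemma average_bounds (lb : 'rV[R]_n) (C : {set 'I_n}) (a b : R) k : k \in C ->
  (forall j, a <= lb 0 j <= b) -> a <= average lb C <= b.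
Proof.
move=> kC H; have C0 : 0 < #|C|%:R :> R by rewrite ltr0n; apply/card_gt0P; exists k.
rewrite /average; apply/andP; split.
  rewrite ler_pdivlMr// mulr_natr -sumr_const.
  by apply: ler_sum => j _; case/andP: (H j).
rewrite ler_pdivrMr// mulr_natr -sumr_const.
by apply: ler_sum => j _; case/andP: (H j).
Qed.

(** Conservation of momentum: a weight that is constant on clusters does not see the difference
    between individual velocities and cluster averages. *)
Lemma sum_average (lb : 'rV[R]_n) cl (f : 'I_n -> R) : partition_map cl ->
  (forall k l, l \in cl k -> f l = f k) ->
  \sum_k f k * average lb (cl k) = \sum_k f k * lb 0 k.
Proof.
move=> [pk pcl] same.
transitivity (\sum_k \sum_(j in cl k) f k * lb 0 j / #|cl k|%:R).
  apply: eq_bigr => k _; rewrite /average mulrA mulr_sumr mulr_suml.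
  by apply: eq_bigr.
rewrite (exchange_big_dep predT)//=; apply: eq_bigr => j _.
rewrite (eq_bigr (fun=> f j * lb 0 j / #|cl j|%:R)); last first.
  by move=> k jk; rewrite (same k j)// (pcl k j).
rewrite (eq_bigl (fun k => k \in cl j)); last first.
  move=> k; apply/idP/idP => H.
    by rewrite (pcl _ _ H); exact: pk.
  by rewrite (pcl _ _ H); exact: pk.
rewrite sumr_const -[LHS]mulr_natr divfK// pnatr_eq0 -lt0n.
by apply/card_gt0P; exists j.
Qed.

Definition slope_cluster x (cl : 'I_d -> 'I_n -> {set 'I_n}) g k :=
  average (row g (tlam lam x)) (cl g k).

Lemma tPhi_row x g t : row g (tPhi lam x t) = spd (row g (tlam lam x)) (row g x) t.
Proof. by apply/rowP => k; rewrite !mxE. Qed.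

Lemma tPhi_local x t : configuration x -> 0 <= t ->
  configuration (tPhi lam x t) /\
  exists2 e, 0 < e & exists2 cl, (forall g, partition_map (cl g)) &
    (forall g k l, l \in cl g k -> tPhi lam x t g l = tPhi lam x t g k) /\
    forall s, 0 <= s <= e -> forall g k,
      tPhi lam x (t + s) g k = tPhi lam x t g k + s * slope_cluster x cl g k.
Proof.
move=> cx t0; split.
  move=> g; rewrite tPhi_row.
  by have [] := @spd_local _ _ (row g (tlam lam x)) (row g x) t (cx g) t0.
have H g := (@spd_local _ _ (row g (tlam lam x)) (row g x) t (cx g) t0).2.
have [||e e0 He] := @finite_positive_bound R 'I_d (fun g e =>
    exists2 cl, partition_map cl &
    (forall k l, l \in cl k -> tPhi lam x t g l = tPhi lam x t g k) /\
    forall s, 0 <= s <= e -> forall k,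
      tPhi lam x (t + s) g k = tPhi lam x t g k +
        s * average (row g (tlam lam x)) (cl k)).
- move=> g; have [e e0 [cl pcl [same mv]]] := H g.
  exists e => //; exists cl => //; split => [k l lk|s se k].
    by rewrite !mxE; exact: same.
  by rewrite !mxE mv// !mxE.
- move=> g e e' /andP[e'0 ee] [cl pcl [same mv]]; exists cl => //; split => // s.
  by move=> /andP[s0 se]; apply: mv; rewrite s0 (le_trans se).
exists e => //; have /choice[cl Hcl] : forall g, exists cl, partition_map cl /\
    ((forall k l, l \in cl k -> tPhi lam x t g l = tPhi lam x t g k) /\
    forall s, 0 <= s <= e -> forall k,
      tPhi lam x (t + s) g k = tPhi lam x t g k +
        s * average (row g (tlam lam x)) (cl k)).
  by move=> g; have [cl pcl Hc] := He g; exists cl.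
exists cl; first by move=> g; case: (Hcl g).
split; first by move=> g; case: (Hcl g) => _ [].
by move=> s se g k; have [_ [_]] := Hcl g; apply.
Qed.

Lemma slope_cluster_bounds x cl g k : (forall g, partition_map (cl g)) ->
  A g <= slope_cluster x cl g k <= B g.
Proof.
move=> pcl; apply: (average_bounds (k := k)); first by case: (pcl g).
by move=> j; rewrite mxE; exact: tlam_bounds.
Qed.

(** Cluster averages of type [g] stay above [A g] and those of type [h] below [B h], so the
    difference of positions has right slope at least [L] at every time, collisions included; real
    induction integrates it. *)
Lemma tPhi_separate x g h k l a b : configuration x -> (g < h)%N ->
  0 <= a -> a <= b ->
  tPhi lam x a g k - tPhi lam x a h l + L * (b - a) <=
  tPhi lam x b g k - tPhi lam x b h l.
Proof.
move=> cx gh a0 ab.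
apply: (@right_slope_increasing _ (fun t => tPhi lam x t g k - tPhi lam x t h l)) => //.
  by move=> t; apply: cvgB; exact: tPhi_continuous.
move=> t /andP[a_t _]; have t0 := le_trans a0 a_t.
have [_ [e e0 [cl pcl [_ mv]]]] := tPhi_local cx t0.
exists e => // s se; rewrite !mv//.
have /andP[h1 _] := slope_cluster_bounds x g k pcl.
have /andP[_ h2] := slope_cluster_bounds x h l pcl.
have := AB_sep gh; case/andP : se => s0 _.
have : s * L <= s * (slope_cluster x cl g k - slope_cluster x cl h l).
  by rewrite ler_wpM2l//; have := AB_sep gh; lra.
by rewrite mulrBr; lra.
Qed.

(** Were no uncrossed pair to meet at [s], continuity of the finitely many positions would forbid
    meetings until some later [s + e], contradicting the infimum. *)
Lemma meeting_time_attained x s : meeting_time lam x = s%:E ->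
  0 <= s /\ exists2 p, p \in uncrossed x &
    tPhi lam x s p.1.1 p.1.2 = tPhi lam x s p.2.1 p.2.2.
Proof.
move=> Es; have s0 : 0 <= s by rewrite -lee_fin -Es meeting_time_ge0.
split => //; apply: contrapT => nmeet.
have [||e e0 He] := @finite_positive_bound R (('I_d * 'I_n) * ('I_d * 'I_n))%type
  (fun p e => p \in uncrossed x -> forall t, s <= t < s + e ->
    tPhi lam x t p.1.1 p.1.2 <> tPhi lam x t p.2.1 p.2.2).
- move=> p; have [pu|pu] := boolP (p \in uncrossed x); last by exists 1.
  pose f t := tPhi lam x t p.1.1 p.1.2 - tPhi lam x t p.2.1 p.2.2.
  have cf : {for s, continuous f} by apply: cvgB; exact: tPhi_continuous.
  have f0 : f s != 0 by rewrite subr_eq0; apply/eqP => E; apply: nmeet; exists p.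
  have : \forall t \near s, f t != 0 by exact: (cvgr_neq0 (f s) cf).
  move=> /nbhs_ballP[e /= e0 He]; exists e => // _ t /andP[st te] E.
  have : f t != 0.
    by apply: He; rewrite /ball/= distrC ger0_norm ?subr_ge0// ltrBlDl.
  by rewrite /f E subrr eqxx.
- move=> p e e' /andP[e'0 ee] H pu t /andP[st te]; apply: H => //.
  by rewrite st (lt_le_trans te)// lerD2l.
have : ((s + e)%:E <= meeting_time lam x)%E.
  apply: le_ereal_inf_tmp => _ /= [t [t0 [p pu E]] <-].
  have st : s <= t.
    by rewrite -lee_fin -Es; apply: ereal_inf_lbound; exists t => //; split => //; exists p.
  rewrite lee_fin leNgt; apply/negP => te.
  by apply: (He p pu t) => //; rewrite st.
by rewrite Es lee_fin gerDl leNgt e0.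
Qed.

(** Intermediate value theorem: a pair no longer in strict order at [t] has met by then. *)
Lemma uncrossed_before x p t : 0 <= t -> (t%:E < meeting_time lam x)%E ->
  p \in uncrossed x -> tPhi lam x t p.1.1 p.1.2 < tPhi lam x t p.2.1 p.2.2.
Proof.
move=> t0 tm pu; rewrite ltNge; apply/negP => le.
pose f r := tPhi lam x r p.1.1 p.1.2 - tPhi lam x r p.2.1 p.2.2.
have [||r] := @IVT _ f 0 t 0 t0.
- have cf : continuous f by move=> r; apply: cvgB; exact: tPhi_continuous.
  exact: continuous_subspaceT.
- have f0 : f 0 <= 0.
    by move: pu; rewrite /f tPhi0 inE subr_le0 => /andP[_ /ltW].
  have ft : 0 <= f t by rewrite subr_ge0.
  by rewrite ge_min f0/= le_max ft orbT.
rewrite in_itv/= => /andP[r0 rt] /eqP; rewrite subr_eq0 => /eqP E.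
have : (meeting_time lam x <= r%:E)%E.
  by apply: ereal_inf_lbound; exists r => //; split => //; exists p.
by move=> /(lt_le_trans tm); rewrite lte_fin ltNge rt.
Qed.

(** [omega] resolves ties as the flow does. A faster particle level with [(g, k)] is strictly ahead
    right after and is not counted; a slower one is strictly behind and is counted. Before the
    meeting time uncrossed pairs keep their strict order, so the initial counts stay valid. *)
Lemma omega_rank x g k h t : configuration x -> h != g ->
  0 < t -> (t%:E < meeting_time lam x)%E ->
  omega x g k h = rank (tPhi lam x t) (tPhi lam x t g k) h.
Proof.
move=> cx hg t0 tm; rewrite /omega /rank.
have Lt : 0 < L * (t - 0) by rewrite subr0 mulr_gt0.
case: ifP => gh; congr (_%:R / _); apply: eq_card => l; rewrite !inE.
- apply/idP/idP => H.
    by apply: ltW; apply: (@uncrossed_before x ((h, l), (g, k)));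
      rewrite ?inE ?gh ?(ltW t0).
  rewrite ltNge; apply/negP => H'.
  have := tPhi_separate l k cx gh (lexx 0) (ltW t0); rewrite tPhi0.
  move: H; set a := tPhi _ _ _ _ _; set b := tPhi _ _ _ _ _; lra.
- have {}gh : (g < h)%N.
    by rewrite ltn_neqAle leqNgt gh andbT; apply: contraNneq hg => /val_inj ->.
  apply/idP/idP => H.
    have := tPhi_separate k l cx gh (lexx 0) (ltW t0); rewrite tPhi0.
    by set a := tPhi _ _ _ _ _; set b := tPhi _ _ _ _ _; lra.
  rewrite leNgt; apply/negP => H'.
  have := @uncrossed_before x ((g, k), (h, l)) t (ltW t0) tm.
  by rewrite inE gh H' /= => /(_ isT); rewrite ltNge H.
Qed.

Lemma tlam_char_speed x t g k : configuration x ->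
  0 < t -> (t%:E < meeting_time lam x)%E ->
  tlam lam x g k = char_speed (tPhi lam x t) g k.
Proof.
move=> cx t0 tm; rewrite tlamE; congr (_ * _); apply: eq_Rintegral => w _.
congr (F g _); apply/rowP => h; rewrite [LHS]mxE [RHS]mxE; case: eqP => // /eqP hg.
exact: omega_rank.
Qed.

(** [v] is the velocity field just after [t]. The momentum balance is asked only for [s > 0]: at a
    meeting time particles of different types coincide, and [rank], which counts ties, may differ
    from the rank that holds just afterwards. *)
Definition locally_characteristic (y : R -> 'M[R]_(d, n)) t :=
  exists2 e, 0 < e & exists2 v : 'I_d -> 'I_n -> R,
    (forall g k, A g <= v g k <= B g) &
    (forall s, 0 <= s <= e -> forall g k, y (t + s) g k = y t g k + s * v g k) /\
    forall s, 0 < s <= e -> forall g (f : R -> R),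
      \sum_k f (y (t + s) g k) * v g k =
      \sum_k f (y (t + s) g k) * char_speed (y (t + s)) g k.

Lemma tPhi_characteristic x t : configuration x -> 0 <= t ->
  (t%:E < meeting_time lam x)%E ->
  exists2 e, 0 < e & (forall s, 0 <= s <= e -> ((t + s)%:E < meeting_time lam x)%E) /\
   exists2 v : 'I_d -> 'I_n -> R,
    (forall g k, A g <= v g k <= B g) &
    (forall s, 0 <= s <= e -> forall g k,
       tPhi lam x (t + s) g k = tPhi lam x t g k + s * v g k) /\
    forall s, 0 < s <= e -> forall g (f : R -> R),
      \sum_k f (tPhi lam x (t + s) g k) * v g k =
      \sum_k f (tPhi lam x (t + s) g k) * char_speed (tPhi lam x (t + s)) g k.
Proof.
move=> cx t0 tm.
have [e1 e10 He1] : exists2 e, 0 < e & (forall s, 0 <= s <= e ->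
    ((t + s)%:E < meeting_time lam x)%E).
  move: tm; case: meeting_time => [s| |]//; last first.
    by move=> _; exists 1 => // s _; rewrite ltry.
  rewrite lte_fin => ts; exists ((s - t) / 2); first by rewrite divr_gt0// subr_gt0.
  by move=> r /andP[r0 rs]; rewrite lte_fin; lra.
have [_ [e e0 [cl pcl [same mv]]]] := tPhi_local cx t0.
have me : 0 < Num.min e e1 by rewrite lt_min e0.
exists (Num.min e e1) => //; split.
  by move=> s /andP[s0]; rewrite le_min => /andP[_ se]; apply: He1; rewrite s0.
exists (slope_cluster x cl); first by move=> g k; exact: slope_cluster_bounds.
split.
  by move=> s /andP[s0]; rewrite le_min => /andP[se _] g k; apply: mv; rewrite s0.
move=> s /andP[s0]; rewrite le_min => /andP[se se1] g f.
have s0e : 0 <= s <= e by rewrite (ltW s0).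
rewrite /slope_cluster (sum_average _ (f := fun k => f (tPhi lam x (t + s) g k))) //.
  apply: eq_bigr => k _.
  have -> : row g (tlam lam x) 0 k = tlam lam x g k by rewrite mxE.
  rewrite (@tlam_char_speed x (t + s))//.
    by rewrite ltr_wpDl.
  by apply: He1; rewrite (ltW s0).
move=> k l lk; rewrite !mv// (same g k l)//.
by rewrite /slope_cluster; have [_ /(_ _ _ lk)->] := pcl g.
Qed.

Lemma locally_characteristic_ext (y z : R -> 'M[R]_(d, n)) t t' e : 0 < e ->
  (forall s, 0 <= s <= e -> z (t' + s) = y (t + s)) ->
  locally_characteristic y t -> locally_characteristic z t'.
Proof.
move=> e0 yz [e1 e10 [v vb [mv chs]]].
have zt : z t' = y t by have := yz 0; rewrite !addr0 lexx (ltW e0); apply.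
exists (Num.min e e1); first by rewrite lt_min e0.
exists v => //; split => s /andP[s0]; rewrite le_min => /andP[se se1].
  by move=> g k; rewrite yz ?s0// zt mv// s0.
by move=> g f; rewrite yz ?(ltW s0)//; apply: chs; rewrite s0.
Qed.

Lemma mspd_rec_local fuel x t : configuration x ->
  (#|uncrossed x| <= fuel)%N -> 0 <= t ->
  configuration (mspd_rec lam fuel x t) /\
  locally_characteristic (mspd_rec lam fuel x) t.
Proof.
have free x' t' (y : R -> 'M[R]_(d, n)) : configuration x' -> 0 <= t' ->
    (t'%:E < meeting_time lam x')%E ->
    (forall t, (t%:E < meeting_time lam x')%E -> y t = tPhi lam x' t) ->
    configuration (y t') /\ locally_characteristic y t'.
  move=> cx t0 tm yE; split; first by rewrite yE//; case: (tPhi_local cx t0).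
  have [e e0 [em H]] := tPhi_characteristic cx t0 tm.
  have loc : locally_characteristic (tPhi lam x') t' by exists e.
  apply: (locally_characteristic_ext e0 _ loc) => s se.
  by rewrite yE// em.
elim: fuel x t => [|fuel IH] x t cx card_x t0.
  apply: (free x) => //; suff -> : meeting_time lam x = +oo%E by rewrite ltry.
  apply/eqP; rewrite -leye_eq; apply: le_ereal_inf_tmp => _ /= [s [s0 [p pu _]] <-].
  move: card_x; rewrite leqn0 => /eqP/cards0_eq E.
  by rewrite E inE in pu.
have [tm|mt] := ltP t%:E (meeting_time lam x).
  by apply: (free x) => // r /= ->.
case Es : (meeting_time lam x) mt => [s| |]//; last first.
  by have := meeting_time_ge0 lam x; rewrite Es.
rewrite lee_fin => st.
have [s0 [p pu meet]] := meeting_time_attained Es.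
set x' := tPhi lam x s.
have cx' : configuration x' by case: (tPhi_local cx s0).
have card_x' : (#|uncrossed x'| <= fuel)%N.
  (* No pair becomes uncrossed, since the faster type only gains ground, and the pair that meets
     drops out because its inequality was strict. *)
  rewrite -ltnS; apply: leq_trans card_x; apply: proper_card; apply/properP; split.
    apply/fintype.subsetP => -[[g k] [h l]]; rewrite !inE /= => /andP[gh H]; rewrite gh/=.
    rewrite ltNge; apply/negP => H'.
    have := tPhi_separate k l cx gh (lexx 0) s0; rewrite tPhi0.
    have : 0 <= L * (s - 0) by rewrite subr0 mulr_ge0// ltW.
    move: H; rewrite /x'; set a := tPhi _ _ _ _ _; set b := tPhi _ _ _ _ _; lra.
  by exists p => //; rewrite inE /x' meet ltxx andbF.
have ts0 : 0 <= t - s by rewrite subr_ge0.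
have [IH1 IH2] := IH _ _ cx' card_x' ts0.
have recE r : s <= r ->
    mspd_rec lam fuel.+1 x r = mspd_rec lam fuel x' (r - s).
  by move=> sr /=; rewrite Es lte_fin ltNge sr.
rewrite recE//; split => //.
apply: (locally_characteristic_ext ltr01 _ IH2) => r /andP[r0 _].
by rewrite recE ?ler_wpDr// addrAC.
Qed.

Lemma mspd_local x t : configuration x -> 0 <= t ->
  configuration (mspd lam x t) /\ locally_characteristic (mspd lam x) t.
Proof. by move=> cx t0; exact: mspd_rec_local. Qed.

Lemma mspd0 x : mspd lam x 0 = x.
Proof. exact: mspd_rec0. Qed.

Lemma mspd_continuous x g k : continuous (fun t => mspd lam x t g k).
Proof. exact: mspd_rec_continuous. Qed.

Lemma mspd_increment x g k a b : configuration x -> 0 <= a -> a <= b ->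
  A g * (b - a) <= mspd lam x b g k - mspd lam x a g k <= B g * (b - a).
Proof.
move=> cx a0 ab; apply/andP; split.
- rewrite lerBrDl.
  apply: (@right_slope_increasing _ (fun t => mspd lam x t g k)) => //.
    exact: mspd_continuous.
  move=> t /andP[a_t _].
  have [_ [e e0 [v vb [mv _]]]] := mspd_local cx (le_trans a0 a_t).
  exists e => // s se; rewrite mv// lerD2l mulrC.
  by case/andP : se => s0 _; rewrite ler_wpM2l//; case/andP: (vb g k).
- suff : - mspd lam x a g k + (- B g) * (b - a) <= - mspd lam x b g k by lra.
  apply: (@right_slope_increasing _ (fun t => - mspd lam x t g k)) => //.
    by move=> t; apply: cvgN; exact: mspd_continuous.
  move=> t /andP[a_t _].
  have [_ [e e0 [v vb [mv _]]]] := mspd_local cx (le_trans a0 a_t).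
  exists e => // s se; rewrite mv// opprD lerD2l mulNr lerN2 mulrC.
  by case/andP : se => s0 _; rewrite ler_wpM2r//; case/andP: (vb g k).
Qed.

(** A closed inequality with [L] independent of the number of particles: it survives the limit,
    where it bounds the number of meetings of two trajectories by one. *)
Lemma mspd_separate x g h k l a b : configuration x -> (g < h)%N ->
  0 <= a -> a <= b ->
  mspd lam x a g k - mspd lam x a h l + L * (b - a) <=
  mspd lam x b g k - mspd lam x b h l.
Proof.
move=> cx gh a0 ab.
apply: (@right_slope_increasing _ (fun t => mspd lam x t g k - mspd lam x t h l)) => //.
  by move=> t; apply: cvgB; exact: mspd_continuous.
move=> t /andP[a_t _]; have t0 := le_trans a0 a_t.
have [_ [e e0 [v vb [mv _]]]] := mspd_local cx t0.
exists e => // s se; rewrite !mv//.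
have /andP[h1 _] := vb g k; have /andP[_ h2] := vb h l.
case/andP : se => s0 _.
have : s * L <= s * (v g k - v h l).
  by rewrite ler_wpM2l//; have := AB_sep gh; lra.
by rewrite mulrBr; lra.
Qed.

End multitype_dynamics.

(** * Bounded functions and finite measures *)

Section bounded_functions.
Context {R : realType} d (T : measurableType d).
Variable m : {finite_measure set T -> \bar R}.
Implicit Types f g : T -> R.

Lemma bounded_integrable f M : measurable_fun setT f -> (forall x, `|f x| <= M) ->
  m.-integrable setT (EFin \o f).
Proof.
move=> mf fM; apply: measurable_bounded_integrable => //.
  by rewrite ltey_eq fin_num_measure.
exists M; split; first exact: num_real.
by move=> x Mx y _ /=; apply: le_trans (fM y) (ltW Mx).
Qed.

Lemma bounded_cvg (f_ : nat -> T -> R) f M :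
  (forall n, measurable_fun setT (f_ n)) -> measurable_fun setT f ->
  (forall n x, `|f_ n x| <= M) ->
  {ae m, forall x, f_ ^~ x @ \oo --> f x} ->
  \int[m]_x f_ n x @[n --> \oo] --> \int[m]_x f x.
Proof.
move=> mf_ mf f_M fcv.
have iM : m.-integrable setT (EFin \o (fun=> M)).
  apply: (@bounded_integrable _ `|M|) => //.
have [intf _ cv] := @dominated_convergence _ _ _ m setT measurableT
  (fun n => EFin \o f_ n) (EFin \o f) (EFin \o (fun=> M))
  (fun n => measurable_funS measurableT (@subsetT _ _) ltac:(exact/measurable_EFinP/mf_))
  ltac:(exact/measurable_EFinP)
  ltac:(by apply: filterS fcv => x fx _; apply: cvg_EFin => //; exact: nearW)
  iM ltac:(by apply: nearW => x n _ /=; rewrite lee_fin).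
apply: fine_cvg; rewrite fineK//.
exact: integrable_fin_num.
Qed.

Lemma ae_eq_Rintegral f g : measurable_fun setT f -> measurable_fun setT g ->
  {ae m, forall x, f x = g x} -> \int[m]_x f x = \int[m]_x g x.
Proof.
move=> mf mg fg; congr fine; apply: ae_eq_integral => //.
- exact/measurable_EFinP.
- exact/measurable_EFinP.
- by apply: filterS fg => x /= ->.
Qed.

Lemma bounded_Rintegral_le f M : measurable_fun setT f -> (forall x, `|f x| <= M) ->
  `|\int[m]_x f x| <= M * fine (m setT).
Proof.
move=> mf fM; have intf := bounded_integrable mf fM.
apply: (le_trans (le_normr_Rintegral measurableT intf)).
rewrite -(Rintegral_cst m measurableT M); apply: le_Rintegral => //.
- by apply: (@bounded_integrable _ M) => [|x]; [exact: measurableT_comp|rewrite normr_id].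
- by apply: (@bounded_integrable _ `|M|).
Qed.

End bounded_functions.

Section bounded_fubini.
Context {R : realType} d1 d2 (T1 : measurableType d1) (T2 : measurableType d2).
Variables (m1 : {finite_measure set T1 -> \bar R}) (m2 : {finite_measure set T2 -> \bar R}).
Variables (f : T1 * T2 -> R) (M : R).
Hypotheses (mf : measurable_fun setT f) (fM : forall z, `|f z| <= M).

Let sec1 x : m2.-integrable setT (EFin \o (fun y => f (x, y))).
Proof.
by apply: (@bounded_integrable _ _ _ m2 _ M) => //; exact: measurableT_comp.
Qed.

Let sec2 y : m1.-integrable setT (EFin \o (fun x => f (x, y))).
Proof.
by apply: (@bounded_integrable _ _ _ m1 _ M) => //; exact: measurableT_comp.
Qed.

Let int_prod : (m1 \x m2)%E.-integrable setT (EFin \o f).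
Proof.
apply/integrable12ltyP; first exact/measurable_EFinP.
apply: (@le_lt_trans _ _ (\int[m1]_x (M%:E * m2 setT))%E).
  apply: ge0_le_integral => //.
  - by move=> x _; apply: integral_ge0.
  - apply: (@measurable_fun_fubini_tonelli_F _ _ _ _ _ m2 (fun z => `|(f z)%:E|%E)) => //.
    by apply: measurableT_comp => //; exact/measurable_EFinP.
  - move=> x _; rewrite -integral_cst//; apply: ge0_le_integral => //.
    + by apply: measurableT_comp => //; apply/measurable_EFinP; exact: measurableT_comp.
    + by move=> y _; rewrite lee_fin.
rewrite integral_cst// -[X in (_ < X)%E]/(+oo%E).
by rewrite ltey_eq fin_numM// ?fin_numM// fin_num_measure.
Qed.

Lemma measurable_Rintegral : measurable_fun setT (fun x => \int[m2]_y f (x, y)).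
Proof.
apply: measurableT_comp => //.
exact: (measurable_fubini_F int_prod).
Qed.

Lemma Rintegral_swap :
  \int[m1]_x \int[m2]_y f (x, y) = \int[m2]_y \int[m1]_x f (x, y).
Proof.
rewrite /Rintegral; have := Fubini int_prod => /= FE.
transitivity (fine (\int[m1]_x \int[m2]_y (f (x, y))%:E)%E).
  congr fine; apply: eq_integral => x _.
  by rewrite fineK//; apply: integrable_fin_num => //; exact: sec1.
rewrite FE; congr fine; apply: eq_integral => y _.
by rewrite fineK//; apply: integrable_fin_num => //; exact: sec2.
Qed.

End bounded_fubini.

(** * Lebesgue measure on a segment and the uniform law *)

Section interval_measures.
Context {R : realType}.
Notation mu := (@lebesgue_measure R).

Lemma lebesgue_itv_lty (a b : R) : (mu `[a, b] < +oo)%E.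
Proof. by rewrite lebesgue_measure_itv/=; case: ifP => _; rewrite ?ltry. Qed.

(** Restrictions are taken as finite measures on the whole line, so that every bounded measurable
    function is integrable and the bounded Fubini and convergence lemmas apply without domains. *)
Definition leb_itv (a b : R) : set (measurableTypeR R) -> \bar R :=
  @mfrestr _ (measurableTypeR R) R `[a, b] mu (measurable_itv `[a, b])
    (lebesgue_itv_lty a b).

HB.instance Definition _ a b := FiniteMeasure.copy (leb_itv a b)
  (@mfrestr _ (measurableTypeR R) R `[a, b] mu (measurable_itv `[a, b])
    (lebesgue_itv_lty a b)).

Definition unit_law : set (measurableTypeR R) -> \bar R :=
  @mrestr _ (measurableTypeR R) R `]0, 1[ mu (measurable_itv `]0, 1[).

HB.instance Definition _ := Measure.copy unit_law
  (@mrestr _ (measurableTypeR R) R `]0, 1[ mu (measurable_itv `]0, 1[)).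

Let unit_law_setT : unit_law setT = 1%E.
Proof. by rewrite /unit_law /mrestr setTI lebesgue_measure_itv/= lte_fin ltr01 sube0. Qed.

HB.instance Definition _ :=
  Measure_isProbability.Build _ _ _ unit_law unit_law_setT.

Lemma leb_itvE a b A : leb_itv a b A = mu (A `&` `[a, b]).
Proof. by []. Qed.

Lemma unit_lawE A : unit_law A = mu (A `&` `]0, 1[).
Proof. by []. Qed.

Lemma restr_integral (m : {measure set (measurableTypeR R) -> \bar R})
  (D : set (measurableTypeR R)) (f : measurableTypeR R -> \bar R) :
  measurable D -> m (~` D) = 0%E ->
  (forall A, measurable A -> A `<=` D -> m A = mu A) -> measurable_fun setT f ->
  (\int[m]_x f x = \int[mu]_(x in D) f x)%E.
Proof.
move=> mD mDC mE mf.
rewrite -(eq_measure_integral (D := D) mu (m1 := m))// [RHS]integral_mkcond.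
apply: ae_eq_integral => //.
  by apply/(measurable_restrictT _ mD); exact: measurable_funTS.
exists (~` D); split => //; first exact: measurableC.
move=> x /= H Dx; apply: H => _; rewrite patchE; case: ifPn => //.
by rewrite notin_setE => /(_ Dx).
Qed.

Lemma leb_itv_integral a b (f : measurableTypeR R -> R) : measurable_fun setT f ->
  \int[leb_itv a b]_x f x = \int[mu]_(x in `[a, b]) f x.
Proof.
move=> mf; congr fine; apply: restr_integral => //.
- by rewrite [LHS]leb_itvE setICl measure0.
- by move=> A mA Ab; rewrite [LHS]leb_itvE setIidl.
- exact/measurable_EFinP.
Qed.

Lemma unit_law_integral (f : measurableTypeR R -> R) : measurable_fun setT f ->
  \int[unit_law]_x f x = \int[mu]_(x in `]0, 1[) f x.
Proof.
move=> mf; congr fine; apply: restr_integral => //.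
- by rewrite [LHS]unit_lawE setICl measure0.
- by move=> A mA Ab; rewrite [LHS]unit_lawE setIidl.
- exact/measurable_EFinP.
Qed.

Lemma unit_law_ae (P : set R) : (forall x, 0 < x < 1 -> P x) -> {ae unit_law, forall x, P x}.
Proof.
move=> H; exists (~` `]0, 1[); split.
- exact: measurableC.
- by rewrite [LHS]unit_lawE setICl measure0.
- by move=> x /= nP; rewrite in_itv/= => x01; apply/nP/H.
Qed.

Lemma leb_itv_ae a b (P : set R) : (forall x, a <= x <= b -> P x) -> {ae leb_itv a b, forall x, P x}.
Proof.
move=> H; exists (~` `[a, b]); split.
- exact: measurableC.
- by rewrite [LHS]leb_itvE setICl measure0.
- by move=> x /= nP; rewrite in_itv/= => x01; apply/nP/H.
Qed.

End interval_measures.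

#[global] Instance leb_itv_ae_filter (R : realType) (a b : R) :
  Filter (almost_everywhere (leb_itv a b)).
Proof. exact: ae_filter_ringOfSetsType. Qed.

#[global] Instance unit_law_ae_filter (R : realType) :
  Filter (almost_everywhere (@unit_law R)).
Proof. exact: ae_filter_ringOfSetsType. Qed.

Section measurability.
Context {R : realType} d (T : measurableType d).

Lemma measurable_boolR (b : T -> bool) : measurable_fun setT b ->
  measurable_fun setT (fun x => (b x)%:R : R).
Proof.
move=> mb; rewrite (_ : (fun _ => _) = (fun x => if b x then 1 else 0)).
  exact: measurable_fun_ifT.
by apply/funext => x; case: (b x).
Qed.

Lemma measurable_bool_set (b : T -> bool) : measurable_fun setT b ->
  measurable [set x | b x].
Proof.
move=> mb; have := mb measurableT [set true] I; rewrite setTI.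
by congr measurable; apply/seteqP; split => x /=; case: (b x).
Qed.

Lemma measurable_leR (f g : T -> R) : measurable_fun setT f -> measurable_fun setT g ->
  measurable_fun setT (fun x => (f x <= g x)%R%:R : R).
Proof. by move=> mf mg; apply: measurable_boolR; exact: measurable_fun_ler. Qed.

(** An open set is a countable union of rational boxes, and each box is cut out by finitely many
    measurable inequalities. This serves to make continuous functions of several measurable
    coordinates measurable. *)
Lemma measurable_open_row n (u : 'I_n -> T -> R) (U : set 'rV[R]_n) :
  (forall h, measurable_fun setT (u h)) -> open U ->
  measurable [set z | U (\row_h u h z)].
Proof.
move=> mu oU.
pose box (q : 'rV[rat]_n * rat) : set T :=
  [set z | forall h, `|u h z - ratr (q.1 0 h)| < ratr q.2].
(* Boxes that are not contained in the preimage are emptied, so that the union runs over the whole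
   countable type. A half-width below [e / 2] keeps two points of a box at distance less than
   [e]. *)
pose V (q : 'rV[rat]_n * rat) : set T :=
  if `[< box q `<=` [set z | U (\row_h u h z)] >] then box q else set0.
rewrite (_ : [set _ | _] = \bigcup_q V q); last first.
  apply/seteqP; split => [z Uz|z [q _]]; last first.
    by rewrite /V; case: asboolP => // sub; exact: sub.
  have : nbhs (\row_h u h z : 'rV[R]_n) U by apply: open_nbhs_nbhs; split.
  move=> /nbhs_ballP[e /= e0 eU].
  have [e' /[!in_itv]/= /andP[e'0 e'e]] : exists e' : rat, ratr e' \in `]0, e / 2[.
    by apply: rat_in_itvoo; rewrite divr_gt0.
  have /choice[q Hq] : forall h, exists q : rat, `|u h z - ratr q| < ratr e'.
    move=> h; have [q /[!in_itv]/= /andP[q1 q2]] :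
        exists q : rat, ratr q \in `]u h z - ratr e', u h z + ratr e'[.
      by apply: rat_in_itvoo; lra.
    by exists q; rewrite ltr_norml; lra.
  exists (\row_h q h, e') => //; rewrite /V asboolT.
    by move=> h; rewrite mxE; exact: Hq.
  move=> y yq /=; apply: eU; split => // i j; rewrite !mxE /ball/=.
  have := Hq j; have := yq j; rewrite mxE.
  by rewrite !ltr_norml; lra.
apply: countable_bigcupT_measurable => [|q]; first exact: countableP.
rewrite /V; case: asboolP => // _.
rewrite (_ : box q = ~` \bigcup_(h in [set: 'I_n])
    [set z | ~~ (`|u h z - ratr (q.1 0 h)| < ratr q.2)%R]).
  apply: measurableC; apply: fin_bigcup_measurable => // h _.
  apply: measurable_bool_set; apply: measurable_neg; apply: measurable_fun_ltr => //.
  by apply: measurableT_comp => //; exact: measurable_funB.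
apply/seteqP; split => [z H [h _ /=]|z H h]; first by rewrite H.
by apply: contrapT => /negP nh; apply: H; exists h.
Qed.

Lemma measurable_continuous_row n (u : 'I_n -> T -> R) (f : 'rV[R]_n -> R) :
  (forall h, measurable_fun setT (u h)) -> continuous f ->
  measurable_fun setT (fun z => f (\row_h u h z)).
Proof.
move=> mu /continuousP cf.
apply: (measurability _ (RGenOpens.measurableE R)) => _ [_ [a [b ->]] <-].
rewrite setTI; apply: (measurable_open_row mu (U := f @^-1` `]a, b[)).
exact/cf/interval_open.
Qed.

End measurability.

Section bounded_primitive.
Context {R : realType}.
Notation mu := (@lebesgue_measure R).
Variables (H : measurableTypeR R -> R) (C : R).
Hypotheses (mH : measurable_fun setT H) (HC : forall t, `|H t| <= C).

Lemma bounded_itv_integrable a b (f : measurableTypeR R -> R) M :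
  measurable_fun setT f -> (forall t, `|f t| <= M) ->
  mu.-integrable `[a, b] (EFin \o f).
Proof.
move=> mf fM; apply: measurable_bounded_integrable => //.
- exact: lebesgue_itv_lty.
- exact: measurable_funTS.
- exists M; split; first exact: num_real.
  by move=> x Mx y _ /=; apply: le_trans (fM y) (ltW Mx).
Qed.

Definition primitive (t : R) : R := \int[mu]_(s in `[0, t]) H s.

(** The bound on [H] excludes the left end, which the integral does not see: at a meeting time the
    value of [H] there need not be its right limit. *)
Lemma primitive_increment c e a b : 0 <= a -> a <= b -> 0 <= e ->
  (forall r, a < r <= b -> `|H r - c| <= e) ->
  `|primitive b - primitive a - c * (b - a)| <= e * (b - a).
Proof.
move=> a0 ab e0 He; rewrite /primitive.
have iH := @bounded_itv_integrable 0 b H C mH HC.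
have -> : \int[mu]_(s in `[0, b]) H s - \int[mu]_(s in `[0, a]) H s =
    \int[mu]_(s in `]a, b]) H s by rewrite Rintegral_itvB.
have mab : measurable (`]a, b] : set (measurableTypeR R)) by exact: measurable_itv.
have iHab : mu.-integrable `]a, b] (EFin \o H).
  apply: integrableS iH => // x /=; rewrite !in_itv/= => /andP[ax ->].
  by rewrite andbT (le_trans a0)// ltW.
have muab : mu `]a, b] = (b - a)%:E.
  rewrite lebesgue_measure_itv/= lte_fin; case: ltP => // ba.
  by rewrite (le_anti (introT andP (conj ab ba))) subrr.
have ic k : mu.-integrable `]a, b] (EFin \o (fun=> k)).
  apply: measurable_bounded_integrable; [exact: mab| |exact: measurable_cst|].
    by rewrite [X in (X < _)%E]muab ltry.
  exists `|k|; split; first exact: num_real.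
  by move=> x kx y _ /=; exact: ltW.
have cst k : \int[mu]_(s in `]a, b]) k = k * (b - a).
  by rewrite Rintegral_cst//= muab.
rewrite -(cst c) -(RintegralB mab iHab (ic c)).
apply: (le_trans (le_normr_Rintegral mab _)).
  exact: (integrableB mab iHab (ic c)).
have ie := ic e.
rewrite -(cst e); apply: le_Rintegral => //.
by apply: integrable_norm => //; exact: (integrableB mab iHab (ic c)).
Qed.

Lemma primitive_lipschitz a b : `|primitive b - primitive a| <= C * `|b - a|.
Proof.
have C0 : 0 <= C by apply: le_trans (HC 0).
wlog ab : a b / a <= b.
  move=> W; have [ab|ba] := leP a b; first exact: W.
  by rewrite distrC (distrC b); apply: W; exact: ltW.
(* For negative [t] the domain of integration is empty, so the primitive is constant there. *)
have p0 t : t < 0 -> primitive t = primitive 0.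
  move=> t0; rewrite /primitive set_itv1 Rintegral_set1.
  by rewrite set_itv_ge ?Rintegral_set0// bnd_simp -ltNge.
have key a' b' : 0 <= a' -> a' <= b' -> `|primitive b' - primitive a'| <= C * (b' - a').
  move=> a0 ab'; have := @primitive_increment 0 C a' b' a0 ab' C0.
  by rewrite mul0r !subr0; apply => r _; rewrite subr0.
rewrite (ger0_norm (x := b - a)) ?subr_ge0//.
have [b0|b0] := ltP b 0.
  by rewrite !p0 ?(le_lt_trans ab)// subrr normr0 mulr_ge0// subr_ge0.
have [a0|a0] := ltP a 0; last exact: key.
rewrite (p0 a)//; apply: le_trans (key 0 b (lexx 0) b0) _.
by rewrite ler_wpM2l// lerD2l lerN2 ltW.
Qed.

Lemma lipschitz_continuous (f : R -> R) K :
  (forall a b, `|f b - f a| <= K * `|b - a|) -> continuous f.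
Proof.
move=> fK a; apply/cvgrPdist_le => e e0.
have K1 : 0 < `|K| + 1 by rewrite ltr_pwDr.
near=> b; rewrite distrC; apply: le_trans (fK a b) _.
apply: (@le_trans _ _ ((`|K| + 1) * `|b - a|)).
  by rewrite ler_wpM2r// (le_trans (ler_norm K))// lerDl.
rewrite mulrC -ler_pdivlMr//; near: b.
have : 0 < e / (`|K| + 1) by rewrite divr_gt0.
by move=> h; near=> b; rewrite distrC; near: b; exact: cvgr_dist_le.
Unshelve. all: by end_near. Qed.

Lemma primitive_continuous : continuous primitive.
Proof. exact: (lipschitz_continuous primitive_lipschitz). Qed.

End bounded_primitive.

(** * The weak identity along the discrete dynamics *)

Section test_functions.
Context {R : realType}.
Notation mu := (@lebesgue_measure R).

(** Test functions extended to all real times. The derivative is required only for [t > 0], since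
    the extension used later freezes negative times at the value at 0 and may have a corner
    there. *)
Record smooth_test (phi dphi : R -> R -> R) (M C : R) : Prop := SmoothTest {
  smooth_test_pos : 0 < M;
  smooth_test_cont : continuous (fun z : R * R => phi z.1 z.2);
  smooth_test_dcont : continuous (fun z : R * R => dphi z.1 z.2);
  smooth_test_supp : forall t x, M <= t \/ M <= `|x| -> phi t x = 0 /\ dphi t x = 0;
  smooth_test_bound : forall t x, `|phi t x| <= C /\ `|dphi t x| <= C;
  smooth_test_derive : forall t x : R, 0 < t -> is_derive t 1 (phi^~ x) (dphi t x) }.

Lemma pair_continuous (T U V : topologicalType) (f : T -> U) (g : T -> V) :
  continuous f -> continuous g -> continuous (fun x => (f x, g x)).
Proof. by move=> cf cg x; exact: (cvg_pair (cf x) (cg x)). Qed.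

Lemma curry_continuous2 (f : R -> R -> R) t : continuous (fun z : R * R => f z.1 z.2) ->
  continuous (f t).
Proof.
move=> cf x; apply: (@continuous_comp _ _ _ (fun x => (t, x)) (fun z => f z.1 z.2)) => //.
  by apply: pair_continuous => ?; [exact: cvg_cst|exact: cvg_id].
exact: cf.
Qed.

Lemma curry_continuous1 (f : R -> R -> R) x : continuous (fun z : R * R => f z.1 z.2) ->
  continuous (f ^~ x).
Proof.
move=> cf t; apply: (@continuous_comp _ _ _ (fun t => (t, x)) (fun z => f z.1 z.2)) => //.
  by apply: pair_continuous => ?; [exact: cvg_id|exact: cvg_cst].
exact: cf.
Qed.

Lemma curve_continuous (f : R -> R -> R) (y : R -> R) :
  continuous (fun z : R * R => f z.1 z.2) -> continuous y ->
  continuous (fun t => f t (y t)).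
Proof.
move=> cf cy t; apply: (@continuous_comp _ _ _ (fun t => (t, y t)) (fun z => f z.1 z.2)) => //.
  by apply: pair_continuous => ?; [exact: cvg_id|exact: cy].
exact: cf.
Qed.

Lemma continuous_measurableR (f : R -> R) : continuous f ->
  measurable_fun setT (f : measurableTypeR R -> R).
Proof.
by move=> cf; apply: (@continuous_measurable_fun R).
Qed.

(** Continuity in time is uniform over the compact segment from [- M] to [M], and both terms vanish
    outside it. *)
Lemma uniform_in_space (f : R -> R -> R) (M t0 e : R) : 0 < e ->
  continuous (fun z : R * R => f z.1 z.2) ->
  (forall t x, M <= `|x| -> f t x = 0) ->
  exists2 r, 0 < r & forall t, `|t - t0| < r -> forall x, `|f t x - f t0 x| <= e.
Proof.
move=> e0 cf supp.
have /compact_near_coveringP nc := @segment_compact R (- M) M.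
have H : \forall t \near t0, `[- M, M] `<=` (fun x => `|f t x - f t0 x| <= e).
  apply: (nc R (nbhs t0) (fun t x => `|f t x - f t0 x| <= e) (nbhs_filter t0)) => x _.
  have e2 : 0 < e / 2 by rewrite divr_gt0.
  have /cvgrPdist_lt/(_ _ e2)[[A1 A2] /= [A1t A2x] H1] := cf (t0, x).
  have /cvgrPdist_lt/(_ _ e2) H2 := @curry_continuous2 f t0 cf x.
  exists ([set x' | A2 x' /\ `|f t0 x - f t0 x'| < e / 2], A1) => /=.
    by split => //; apply: filterI.
  move=> [x' t] /= [[A2x' H2x'] A1t'].
  have := H1 (t, x') (conj A1t' A2x') => /= H1'.
  rewrite (_ : f t x' - f t0 x' = (f t0 x - f t0 x') - (f t0 x - f t x')); last by ring.
  rewrite (le_trans (ler_normB _ _))// (splitr e) lerD// ltW//.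
move: H => /nbhs_ballP[r /= r0 Hr]; exists r => // t tr x.
have [xM|xM] := leP M `|x|; first by rewrite !supp// subrr normr0 ltW.
apply: (Hr t); first by rewrite /ball/= distrC.
by rewrite /= in_itv/= -ler_norml ltW.
Qed.

(** The primitive of [f] that vanishes at the right end, up to sign, as a function of the position
    [p]; its derivative is [- f p]. As the indicator of [p <= z] is the distribution function of a
    unit mass at [p], averaging tails over particles integrates [f] against their empirical
    distribution function. *)
Definition tail (M : R) (f : R -> R) (p : R) : R :=
  \int[leb_itv (- M) M]_z (f z * (p <= z)%R%:R).

Section tail.
Variables (M : R) (M0 : 0 < M).
Implicit Types (f g h : R -> R) (p q a c e C : R).

Lemma tail_measurable f p : continuous f ->
  measurable_fun setT (fun z : measurableTypeR R => f z * (p <= z)%R%:R).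
Proof.
move=> cf; apply: measurable_funM; first exact: continuous_measurableR.
by apply: measurable_leR.
Qed.

Lemma indic_le_bound f p z C : `|f z| <= C -> `|f z * (p <= z)%R%:R| <= C.
Proof.
by case: (p <= z); rewrite ?mulr1// mulr0 normr0; apply: le_trans.
Qed.

Lemma tail_bound f p C : continuous f -> (forall z, `|f z| <= C) ->
  `|tail M f p| <= C * (2 * M).
Proof.
move=> cf fC; have := @bounded_Rintegral_le R _ _ (leb_itv (- M) M) _ C (tail_measurable p cf)
  (fun z => indic_le_bound p (fC z)).
suff -> : fine (leb_itv (- M) M setT) = 2 * M by [].
rewrite leb_itvE setTI lebesgue_measure_itv/= lte_fin ifT; last first.
  by move: M0; lra.
by rewrite -EFinB/=; ring.
Qed.

Lemma tail_integrable f p C : continuous f -> (forall z, `|f z| <= C) ->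
  (leb_itv (- M) M).-integrable setT (EFin \o (fun z => f z * (p <= z)%R%:R)).
Proof.
move=> cf fC; apply: (@bounded_integrable _ _ _ _ _ C); first exact: tail_measurable.
by move=> z; exact: indic_le_bound.
Qed.

Lemma tail_combine f g h p a C : continuous f -> continuous g -> continuous h ->
  (forall z, `|f z| <= C) -> (forall z, `|g z| <= C) -> (forall z, `|h z| <= C) ->
  tail M (fun z => f z - g z - a * h z) p = tail M f p - tail M g p - a * tail M h p.
Proof.
move=> cf cg ch fC gC hC; rewrite /tail.
have f1 := tail_integrable p cf fC; have g1 := tail_integrable p cg gC.
have h1 := tail_integrable p ch hC.
rewrite -(RintegralZl _ _ h1)// -RintegralB// -RintegralB//.
- by apply: eq_Rintegral => z _; ring.
- exact: (integrableB _ f1 g1).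
- by have := integrableZl measurableT a h1; apply: eq_integrable.
Qed.

Lemma tail_diff f p q C : continuous f -> (forall z, `|f z| <= C) ->
  (forall z, M <= `|z| -> f z = 0) -> p <= q ->
  tail M f p - tail M f q = \int[mu]_(z in `[p, q]) f z.
Proof.
move=> cf fC supp pq; rewrite /tail.
have f1 := tail_integrable p cf fC; have g1 := tail_integrable q cf fC.
rewrite -RintegralB//.
have iq : mu.-integrable `[p, q[ (EFin \o f).
  have iq0 := continuous_itv_integrable p q cf.
  apply: integrableS iq0 => // x /=; by rewrite !in_itv/= => /andP[-> /ltW].
rewrite -Rintegral_itv_bndo_bndc//.
rewrite leb_itv_integral; last first.
  apply: measurable_funB; exact: tail_measurable.
rewrite Rintegral_mkcond [RHS]Rintegral_mkcond; apply: eq_Rintegral => z _.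
rewrite !patchE !mem_setE !in_itv/=.
have [zM|zM] := leP M `|z|.
  by rewrite supp// !mul0r subrr !if_same.
rewrite -ler_norml ltW//= -mulrBr.
have [pz|zp] := leP p z; have [qz|zq] /= := leP q z.
- by rewrite subrr mulr0.
- by rewrite subr0 mulr1.
- by have := lt_le_trans zp (le_trans pq qz); rewrite ltxx.
- by rewrite subrr mulr0.
Qed.

Lemma tail_close f p q c e C : continuous f -> (forall z, `|f z| <= C) ->
  (forall z, M <= `|z| -> f z = 0) ->
  (forall z, `|z - p| <= `|q - p| -> `|f z - c| <= e) ->
  `|tail M f q - tail M f p + c * (q - p)| <= e * `|q - p|.
Proof.
move=> cf fC supp H.
have key a b : a <= b -> (forall z, a <= z <= b -> `|f z - c| <= e) ->
    `|(tail M f a - tail M f b) - c * (b - a)| <= e * (b - a).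
  move=> ab Hab; rewrite (tail_diff cf fC supp ab).
  have := @itv_integral_bounds _ f a b (c - e) (c + e) cf ab.
  have Hb w : w \in `[a, b] -> c - e <= f w <= c + e.
    by rewrite in_itv/= => /Hab; rewrite ler_norml; lra.
  move=> /(_ Hb); rewrite ler_norml; set J := Rintegral _ _ _.
  by move=> /andP[h1 h2]; apply/andP; split; lra.
have [pq|qp] := leP p q.
  rewrite (ger0_norm (x := q - p)) ?subr_ge0//.
  have := key p q pq; rewrite -normrN opprB opprD opprK.
  rewrite (_ : c * (q - p) + (- tail M f p + tail M f q) = tail M f q - tail M f p + c * (q - p)); last by ring.
  apply=> z /andP[pz zq]; apply: H.
  by rewrite !ger0_norm ?subr_ge0// lerD2r.
rewrite (ltr0_norm (x := q - p)) ?subr_lt0// opprB.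
have := key q p (ltW qp).
rewrite (_ : _ - _ - c * (p - q) = tail M f q - tail M f p + c * (q - p)); last by ring.
apply=> z /andP[qz zp]; apply: H.
by rewrite !ler0_norm ?subr_le0// ?(ltW qp)// lerN2 lerD2r.
Qed.

End tail.

Section potential.
Variables (phi dphi : R -> R -> R) (M C : R).
Hypothesis st : smooth_test phi dphi M C.

Let M0 : 0 < M. Proof. by case: st. Qed.
Let C0 : 0 <= C.
Proof. by have [h _] := smooth_test_bound st 0 0; apply: le_trans h. Qed.
Let cphi t : continuous (phi t).
Proof. apply: curry_continuous2; exact: smooth_test_cont st. Qed.
Let cdphi t : continuous (dphi t).
Proof. apply: curry_continuous2; exact: smooth_test_dcont st. Qed.
Let phiC t x : `|phi t x| <= C. Proof. by case: (smooth_test_bound st t x). Qed.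
Let dphiC t x : `|dphi t x| <= C. Proof. by case: (smooth_test_bound st t x). Qed.
Let phi_supp t x : M <= `|x| -> phi t x = 0.
Proof. by move=> h; have [] := smooth_test_supp st (t := t) (or_intror h). Qed.
Let dphi_supp t x : M <= `|x| -> dphi t x = 0.
Proof. by move=> h; have [] := smooth_test_supp st (t := t) (or_intror h). Qed.

Lemma tail_curve_continuous (f : R -> R -> R) (y : R -> R) :
  continuous (fun z : R * R => f z.1 z.2) -> (forall t x, `|f t x| <= C) ->
  (forall t x, M <= `|x| -> f t x = 0) -> continuous y ->
  continuous (fun t => tail M (f t) (y t)).
Proof.
move=> cf fC supp cy t0; apply/cvgrPdist_le => e e0.
have cft t : continuous (f t) by exact: curry_continuous2.
have d0 : 0 < e / 2 / (2 * M) by rewrite !divr_gt0// mulr_gt0.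
have [r r0 Hr] := uniform_in_space t0 d0 cf supp.
have C1 : 0 < C + 1 by rewrite ltr_wpDl.
have d1 : 0 < e / 2 / (C + 1) by rewrite !divr_gt0.
have /cvgrPdist_le/(_ _ d1) cy' := cy t0.
near=> t; rewrite distrC.
rewrite (_ : tail M (f t) (y t) - tail M (f t0) (y t0) =
    (tail M (f t) (y t) - tail M (f t) (y t0)) +
    (tail M (f t) (y t0) - tail M (f t0) (y t0))); last by ring.
rewrite (le_trans (ler_normD _ _))// (splitr e) lerD//.
- have := @tail_close M (f t) (y t0) (y t) 0 C C (cft t) (fC t) (supp t).
  rewrite mul0r addr0 => h; apply: le_trans (h _) _.
    by move=> z _; rewrite subr0.
  apply: (@le_trans _ _ ((C + 1) * `|y t - y t0|)).
    by rewrite ler_wpM2r// lerDl.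
  rewrite mulrC -ler_pdivlMr// distrC; near: t.
  exact: cy'.
- rewrite (_ : tail M (f t) (y t0) - tail M (f t0) (y t0) =
    tail M (fun z => f t z - f t0 z - 0 * f t z) (y t0)); last first.
    by rewrite (@tail_combine _ _ _ _ _ _ C)//; ring.
  have tr : `|t - t0| < r.
    by rewrite distrC; near: t; exact: (nbhsx_ballx t0 r r0).
  have := @tail_bound M M0 (fun z => f t z - f t0 z - 0 * f t z) (y t0) (e / 2 / (2 * M)).
  rewrite divfK ?gt_eqF ?mulr_gt0//; apply.
    have -> : (fun z => f t z - f t0 z - 0 * f t z) = (fun z => f t z - f t0 z).
      by apply/funext => z; rewrite mul0r subr0.
    by move=> z; apply: cvgB; exact: cft.
  by move=> z; rewrite mul0r subr0; exact: Hr.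
Unshelve. all: by end_near. Qed.

(** The mean value theorem calls for the derivative only at interior times, hence [t0 = 0] is
    allowed. *)
Lemma taylor_in_time (t0 e : R) : 0 <= t0 -> 0 < e ->
  exists2 r, 0 < r & forall s, 0 <= s <= r -> forall x,
    `|phi (t0 + s) x - phi t0 x - s * dphi t0 x| <= e * s.
Proof.
move=> t00 e0.
have [r r0 Hr] := uniform_in_space t0 e0 (smooth_test_dcont st) dphi_supp.
exists (r / 2); first by rewrite divr_gt0.
move=> s /andP[s0 sr] x.
have [c /[!in_itv]/= /andP[tc ct] ->] :
    exists2 c, c \in `[t0, t0 + s] & phi (t0 + s) x - phi t0 x = dphi c x * (t0 + s - t0).
  apply: (@MVT_segment R (phi ^~ x) (dphi ^~ x)); first by rewrite lerDl.
    move=> c /[!in_itv]/= /andP[tc _]; apply: smooth_test_derive st _ _ _.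
    exact: le_lt_trans tc.
  by apply: continuous_subspaceT; apply: curry_continuous1; exact: smooth_test_cont st.
rewrite addrAC subrr add0r mulrC -mulrBr normrM ger0_norm// mulrC ler_wpM2r//.
apply: Hr; rewrite ger0_norm ?subr_ge0//.
have : 0 < r / 2 by rewrite divr_gt0.
lra.
Qed.

(** Chain rule from the right along a straight path. Half of the error pays for the change of [phi]
    in time, spread over a segment of length [2 * M]; the other half pays for the displacement
    [s * v], and [1] is added to the speed so that it can be divided by. *)
Lemma tail_right_derivative (t0 p v e : R) : 0 <= t0 -> 0 < e ->
  exists2 r, 0 < r & forall s, 0 <= s <= r ->
    `|tail M (phi (t0 + s)) (p + s * v) - tail M (phi t0) p -
      s * (tail M (dphi t0) p - phi t0 p * v)| <= e * s.
Proof.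
move=> t00 e0.
have d0 : 0 < e / 2 / (2 * M) by rewrite !divr_gt0// mulr_gt0.
have [r1 r10 H1] := taylor_in_time t00 d0.
have v1 : 0 < `|v| + 1 by rewrite ltr_wpDl.
have d2 : 0 < e / 2 / (`|v| + 1) by rewrite !divr_gt0.
have /cvgrPdist_lt/(_ _ d2)[[A1 A2] /= [A1t A2x] H2] := @smooth_test_cont _ _ _ _ st (t0, p).
have [r2 /= r20 A1r] := (nbhs_ballP _ _).1 A1t.
have [r3 /= r30 A2r] := (nbhs_ballP _ _).1 A2x.
pose r := Num.min r1 (Num.min (r2 / 2) (r3 / 2 / (`|v| + 1))).
exists r; first by rewrite !lt_min r10 !divr_gt0.
move=> s /andP[s0]; rewrite !le_min => /and3P[sr1 sr2 sr3].
set q := p + s * v.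
have qp : `|q - p| = s * `|v| by rewrite /q addrAC subrr add0r normrM ger0_norm.
have B1 : `|tail M (phi (t0 + s)) p - tail M (phi t0) p - s * tail M (dphi t0) p| <= e / 2 * s.
  rewrite -(@tail_combine M (phi (t0 + s)) (phi t0) (dphi t0) p s C)//.
  have -> : e / 2 * s = e / 2 / (2 * M) * s * (2 * M).
    by rewrite [RHS]mulrAC divfK// gt_eqF// mulr_gt0.
  apply: (@tail_bound M M0 (fun z => phi (t0 + s) z - phi t0 z - s * dphi t0 z)).
    move=> z; apply: cvgB; first by apply: cvgB; exact: cphi.
    by apply: cvgM; [exact: cvg_cst|exact: cdphi].
  by move=> z; apply: H1; rewrite s0.
have B2 : `|tail M (phi (t0 + s)) q - tail M (phi (t0 + s)) p + phi t0 p * (q - p)| <=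
    e / 2 / (`|v| + 1) * `|q - p|.
  apply: (@tail_close M _ p q _ _ C) => // [z|z zpq]; first exact: phi_supp.
  rewrite ltW// distrC; apply: (H2 (t0 + s, z)); split => /=.
    apply: A1r; rewrite /ball/= opprD addrA subrr add0r normrN ger0_norm//.
    by apply: le_lt_trans sr2 _; rewrite ltr_pdivrMr// mulr_natr mulr2n ltrDl.
  apply: A2r; rewrite /ball/= distrC; apply: le_lt_trans zpq _; rewrite qp.
  apply: (@le_lt_trans _ _ (s * (`|v| + 1))); first by rewrite ler_wpM2l// lerDl.
  rewrite -ltr_pdivlMr//; apply: le_lt_trans sr3 _.
  by rewrite ltr_pM2r ?invr_gt0// ltr_pdivrMr// mulr_natr mulr2n ltrDl.
have B3 : e / 2 / (`|v| + 1) * `|q - p| <= e / 2 * s.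
  rewrite qp (_ : _ * _ = (e / 2 * s) * (`|v| / (`|v| + 1))); last by ring.
  by rewrite ler_piMr ?mulr_ge0 ?divr_ge0 ?(ltW e0)// ler_pdivrMr// mul1r lerDl.
rewrite (_ : _ - _ - _ =
  (tail M (phi (t0 + s)) q - tail M (phi (t0 + s)) p + phi t0 p * (q - p)) +
  (tail M (phi (t0 + s)) p - tail M (phi t0) p - s * tail M (dphi t0) p)); last first.
  by rewrite /q; ring.
apply: (le_trans (ler_normD _ _)); rewrite (splitr e) mulrDl lerD//.
exact: le_trans B2 B3.
Qed.

End potential.
End test_functions.

Section discrete_weak_identity.
Context {R : realType} {d n : nat}.
Variables (F : 'I_d -> 'rV[R]_d -> R) (A B : 'I_d -> R).
Hypothesis F_cont : forall g, continuous (F g).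
Hypothesis F_bd : forall g u, A g <= F g u <= B g.
Variable y : R -> 'M[R]_(d, n).
Hypothesis y_cont : forall g k, continuous (fun t => y t g k).
Implicit Types (g h : 'I_d) (k l : 'I_n).

Definition speed_bound g : R := Num.max `|A g| `|B g|.

Lemma norm_le_max (a b z : R) : a <= z <= b -> `|z| <= Num.max `|a| `|b|.
Proof.
move=> /andP[az zb]; rewrite le_max; apply/orP; have [z0|z0] := leP 0 z.
  by right; rewrite ger0_norm// (le_trans zb)// ler_norm.
by left; rewrite ltr0_norm//; have := ler_norm (- a); rewrite normrN; lra.
Qed.

Lemma F_norm g u : `|F g u| <= speed_bound g.
Proof. exact: norm_le_max. Qed.

Lemma char_speed_norm (z : 'M[R]_(d, n)) g k : `|char_speed F z g k| <= speed_bound g.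
Proof.
by apply: norm_le_max; apply: slice_bounds => // w; exact: F_replace_continuous.
Qed.

Lemma rank_sum (z : 'M[R]_(d, n)) (p : R) h :
  rank z p h = (\sum_l (z h l <= p)%R%:R) / n%:R.
Proof.
by rewrite /rank -sum1_card natr_sum big_mkcond/=; congr (_ / _);
  apply: eq_bigr => l _; rewrite inE; case: (_ <= _).
Qed.

Lemma char_speed_measurable g k :
  measurable_fun setT (fun t : measurableTypeR R => char_speed F (y t) g k).
Proof.
apply: measurable_funM => //.
set a := k%:R / n%:R; set b := k.+1%:R / n%:R.
pose f (z : measurableTypeR R * measurableTypeR R) : R :=
  F g (\row_h (if h == g then z.2 else rank (y z.1) (y z.1 g k) h)).
have mf : measurable_fun setT f.
  apply: (measurable_continuous_row (u := fun h z =>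
    if h == g then z.2 else rank (y z.1) (y z.1 g k) h)) => // h.
  case: (h == g); first exact: measurable_snd.
  under eq_fun do rewrite rank_sum; apply: measurable_funM => //.
  apply: measurable_sum => l; apply: measurable_leR.
    have m1 : measurable_fun setT (fun t : measurableTypeR R => y t h l).
      exact: continuous_measurableR.
    exact: (measurableT_comp m1 measurable_fst).
  have m1 : measurable_fun setT (fun t : measurableTypeR R => y t g k).
    exact: continuous_measurableR.
  exact: (measurableT_comp m1 measurable_fst).
have := @measurable_Rintegral R _ _ _ _ (leb_itv 0 1) (leb_itv a b) f (speed_bound g) mf
  (fun z => F_norm g _).
congr (measurable_fun setT _); apply/funext => t; rewrite leb_itv_integral//.
exact: (measurableT_comp mf (pair1_measurable _)).
Qed.

Variables (phi dphi : R -> R -> R) (M C : R).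
Hypothesis st : smooth_test phi dphi M C.
Hypothesis y_char : forall t, 0 <= t -> locally_characteristic F A B y t.
Variable g : 'I_d.

Let M0 : 0 < M. Proof. by case: st. Qed.
Let C0 : 0 <= C.
Proof. by have [h _] := smooth_test_bound st 0 0; apply: le_trans h. Qed.
Let cphi t : continuous (phi t).
Proof. apply: curry_continuous2; exact: smooth_test_cont st. Qed.
Let cdphi t : continuous (dphi t).
Proof. apply: curry_continuous2; exact: smooth_test_dcont st. Qed.
Let phiC t x : `|phi t x| <= C. Proof. by case: (smooth_test_bound st t x). Qed.
Let dphiC t x : `|dphi t x| <= C. Proof. by case: (smooth_test_bound st t x). Qed.

(** Up to the factor [n], the integral of [phi t] against the empirical distribution function of
    type [g]; [dpotential] is the same with the time derivative, and [flux] is the transport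
    term. *)
Definition potential t : R := \sum_k tail M (phi t) (y t g k).
Definition dpotential t : R := \sum_k tail M (dphi t) (y t g k).
Definition flux t : R := \sum_k phi t (y t g k) * char_speed F (y t) g k.

Lemma sum_continuous (f : 'I_n -> R -> R) : (forall k, continuous (f k)) ->
  continuous (fun t => \sum_k f k t).
Proof.
move=> cf t; apply: (@cvg_big _ _ +%R 0 _ _ _ _ _ f) => //.
- by move=> z; exact: add_continuous.
- by move=> k _; exact: cf.
Qed.

Lemma potential_continuous : continuous potential.
Proof.
apply: sum_continuous => k; apply: (tail_curve_continuous st) => //.
- exact: smooth_test_cont st.
- by move=> t x h; have [] := smooth_test_supp st (t := t) (or_intror h).
Qed.

Lemma dtail_continuous k : continuous (fun t => tail M (dphi t) (y t g k)).
Proof.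
apply: (tail_curve_continuous st) => //.
- exact: smooth_test_dcont st.
- by move=> t x h; have [] := smooth_test_supp st (t := t) (or_intror h).
Qed.

Lemma dpotential_continuous : continuous dpotential.
Proof. by apply: sum_continuous => k; exact: dtail_continuous. Qed.

Lemma dpotential_bound t : `|dpotential t| <= n%:R * (C * (2 * M)).
Proof.
rewrite /dpotential (le_trans (ler_norm_sum _ _ _))//.
rewrite mulr_natl -[X in _ *+ X]card_ord -sumr_const; apply: ler_sum => k _.
exact: tail_bound.
Qed.

Lemma flux_measurable : measurable_fun setT (flux : measurableTypeR R -> R).
Proof.
apply: measurable_sum => k; apply: measurable_funM.
  apply: continuous_measurableR; apply: curve_continuous => //.
  exact: smooth_test_cont st.
exact: char_speed_measurable.
Qed.

Lemma flux_bound t : `|flux t| <= n%:R * (C * speed_bound g).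
Proof.
rewrite /flux (le_trans (ler_norm_sum _ _ _))//.
rewrite mulr_natl -[X in _ *+ X]card_ord -sumr_const; apply: ler_sum => k _.
by rewrite normrM ler_pM//; exact: char_speed_norm.
Qed.

Let H : measurableTypeR R -> R := fun t => dpotential t - flux t.

Let mH : measurable_fun setT H.
Proof.
apply: measurable_funB; last exact: flux_measurable.
by apply: continuous_measurableR; exact: dpotential_continuous.
Qed.

Let HC t : `|H t| <= n%:R * (C * (2 * M)) + n%:R * (C * speed_bound g).
Proof.
rewrite (le_trans (ler_normB _ _))// lerD//.
  exact: dpotential_bound.
exact: flux_bound.
Qed.

(** [potential] minus the primitive of [H] has zero right derivative, although [H] itself may jump
    at [t0]: only its values at later times enter the primitive. *)
Lemma potential_increment (e t0 : R) : 0 < e -> 0 <= t0 ->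
  exists2 r, 0 < r & forall s, 0 <= s <= r ->
    `|(potential (t0 + s) - primitive H (t0 + s)) - (potential t0 - primitive H t0)| <= e * s.
Proof.
move=> e0 t00.
have [e1 e10 [v vb [mv chs]]] := y_char t00.
(* The velocities [v] valid just after [t0] are frozen, which makes [Hc] continuous. By the momentum
   balance it coincides with [H] strictly after [t0], and its value at [t0] is the right derivative
   of the potential. *)
pose Hc t := \sum_k (tail M (dphi t) (y t g k) - phi t (y t g k) * v g k).
have cHc : continuous Hc.
  apply: sum_continuous => k t; apply: cvgB; first exact: dtail_continuous.
  apply: cvgM; last exact: cvg_cst.
  by apply: curve_continuous => //; exact: smooth_test_cont st.
have n1 : 0 < n.+1%:R :> R by rewrite ltr0n.
have e2 : 0 < e / 2 by rewrite divr_gt0.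
(* The error is shared among [n] particles; dividing by [n.+1] also covers [n = 0]. *)
have en : 0 < e / 2 / n.+1%:R by rewrite divr_gt0.
have /cvgrPdist_le/(_ _ e2)/nbhs_ballP[r2 /= r20 Hr2] := cHc t0.
have [||r1 r10 Hr1] := @finite_positive_bound R 'I_n (fun k r => forall s, 0 <= s <= r ->
    `|tail M (phi (t0 + s)) (y t0 g k + s * v g k) - tail M (phi t0) (y t0 g k) -
      s * (tail M (dphi t0) (y t0 g k) - phi t0 (y t0 g k) * v g k)| <= e / 2 / n.+1%:R * s).
- by move=> k; exact: (tail_right_derivative st).
- by move=> k r r' /andP[r'0 rr] Hk s /andP[s0 sr]; apply: Hk; rewrite s0 (le_trans sr).
exists (Num.min e1 (Num.min r1 (r2 / 2))); first by rewrite !lt_min e10 r10 divr_gt0.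
move=> s /andP[s0]; rewrite !le_min => /and3P[se1 sr1 sr2].
have s0e : 0 <= s <= e1 by rewrite s0.
have Ha : `|potential (t0 + s) - potential t0 - s * Hc t0| <= e / 2 * s.
  rewrite /potential /Hc -sumrB mulr_sumr -sumrB.
  apply: (le_trans (ler_norm_sum _ _ _)).
  apply: (@le_trans _ _ (\sum_(k < n) (e / 2 / n.+1%:R * s))).
    by apply: ler_sum => k _; rewrite mv//; apply: Hr1; rewrite s0.
  rewrite sumr_const card_ord -[leLHS]mulr_natr [leLHS]mulrAC ler_wpM2r//.
  by rewrite -[leLHS]mulrA ler_piMr ?(ltW e2)// mulrC ler_pdivrMr// mul1r ler_nat.
have Hb : `|primitive H (t0 + s) - primitive H t0 - Hc t0 * (t0 + s - t0)| <=
    e / 2 * (t0 + s - t0).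
  apply: (primitive_increment mH HC) => //; [by rewrite lerDl|exact: ltW|].
  move=> r /andP[tr rs]; have rE : r = t0 + (r - t0) by ring.
  have r0 : 0 < r - t0 by rewrite subr_gt0.
  have rs' : r - t0 <= s by rewrite lerBlDl.
  have -> : H r = Hc r.
    rewrite /H /dpotential /flux /Hc sumrB; congr (_ - _).
    by rewrite rE -chs// r0 (le_trans rs').
  rewrite distrC; apply: Hr2; rewrite /ball/= distrC ger0_norm ?(ltW r0)//.
  apply: le_lt_trans rs' _; apply: le_lt_trans sr2 _.
  by rewrite ltr_pdivrMr// mulr_natr mulr2n ltrDl.
have ts : t0 + s - t0 = s by ring.
move: Hb; rewrite ts => Hb.
rewrite (_ : _ - _ = (potential (t0 + s) - potential t0 - s * Hc t0) -
  (primitive H (t0 + s) - primitive H t0 - Hc t0 * s)); last by ring.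
by rewrite (le_trans (ler_normB _ _))// (splitr e) mulrDl lerD.
Qed.

(** A continuous function with zero right derivative is constant: with slopes at least [- (e / M)]
    for it and for its opposite, real induction on a segment of length [M] loses at most [e]. The
    potential vanishes at time [M] because the test function does. *)
Lemma discrete_weak_identity :
  \int[leb_itv 0 M]_t dpotential t + potential 0 = \int[leb_itv 0 M]_t flux t.
Proof.
pose f t := potential t - primitive H t.
have cf : continuous f.
  move=> t; apply: cvgB; first exact: potential_continuous.
  exact: (primitive_continuous mH HC).
have fM : f M = f 0.
  apply/eqP; rewrite eq_le; apply/andP; split; apply/ler_addgt0Pr => e e0.
  - have eM : 0 < e / M by rewrite divr_gt0.
    suff : - f 0 + - (e / M) * (M - 0) <= - f M.
      by rewrite subr0 mulNr divfK ?gt_eqF//; lra.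
    apply: (@right_slope_increasing _ (fun t => - f t)); [|exact: ltW|].
      by move=> t; apply: cvgN; exact: cf.
    move=> t /andP[t0 _]; have [r r0 Hr] := potential_increment eM t0.
    exists r => // s /Hr; rewrite -/(f t) -/(f (t + s)) ler_norml => /andP[_].
    by rewrite mulNr; lra.
  - have eM : 0 < e / M by rewrite divr_gt0.
    suff : f 0 + - (e / M) * (M - 0) <= f M.
      by rewrite subr0 mulNr divfK ?gt_eqF//; lra.
    apply: right_slope_increasing => //; first exact: ltW.
    move=> t /andP[t0 _]; have [r r0 Hr] := potential_increment eM t0.
    exists r => // s /Hr; rewrite -/(f t) -/(f (t + s)) ler_norml => /andP[h _].
    by rewrite mulNr; lra.
have pM : potential M = 0.
  rewrite /potential big1// => k _; rewrite /tail -[RHS](mul0r (fine (leb_itv (- M) M setT))).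
  rewrite -Rintegral_cst//; apply: eq_Rintegral => z _.
  by have [-> _] := smooth_test_supp st (x := z) (or_introl (lexx M)); rewrite mul0r.
have p0 : primitive H 0 = 0 by rewrite /primitive set_itv1 Rintegral_set1.
move: fM; rewrite /f pM p0 /primitive -leb_itv_integral// /H RintegralB//.
- by lra.
- apply: (@bounded_integrable _ _ _ _ _ (n%:R * (C * (2 * M)))); last exact: dpotential_bound.
  by apply: continuous_measurableR; exact: dpotential_continuous.
- apply: (@bounded_integrable _ _ _ _ _ (n%:R * (C * speed_bound g))); last exact: flux_bound.
  exact: flux_measurable.
Qed.

End discrete_weak_identity.

(** * Compactness *)

Section trajectory_convergence.
Context {R : realType} {d : nat}.
Implicit Types (w : trajectory R d) (K : R).

Definition path_lipschitz K w := forall (s t : halfline R) g,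
  `|w s 0 g - w t 0 g| <= K * `|\val s - \val t|.

Lemma val_halfline_continuous : continuous (\val : halfline R -> R).
Proof. exact: initial_continuous. Qed.

Lemma path_lipschitz_equicontinuous K :
  equicontinuous ([set w | path_lipschitz K w] : set (trajectory R d))
    (fun w : trajectory R d => (w : halfline R -> 'rV[R]_d)).
Proof.
move=> t E /=; rewrite -entourage_ballE => -[e /= e0 eE].
have K1 : 0 < `|K| + 1 by rewrite ltr_wpDl.
have eK : 0 < e / (`|K| + 1) by rewrite divr_gt0.
have /cvgrPdist_lt/(_ _ eK) := @val_halfline_continuous t.
apply: filterS => s st w wK; apply: eE => /=; split => // i j.
rewrite (ord1 i) /ball/=; apply: (le_lt_trans (wK _ _ _)).
apply: (@le_lt_trans _ _ ((`|K| + 1) * `|\val t - \val s|)).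
  by rewrite ler_wpM2r// (le_trans (ler_norm K))// lerDl.
by rewrite mulrC -ltr_pdivlMr.
Qed.

(** Ascoli: on an equicontinuous family, pointwise convergence is locally uniform convergence. The
    general filter serves both sequences of paths and paths indexed by a nearby [v]. *)
Lemma trajectory_cvg (I : Type) (F : set_system I) {FF : ProperFilter F}
    (W : I -> trajectory R d) w K : (forall i, path_lipschitz K (W i)) ->
  (forall t g, W i t 0 g @[i --> F] --> w t 0 g) -> W @ F --> w.
Proof.
move=> WK Wp.
pose iota (v : trajectory R d) : {family compact, halfline R -> 'rV[R]_d} := v.
have cv : (iota \o W) @ F --> iota w.
  pose W' i : {ptws halfline R -> 'rV[R]_d} := W i.
  have PF : ProperFilter (W' @ F) by exact: fmap_proper_filter.
  apply: (@pointwise_compact_cvg _ _ (W' @ F) (w : {ptws halfline R -> 'rV[R]_d}) PF _).1.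
    apply/near_powerset_filter_fromP.
      by move=> V1 V2 sub; exact: equicontinuous_subset_id.
    exists [set v : {ptws halfline R -> 'rV[R]_d} |
      exists2 u : trajectory R d, path_lipschitz K u & v = u] => /=.
      by apply: nearW => i; exists (W i).
    move=> t E entE; apply: filterS (path_lipschitz_equicontinuous K t entE).
    by move=> s H _ [u uK ->]; exact: (H u uK).
  apply/(@pointwise_cvgP _ _ (W' @ F) (w : {ptws halfline R -> 'rV[R]_d}) _).2 => t.
  move=> A [P fP PA]; rewrite /fmap /=.
  have : \forall i \near F, forall ij : 'I_1 * 'I_d, P ij.1 ij.2 (W i t ij.1 ij.2).
    by apply: filter_forall => -[i j] /=; have := fP i j; rewrite (ord1 i); exact: Wp.
  by apply: filterS => i Pi; apply: PA => i' j; exact: (Pi (i', j)).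
move=> A; rewrite nbhsE => -[B [[C oC CB] Bw] BA].
have : nbhs (iota w) C by apply: open_nbhs_nbhs; split => //; move: Bw; rewrite -CB.
move=> /cv CF; apply: (@filterS _ F _ [set i | C (iota (W i))]) => // i Ci.
by apply: BA; rewrite -CB.
Qed.

End trajectory_convergence.

(** * Selection of convergent monotone functions *)

Section helly.
Context {R : realType}.

(* A cluster point in a product of segments (Tychonoff) replaces the usual
   nested extraction. *)
Lemma diagonal_subsequence (I : countType) (a : I -> nat -> R) :
  (forall i, exists M, forall n, `|a i n| <= M) ->
  exists r : nat -> nat, {homo r : i j / (i < j)%N >-> (i < j)%N} /\
    forall i, cvgn (a i \o r).
Proof.
move=> /choice[M HM].
pose K := [set f : forall i : I, R | forall i, `[- M i, M i]%classic (f i)].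
have cK : compact (K : set (prod_topology (fun _ : I => R))).
  by apply: (@tychonoff I (fun=> R) (fun i => `[- M i, M i]%classic)) => i; exact: segment_compact.
pose A n : prod_topology (fun _ : I => R) := fun i => a i n.
have FK : (A @ \oo) K.
  by exists 0%N => // n _ i /=; rewrite in_itv/= -ler_norml HM.
have [p [_ clp]] := cK (A @ \oo) _ FK.
have step N k : exists n, (N <= n)%N /\
    forall i, (pickle i < k)%N -> `|a i n - p i| < k.+1%:R^-1.
  pose U : set (prod_topology (fun _ : I => R)) :=
    [set f | forall j : 'I_k, forall i, unpickle j = Some i -> `|f i - p i| < k.+1%:R^-1].
  have pU : \forall f \near (p : prod_topology (fun _ : I => R)), U f.
    have H : forall j : 'I_k, \forall f \near (p : prod_topology (fun _ : I => R)),
        forall i, unpickle j = Some i -> `|f i - p i| < k.+1%:R^-1; last first.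
      exact: (@filter_forall _ _ _ _ (@nbhs_filter (prod_topology (fun _ : I => R)) p) H).
    move=> j; case: (unpickle j) => [i|]; last first.
      exact: (@filterE _ _ (@nbhs_filter (prod_topology (fun _ : I => R)) p)).
    have k0 : 0 < k.+1%:R^-1 :> R by rewrite invr_gt0.
    have cp : (fun f : prod_topology (fun _ : I => R) => f i) @
        (p : prod_topology (fun _ : I => R)) --> p i.
      exact: (@proj_continuous I (fun _ : I => R) i p).
    have := cp _ (nbhsx_ballx (p i) _ k0).
    apply: (@filterS _ _ (@nbhs_filter (prod_topology (fun _ : I => R)) p)) => f.
    by rewrite /ball/= => fi i' [<-]; rewrite distrC.
  have [|_ [[n Nn <-] Un]] := clp [set A n | n in [set n | (N <= n)%N]] U _ pU.
    by exists N => // n Nn; exists n.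
  exists n; split => // i ik; apply: (Un (Ordinal ik)) => /=; exact: pickleK.
have /choice[f Hf] : forall Nk : nat * nat, exists n, (Nk.1 <= n)%N /\
    forall i, (pickle i < Nk.2)%N -> `|a i n - p i| < Nk.2.+1%:R^-1.
  by move=> [N k]; exact: step.
pose r := fix r k := if k is k'.+1 then f ((r k').+1, k) else f (0%N, 0%N).
have rS k : (r k < r k.+1)%N by have [] := Hf ((r k).+1, k.+1).
exists r; split; first exact: (homo_ltn ltn_trans).
move=> i; apply/cvg_ex; exists (p i); apply/cvgrPdist_lt => e e0.
near=> k; rewrite distrC /=.
have ik : (pickle i < k)%N by near: k; exact: nbhs_infty_gt.
apply: (@lt_trans _ _ k.+1%:R^-1); last by near: k; exact: near_infty_natSinv_lt (PosNum e0).
have HS k' : (pickle i < k')%N -> `|a i (r k') - p i| < k'.+1%:R^-1.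
  by case: k' => // k' ik'; have [_ /(_ i ik')] := Hf ((r k').+1, k'.+1).
exact: HS.
Unshelve. all: by end_near. Qed.

Let unitq (q : rat) := 0 < (ratr q : R) < 1.

Section jumps.
Variable L : rat -> R.
Hypothesis L_nd : forall q q', unitq q -> unitq q' -> q < q' -> L q <= L q'.

(** Discontinuities of a monotone function known only at rational points: the jump is measured by
    rationals on either side of [v]. *)
Definition jump : set R := [set v | 0 < v < 1 /\ exists2 e, 0 < e &
  forall q q', unitq q -> unitq q' -> ratr q < v < ratr q' -> e <= L q' - L q].

Lemma rat_between (a b : R) : a < b -> exists q : rat, a < ratr q < b.
Proof. by move=> /rat_in_itvoo[q]; rewrite in_itv/=; exists q. Qed.

(** The jump opens a gap of height [e] above the supremum of the values to the left, and a rational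
    level fits inside. *)
Lemma jump_level v : jump v -> exists c : rat, forall q q', unitq q -> unitq q' ->
  ratr q < v < ratr q' -> L q < ratr c < L q'.
Proof.
move=> [/andP[v0 v1] [e e0 He]].
have [q0 /andP[q00 q0v]] := rat_between v0.
have [q1 /andP[vq1 q11]] := rat_between v1.
have u0 : unitq q0 by rewrite /unitq q00 (lt_trans q0v v1).
have u1 : unitq q1 by rewrite /unitq q11 (lt_trans v0 vq1).
pose S := [set L q | q in [set q | unitq q /\ ratr q < v]].
have hsS : has_sup S.
  split; first by exists (L q0); exists q0.
  exists (L q1) => _ [q [uq qv] <-].
  by have := He q q1 uq u1; rewrite qv vq1 => /(_ isT); lra.
have [c /andP[c1 c2]] : exists c : rat, sup S < ratr c < sup S + e.
  by apply: rat_between; rewrite ltrDl.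
exists c => q q' uq uq' /andP[qv vq']; apply/andP; split.
  by apply: le_lt_trans c1; apply: sup_upper_bound => //; exists q.
apply: (lt_le_trans c2); rewrite -lerBrDr; apply: ge_sup; first exact: hsS.1.
move=> _ [q2 [uq2 q2v] <-]; have := He q2 q' uq2 uq'.
by rewrite q2v vq' => /(_ isT); lra.
Qed.

(** By monotonicity the rational levels chosen in the gaps increase strictly with the jump point,
    which is thus encoded injectively. *)
Lemma jump_countable : countable jump.
Proof.
have /choice[c Hc] : forall v, exists c : rat, jump v -> forall q q', unitq q -> unitq q' ->
    ratr q < v < ratr q' -> L q < ratr c < L q'.
  move=> v; have [/jump_level[c Hc]|nj] := pselect (jump v); first by exists c.
  by exists 0.
apply/countable_injP; exists (fun v => pickle (c v)) => v w /set_mem jv /set_mem jw.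
move=> /(pcan_inj pickleK) cvw.
have lt_c a b : jump a -> jump b -> a < b -> ratr (c a) < ratr (c b) :> R.
  move=> ja jb ab; have [q /andP[aq qb]] := rat_between ab.
  have [/andP[a0 a1] _] := ja; have [/andP[b0 b1] _] := jb.
  have [q0 /andP[q00 q0a]] := rat_between a0.
  have [q1 /andP[bq1 q11]] := rat_between b1.
  have uq : unitq q by rewrite /unitq (lt_trans a0 aq) (lt_trans qb b1).
  have u0 : unitq q0 by rewrite /unitq q00 (lt_trans q0a a1).
  have u1 : unitq q1 by rewrite /unitq q11 (lt_trans b0 bq1).
  have := Hc a ja q0 q u0 uq; rewrite q0a aq => /(_ isT)/andP[_ h1].
  have := Hc b jb q q1 uq u1; rewrite qb bq1 => /(_ isT)/andP[h2 _].
  exact: lt_trans h1 h2.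
have [vw|wv|//] := ltgtP v w; [have := lt_c _ _ jv jw vw|have := lt_c _ _ jw jv wv];
  by rewrite cvw ltxx.
Qed.

End jumps.

(** Between rational points where the limits differ by little, monotonicity traps the values at [v].
    The same trap yields continuity of the limit at [v] along the complement of [N], used later for
    the measurability of the limit trajectories. [J] will be the set of pairs of a rational time and
    a type. *)
Lemma helly (J : countType) (f : J -> nat -> R -> R) :
  (forall j n v w, 0 < v -> v <= w -> w < 1 -> f j n v <= f j n w) ->
  (forall j v, 0 < v < 1 -> exists M, forall n, `|f j n v| <= M) ->
  exists r : nat -> nat, {homo r : i j / (i < j)%N >-> (i < j)%N} /\
  exists N : set R, countable N /\
  forall v, 0 < v < 1 -> ~ N v -> forall j,
    cvgn (fun n => f j (r n) v) /\
    forall e, 0 < e -> exists q q', q < v < q' /\ forall w, 0 < w < 1 -> ~ N w -> q < w < q' ->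
      `|limn (fun n => f j (r n) w) - limn (fun n => f j (r n) v)| <= e.
Proof.
move=> f_nd f_bd.
(* Rationals outside the open unit interval, where no bound is available, contribute the zero
   sequence. *)
pose a (i : J * rat) n := if unitq i.2 then f i.1 n (ratr i.2) else 0.
have [|r [r_incr ar]] := @diagonal_subsequence (J * rat)%type a.
  move=> [j q]; have [uq|nuq] := boolP (unitq q).
    by have [M HM] := f_bd j (ratr q) uq; exists M => n; rewrite /a/= uq.
  by exists 0 => n; rewrite /a/= (negbTE nuq) normr0.
exists r; split => //.
pose L j q := limn (fun n => f j (r n) (ratr q)).
have cL j q : unitq q -> f j (r n) (ratr q) @[n --> \oo] --> L j q.
  move=> uq; have := ar (j, q).
  by rewrite (_ : a (j, q) \o r = fun n => f j (r n) (ratr q))//;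
    apply/funext => n; rewrite /a /= uq.
have L_nd j q q' : unitq q -> unitq q' -> q < q' -> L j q <= L j q'.
  move=> uq uq' qq'; apply: ler_lim.
  - by apply/cvg_ex; exists (L j q); exact: cL.
  - by apply/cvg_ex; exists (L j q'); exact: cL.
  apply: nearW => n; case/andP : uq => q0 _; case/andP: uq' => _ q1.
  by apply: f_nd => //; rewrite ler_rat ltW.
exists (\bigcup_j jump (L j)); split.
  by apply: bigcup_countable => [|j _]; [exact: countableP|exact: jump_countable].
have good v j : 0 < v < 1 -> ~ (\bigcup_j jump (L j)) v -> forall e, 0 < e ->
    exists q q', [/\ unitq q, unitq q', ratr q < v < ratr q' & L j q' - L j q < e].
  move=> v01 nv e e0; apply: contrapT => H; apply: nv; exists j => //; split => //.
  exists e => // q q' uq uq' qvq'; rewrite leNgt; apply/negP => lt.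
  by apply: H; exists q, q'.
have sandwich v j q q' : 0 < v < 1 -> unitq q -> unitq q' -> ratr q < v < ratr q' ->
    forall e, 0 < e -> \forall n \near \oo, L j q - e <= f j (r n) v <= L j q' + e.
  move=> /andP[v0 v1] uq uq' /andP[qv vq'] e e0.
  have /cvgrPdist_le/(_ _ e0) := cL j q uq; have /cvgrPdist_le/(_ _ e0) := cL j q' uq'.
  apply: filterS2 => n; rewrite !ler_norml => /andP[h1 h2] /andP[h3 h4].
  case/andP : (uq) => q0 _; case/andP: (uq') => _ q1.
  have := f_nd j (r n) _ _ q0 (ltW qv) v1; have := f_nd j (r n) _ _ v0 (ltW vq') q1.
  by lra.
have cv v j : 0 < v < 1 -> ~ (\bigcup_j jump (L j)) v -> cvgn (fun n => f j (r n) v).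
  move=> v01 nv; apply: cauchy_cvg; apply/cauchyP => e e0.
  have e3 : 0 < e / 3 by rewrite divr_gt0.
  have [q [q' [uq uq' qvq' Lqq']]] := good v j v01 nv _ e3.
  exists (L j q); have := sandwich v j q q' v01 uq uq' qvq' _ e3.
  apply: filterS => n; rewrite /ball/= ltr_norml => /andP[h1 h2].
  by lra.
have sand_lim v j q q' : 0 < v < 1 -> ~ (\bigcup_j jump (L j)) v ->
    unitq q -> unitq q' -> ratr q < v < ratr q' ->
    L j q <= limn (fun n => f j (r n) v) <= L j q'.
  move=> v01 nv uq uq' qvq'; apply/andP; split; apply/ler_addgt0Pr => e e0.
  - rewrite -lerBlDr; apply: limr_ge; first exact: cv.
    by have := sandwich v j q q' v01 uq uq' qvq' _ e0; apply: filterS => n /andP[].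
  - apply: limr_le; first exact: cv.
    by have := sandwich v j q q' v01 uq uq' qvq' _ e0; apply: filterS => n /andP[].
move=> v v01 nv j; split; first exact: cv.
move=> e e0; have [q [q' [uq uq' qvq' Lqq']]] := good v j v01 nv _ e0.
exists (ratr q), (ratr q'); split => // w w01 nw qwq'.
have /andP[h1 h2] := sand_lim v j q q' v01 nv uq uq' qvq'.
have /andP[h3 h4] := sand_lim w j q q' w01 nw uq uq' qwq'.
by rewrite ler_norml; lra.
Qed.

End helly.

(** * The weak identity in quantile coordinates *)

Section unit_interval_coupling.
Context {R : realType}.
Notation mu := (@lebesgue_measure R).

Lemma Rintegral_sum dT (T : measurableType dT) (m : {measure set T -> \bar R})
    (I : Type) (s : seq I) (f : I -> T -> R) :
  (forall i, m.-integrable setT (EFin \o f i)) ->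
  \int[m]_x (\sum_(i <- s) f i x) = \sum_(i <- s) \int[m]_x f i x.
Proof.
move=> intf; elim: s => [|i s IH].
  by under eq_Rintegral do rewrite big_nil; rewrite big_nil Rintegral_cst// mul0r.
under eq_Rintegral do rewrite big_cons.
rewrite big_cons -IH RintegralD//.
have H : m.-integrable setT (fun x => (\sum_(i <- s) (EFin \o f i) x)%E).
  by apply: integrable_sum => // i _; exact: intf.
by apply: eq_integrable H => // x _ /=; rewrite sumEFin.
Qed.

Section index.
Variable n : nat.
Implicit Types (v w : R) (k : 'I_n.+1).

(* The particle carrying the mass [v] in the quantile coupling. *)
Definition idx v : 'I_n.+1 := inord (minn n (Num.truncn (n.+1%:R * v))).

Lemma idx_le v w : v <= w -> (idx v <= idx w)%N.
Proof.
move=> vw; rewrite !inordK ?ltnS ?geq_minl//.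
rewrite leq_min geq_minl/= geq_min; apply/orP; right.
by apply: le_truncn; rewrite ler_pM2l// ltr0n.
Qed.

Lemma idx_eq v k : 0 <= v < 1 ->
  (idx v == k) = (k%:R / n.+1%:R <= v < k.+1%:R / n.+1%:R).
Proof.
move=> /andP[v0 v1]; have n0 : 0 < n.+1%:R :> R by rewrite ltr0n.
have nv0 : 0 <= n.+1%:R * v by rewrite mulr_ge0.
have /andP[t1 t2] := truncn_itv nv0.
have tn : (Num.truncn (n.+1%:R * v) <= n)%N.
  rewrite -ltnS -(ltr_nat R); apply: (le_lt_trans t1).
  by rewrite -[ltRHS]mulr1 ltr_pM2l.
rewrite ler_pdivrMr// ltr_pdivlMr// mulrC.
apply/eqP/idP => [<-|/andP[h1 h2]].
  by rewrite inordK ?ltnS ?geq_minl// (minn_idPr tn) t1 t2.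
apply/val_inj; rewrite /= inordK ?ltnS ?geq_minl// (minn_idPr tn).
apply/eqP; rewrite eqn_leq -ltnS -[X in _ && X]ltnS.
by rewrite -!(ltr_nat R) (le_lt_trans t1 h2) (le_lt_trans h1 t2).
Qed.

Lemma measurable_idx k : measurable [set v : measurableTypeR R | idx v == k].
Proof.
apply: is_interval_measurable => a b /= /eqP ak /eqP bk z /andP[az zb].
apply/eqP/val_inj/eqP; rewrite /= eqn_leq; apply/andP; split.
  by rewrite -bk idx_le.
by rewrite -ak idx_le.
Qed.

Lemma measurable_idx_indic k :
  measurable_fun setT (fun v : measurableTypeR R => (idx v == k)%:R : R).
Proof.
apply: measurable_boolR; apply: (measurable_fun_bool true).
by rewrite setTI; have := measurable_idx k; congr measurable.
Qed.

Lemma idx_sumE (T : Type) (f : 'I_n.+1 -> T -> R) v z :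
  f (idx v) z = \sum_k (idx v == k)%:R * f k z.
Proof.
rewrite (bigD1 (idx v))//= eqxx mul1r big1 ?addr0// => k /negbTE.
by rewrite eq_sym => ->; rewrite mul0r.
Qed.

Lemma measurable_idx_fun (f : 'I_n.+1 -> measurableTypeR R -> R) :
  (forall k, measurable_fun setT (f k)) -> measurable_fun setT (fun v => f (idx v) v).
Proof.
move=> mf; under eq_fun do rewrite idx_sumE.
by apply: measurable_sum => k; apply: measurable_funM; [exact: measurable_idx_indic|exact: mf].
Qed.

(** [f] depends on [v] both through the index and directly. On the slice of particle [k] the direct
    argument runs through the slice, which is how the slice integral of [char_speed] arises from an
    integral over [v]. *)
Lemma idx_integral (f : 'I_n.+1 -> measurableTypeR R -> R) C :
  (forall k, measurable_fun setT (f k)) -> (forall k v, `|f k v| <= C) ->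
  \int[unit_law]_v f (idx v) v =
  \sum_(k < n.+1) \int[mu]_(w in `[k%:R / n.+1%:R, k.+1%:R / n.+1%:R]) f k w.
Proof.
move=> mf fC; transitivity (\int[unit_law]_v (\sum_k (idx v == k)%:R * f k v)).
  by apply: eq_Rintegral => v _; exact: idx_sumE.
have ms (k : 'I_n.+1) : measurable_fun setT (fun v : measurableTypeR R => (idx v == k)%:R * f k v).
  by apply: measurable_funM; [exact: measurable_idx_indic|exact: mf].
have sC (k : 'I_n.+1) v : `|(idx v == k)%:R * f k v| <= C.
  by case: (_ == _); rewrite ?mul1r// mul0r normr0 (le_trans _ (fC k v)).
rewrite Rintegral_sum; last by move=> k; exact: (@bounded_integrable _ _ _ unit_law _ C).
apply: eq_bigr => k _; rewrite unit_law_integral//.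
have ib (i : interval R) (g : measurableTypeR R -> R) : [set` i] `<=` `[0, 1]%classic ->
    measurable_fun setT g -> (forall v, `|g v| <= C) -> mu.-integrable [set` i] (EFin \o g).
  move=> i01 mg gC; have H := @bounded_itv_integrable R 0 1 g C mg gC.
  by apply: integrableS H.
have n0 : 0 < n.+1%:R :> R by rewrite ltr0n.
have sub01 v : k%:R / n.+1%:R <= v < k.+1%:R / n.+1%:R -> 0 <= v < 1.
  move=> /andP[h1 h2]; rewrite (le_trans _ h1) ?divr_ge0//= (lt_le_trans h2)//.
  by rewrite ler_pdivrMr// mul1r ler_nat ltn_ord.
rewrite Rintegral_itv_obnd_cbnd; last first.
  by apply: ib => // v /=; rewrite !in_itv/= => /andP[h1 h2]; rewrite !ltW.
rewrite -Rintegral_itv_bndo_bndc; last first.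
  apply: ib => // v /=; rewrite !in_itv/= => /sub01/andP[-> h].
  exact: ltW.
rewrite Rintegral_mkcond [RHS]Rintegral_mkcond; apply: eq_Rintegral => v _.
rewrite !patchE !mem_setE !in_itv/=.
have [v01|v01] := boolP (0 <= v < 1).
  by rewrite idx_eq//; case: ifP => _; rewrite ?mul1r ?mul0r.
by case: ifPn => // /sub01 h; rewrite h in v01.
Qed.

Lemma slice_cst k (c : R) :
  \int[mu]_(w in `[k%:R / n.+1%:R, k.+1%:R / n.+1%:R]) c = c / n.+1%:R.
Proof.
have n0 : 0 < n.+1%:R :> R by rewrite ltr0n.
rewrite Rintegral_cst//= lebesgue_measure_itv/= lte_fin ltr_pM2r ?invr_gt0//.
by rewrite ltr_nat ltnSn/= -mulrBl -natrB// subSnn mul1r.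
Qed.

Lemma idx_average (f : 'I_n.+1 -> R) :
  \int[unit_law]_v f (idx v) = (\sum_k f k) / n.+1%:R.
Proof.
have := @idx_integral (fun k _ => f k) (\sum_k `|f k|) => ->.
- by rewrite mulr_suml; apply: eq_bigr => k _; rewrite slice_cst.
- by move=> k; exact: measurable_cst.
- by move=> k v; rewrite (bigD1 k)//= lerDl sumr_ge0.
Qed.

End index.

Lemma empirical_integral dT (T : measurableType dT) n (a : 'I_n.+1 -> T) (f : T -> R) C :
  measurable_fun setT f -> (forall z, `|f z| <= C) ->
  \int[empirical (R := R) a]_z f z = (\sum_k f (a k)) / n.+1%:R.
Proof.
move=> mf fC.
have pos (g : T -> R) : measurable_fun setT g -> (forall z, 0 <= g z) ->
    \int[empirical (R := R) a]_z g z = (\sum_k g (a k)) / n.+1%:R.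
  move=> mg g0; rewrite /Rintegral.
  have mg' : measurable_fun setT (EFin \o g) by exact/measurable_EFinP.
  have := @ge0_integral_mscale _ T R (msum (fun k => \d_(a (inord k))) n.+1) setT measurableT
    (n.+1%:R^-1)%:nng (EFin \o g) mg' (fun z _ => g0 z).
  rewrite (@ge0_integral_measure_sum _ _ _ (fun k => \d_(a (inord k))) setT measurableT
    (EFin \o g) (fun z _ => g0 z) mg').
  under eq_bigr do rewrite integral_dirac// diracT mul1e.
  move=> E; rewrite [X in fine X]E /= sumEFin -EFinM /= mulrC; congr (_ * _).
  by apply: eq_bigr => k _; rewrite inord_val.
have intf : (empirical (R := R) a).-integrable setT (EFin \o f).
  exact: (@bounded_integrable _ _ _ _ _ C).
have intC : (empirical (R := R) a).-integrable setT (EFin \o (fun=> C)).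
  exact: (@bounded_integrable _ _ _ _ _ `|C|).
(* Adding the bound [C] makes the integrand nonnegative, the case settled by [pos]. *)
have E : \int[empirical (R := R) a]_z (f z + C) = \int[empirical (R := R) a]_z f z + C.
  rewrite RintegralD//; congr (_ + _); rewrite Rintegral_cst// -[RHS]mulr1.
  by congr (_ * _); exact: (congr1 fine (probability_setT (empirical (R := R) a))).
apply: (addIr C); rewrite -E pos.
- rewrite big_split/= sumr_const card_ord mulrDl; congr (_ + _).
  by rewrite -[C *+ _]mulr_natr mulfK// pnatr_eq0.
- by apply: measurable_funD.
- by move=> z; have := fC z; rewrite ler_norml; lra.
Qed.

End unit_interval_coupling.

Section coupled_weak_identity.
Context {R : realType} {d : nat}.
Variables (F : 'I_d -> 'rV[R]_d -> R) (A B : 'I_d -> R).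
Hypothesis F_cont : forall g, continuous (F g).
Hypothesis F_bd : forall g u, A g <= F g u <= B g.

Definition law_cdf (X : R -> R) (p : R) : R := \int[unit_law]_v (X v <= p)%R%:R.

Definition coupled_speed (X : 'I_d -> R -> R) g (v : R) : R :=
  F g (\row_h (if h == g then v else law_cdf (X h) (X g v))).

Definition coupled_weak_identity (phi dphi : R -> R -> R) M g (X : 'I_d -> R -> R -> R) :=
  \int[leb_itv 0 M]_t \int[unit_law]_v tail M (dphi t) (X g t v) +
    \int[unit_law]_v tail M (phi 0) (X g 0 v) =
  \int[leb_itv 0 M]_t \int[unit_law]_v
    (phi t (X g t v) * coupled_speed (X ^~ t) g v).

(** The discrete identity divided by the number of particles: sums become integrals over [v], and
    [rank] becomes the distribution function of the position under the uniform law. *)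
Lemma discrete_coupled_weak_identity n (y : R -> 'M[R]_(d, n.+1)) phi dphi M C g :
  (forall g k, continuous (fun t => y t g k)) ->
  smooth_test phi dphi M C ->
  (forall t, 0 <= t -> locally_characteristic F A B y t) ->
  coupled_weak_identity phi dphi M g (fun h t v => y t h (@idx R n v)).
Proof.
move=> y_cont st y_char; rewrite /coupled_weak_identity.
have H := discrete_weak_identity F_cont F_bd y_cont st y_char g.
have n0 : n.+1%:R != 0 :> R by rewrite pnatr_eq0.
have M0 : 0 < M by case: st.
have i1 : (leb_itv 0 M).-integrable setT (EFin \o dpotential y dphi M g).
  apply: (@bounded_integrable _ _ _ _ _ (n.+1%:R * (C * (2 * M)))).
    by apply: continuous_measurableR; exact: (dpotential_continuous y_cont st).
  by move=> t; exact: (dpotential_bound y st).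
have i2 : (leb_itv 0 M).-integrable setT (EFin \o flux F y phi g).
  apply: (@bounded_integrable _ _ _ _ _ (n.+1%:R * (C * speed_bound A B g))).
    exact: (flux_measurable F_cont F_bd y_cont st).
  by move=> t; exact: (flux_bound F_cont F_bd y st).
have E1 t : \int[unit_law]_v tail M (dphi t) (y t g (@idx R n v)) =
    n.+1%:R^-1 * dpotential y dphi M g t.
  by rewrite (idx_average (fun k => tail M (dphi t) (y t g k))) mulrC.
have E2 : \int[unit_law]_v tail M (phi 0) (y 0 g (@idx R n v)) =
    n.+1%:R^-1 * potential y phi M g 0.
  by rewrite (idx_average (fun k => tail M (phi 0) (y 0 g k))) mulrC.
have E3 t : \int[unit_law]_v (phi t (y t g (@idx R n v)) *
      coupled_speed (fun h v => y t h (@idx R n v)) g v) = n.+1%:R^-1 * flux F y phi g t.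
  have C0 : 0 <= C by have [h _] := smooth_test_bound st 0 0; apply: le_trans h.
  pose f k (w : measurableTypeR R) := phi t (y t g k) * F g (ranks (y t) g (y t g k) w).
  have cf k : continuous (fun w => F g (ranks (y t) g (y t g k) w)).
    exact: F_replace_continuous.
  transitivity (\int[unit_law]_v f (@idx R n v) v).
    apply: eq_Rintegral => v _; rewrite /f /coupled_speed; congr (_ * F g _).
    apply/rowP => h; rewrite !mxE; case: ifP => // _.
    rewrite /law_cdf (idx_average (fun k => (y t h k <= y t g (idx n v))%R%:R)).
    by rewrite rank_sum.
  rewrite (@idx_integral R n f (C * speed_bound A B g)).
  - rewrite /flux mulr_sumr; apply: eq_bigr => k _.
    rewrite /f RintegralZl//; last by apply: continuous_itv_integrable; exact: cf.
    by rewrite [RHS]mulrCA /char_speed mulKf.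
  - by move=> k; apply: measurable_funM => //; apply: continuous_measurableR; exact: cf.
  - move=> k v; rewrite /f normrM ler_pM//; first by case: (smooth_test_bound st t (y t g k)).
    exact: (F_norm F_bd).
under eq_Rintegral do rewrite E1.
under [RHS]eq_Rintegral do rewrite E3.
by rewrite E2 !RintegralZl// -mulrDr H.
Qed.

End coupled_weak_identity.

(** * Passage to the limit in the weak identity *)

Section limit_tools.
Context {R : realType}.
Notation mR := (measurableTypeR R).

Lemma norm_boolR (b : bool) : `|b%:R : R| <= 1.
Proof. by case: b; rewrite ?normr1// normr0. Qed.

Lemma ae_of_Rintegral0 dT (T : measurableType dT) (m : {finite_measure set T -> \bar R})
    (f : T -> R) C : measurable_fun setT f -> (forall z, 0 <= f z) ->
  (forall z, `|f z| <= C) -> \int[m]_z f z = 0 -> {ae m, forall z, f z = 0}.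
Proof.
move=> mf f0 fC If.
have intf : m.-integrable setT (EFin \o f) by exact: (@bounded_integrable _ _ _ _ _ C).
have mfE : measurable_fun setT (EFin \o f) by exact/measurable_EFinP.
have [H _] := ae_eq_integral_abs m measurableT mfE.
have : (\int[m]_z `|(EFin \o f) z| = 0)%E.
  under eq_integral do rewrite gee0_abs ?lee_fin//.
  have fin := integrable_fin_num measurableT intf.
  by rewrite -(fineK fin) -[fine _]/(\int[m]_z f z) If.
by move=> /H; apply: filterS => z /(_ I) [].
Qed.

Lemma ae_Rintegral0 dT (T : measurableType dT) (m : {finite_measure set T -> \bar R})
    (f : T -> R) : measurable_fun setT f -> {ae m, forall z, f z = 0} -> \int[m]_z f z = 0.
Proof.
move=> mf f0; rewrite (@ae_eq_Rintegral _ _ _ m f (fun=> 0))//.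
by rewrite Rintegral_cst// mul0r.
Qed.

Lemma measurable_Rintegral_section d1 d2 (T1 : measurableType d1) (T2 : measurableType d2)
    (m2 : {finite_measure set T2 -> \bar R}) (f : T1 * T2 -> R) M :
  measurable_fun setT f -> (forall z, `|f z| <= M) ->
  measurable_fun setT (fun x => \int[m2]_y f (x, y)).
Proof. exact: (@measurable_Rintegral _ _ _ _ _ (\d_(point : T1)) m2). Qed.

Lemma measurable_continuous2 dT (T : measurableType dT) (f : R -> R -> R) (u v : T -> R) :
  continuous (fun z : R * R => f z.1 z.2) -> measurable_fun setT u ->
  measurable_fun setT v -> measurable_fun setT (fun z => f (u z) (v z)).
Proof.
move=> cf mu mv.
pose w (h : 'I_2) := if h == ord0 then u else v.
pose f' (r : 'rV[R]_2) := f (r 0 ord0) (r 0 (lift ord0 ord0)).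
have := @measurable_continuous_row R _ T 2 w f'.
rewrite (_ : (fun z => f' _) = fun z => f (u z) (v z)); last first.
  by apply/funext => z; rewrite /f' !mxE.
apply; first by move=> h; rewrite /w; case: ifP.
move=> r; apply: (@continuous_comp _ _ _
  (fun r : 'rV[R]_2 => (r 0 ord0, r 0 (lift ord0 ord0))) (fun z => f z.1 z.2)).
  by apply: pair_continuous; exact: coord_continuous.
exact: cf.
Qed.

Lemma cvg_row n (u : nat -> 'I_n -> R) (l : 'I_n -> R) :
  (forall h, u m h @[m --> \oo] --> l h) ->
  ((\row_h u m h) : 'rV[R]_n) @[m --> \oo] --> ((\row_h l h) : 'rV[R]_n).
Proof.
move=> ul A [P fP PA]; rewrite /fmap /=.
have : \forall m \near \oo, forall ij : 'I_1 * 'I_n,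
    P ij.1 ij.2 ((\row_h u m h : 'rV[R]_n) ij.1 ij.2).
  apply: filter_forall => -[i j] /=; have := fP i j; rewrite mxE => /ul H.
  by apply: (@filterS _ \oo _ _ _ _ H) => m; rewrite mxE.
by apply: filterS => m Pm; apply: PA => i' j; exact: (Pm (i', j)).
Qed.

Lemma cvg_leR (u v : nat -> R) (a b : R) : u @ \oo --> a -> v @ \oo --> b -> a != b ->
  ((u n <= v n)%R%:R : R) @[n --> \oo] --> ((a <= b)%R%:R : R).
Proof.
move=> ua vb ab; apply: cvg_near_cst.
have uv : (u n - v n) @[n --> \oo] --> a - b by exact: cvgB.
have [lt|gt|E] := ltgtP a b.
- have : a - b < 0 by rewrite subr_lt0.
  move=> /(cvgr_lt _ uv); apply: filterS => n; rewrite subr_lt0 => h.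
  by rewrite (ltW h).
- have : 0 < a - b by rewrite subr_gt0.
  move=> /(cvgr_gt _ uv); apply: filterS => n; rewrite subr_gt0 => h.
  by rewrite leNgt h.
- by rewrite E eqxx in ab.
Qed.

Lemma leb_itv_neq (a b c : R) : {ae leb_itv a b, forall t, t != c}.
Proof.
exists [set c]; split => //.
- rewrite [LHS]leb_itvE; apply/eqP; rewrite eq_le measure_ge0 andbT.
  rewrite -(lebesgue_measure_set1 c); apply: le_measure; rewrite ?inE//.
  by apply: measurableI => //; exact: measurable_itv.
- by move=> t /= /negP; rewrite negbK => /eqP.
Qed.

Lemma tail_continuous M (f : R -> R) C : 0 < M -> continuous f -> (forall z, `|f z| <= C) ->
  (forall z, M <= `|z| -> f z = 0) -> continuous (tail M f).
Proof.
move=> M0 cf fC supp; apply: (@lipschitz_continuous _ _ C) => p q.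
have := @tail_close R M f p q 0 C C cf fC supp.
by rewrite mul0r addr0; apply => z _; rewrite subr0.
Qed.

End limit_tools.

Section limit.
Context {R : realType} {d : nat}.
Notation mR := (measurableTypeR R).
Variables (F : 'I_d -> 'rV[R]_d -> R) (A B : 'I_d -> R).
Hypothesis F_cont : forall g, continuous (F g).
Hypothesis F_bd : forall g u, A g <= F g u <= B g.
Variables (phi dphi : R -> R -> R) (M C : R).
Hypothesis st : smooth_test phi dphi M C.

Let M0 : 0 < M. Proof. by case: st. Qed.
Let C0 : 0 <= C.
Proof. by have [h _] := smooth_test_bound st 0 0; apply: le_trans h. Qed.
Let cphi t : continuous (phi t).
Proof. apply: curry_continuous2; exact: smooth_test_cont st. Qed.
Let cdphi t : continuous (dphi t).
Proof. apply: curry_continuous2; exact: smooth_test_dcont st. Qed.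
Let phiC t x : `|phi t x| <= C. Proof. by case: (smooth_test_bound st t x). Qed.
Let dphiC t x : `|dphi t x| <= C. Proof. by case: (smooth_test_bound st t x). Qed.
Let phi_supp t x : M <= `|x| -> phi t x = 0.
Proof. by move=> h; have [] := smooth_test_supp st (t := t) (or_intror h). Qed.
Let dphi_supp t x : M <= `|x| -> dphi t x = 0.
Proof. by move=> h; have [] := smooth_test_supp st (t := t) (or_intror h). Qed.

Section measurable_path.
Variable X : 'I_d -> R -> R -> R.
Hypothesis mX : forall g, measurable_fun setT (fun z : mR * mR => X g z.1 z.2).

Lemma measurable_path_comp dT (T : measurableType dT) g (u v : T -> mR) :
  measurable_fun setT u -> measurable_fun setT v ->
  measurable_fun setT (fun z => X g (u z) (v z)).
Proof.
move=> mu mv.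
exact: (measurableT_comp (mX g) (measurable_fun_pair mu mv)).
Qed.

Lemma measurable_law_cdf dT (T : measurableType dT) h (u p : T -> mR) :
  measurable_fun setT u -> measurable_fun setT p ->
  measurable_fun setT (fun z => law_cdf (X h (u z)) (p z)).
Proof.
move=> mu mp.
apply: (@measurable_Rintegral_section _ _ _ T mR unit_law
  (fun z => (X h (u z.1) z.2 <= p z.1)%R%:R) 1).
  apply: measurable_leR; last exact: (measurableT_comp mp measurable_fst).
  apply: measurable_path_comp; last exact: measurable_snd.
  exact: (measurableT_comp mu measurable_fst).
by move=> z; exact: norm_boolR.
Qed.

Lemma measurable_coupled_speed g :
  measurable_fun setT (fun z : mR * mR => coupled_speed F (X ^~ z.1) g z.2).
Proof.
apply: (measurable_continuous_row (u := fun h z =>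
  if h == g then z.2 else law_cdf (X h z.1) (X g z.1 z.2))) => // h.
case: (h == g); first exact: measurable_snd.
by apply: measurable_law_cdf; [exact: measurable_fst|exact: mX].
Qed.

Lemma coupled_speed_bound (Y : 'I_d -> R -> R) g v :
  `|coupled_speed F Y g v| <= speed_bound A B g.
Proof. exact: F_norm. Qed.

Definition flux_density g (z : mR * mR) : R :=
  phi z.1 (X g z.1 z.2) * coupled_speed F (X ^~ z.1) g z.2.

Lemma measurable_flux_density g : measurable_fun setT (flux_density g).
Proof.
apply: measurable_funM; last exact: measurable_coupled_speed.
apply: measurable_continuous2; [exact: smooth_test_cont st|exact: measurable_fst|exact: mX].
Qed.

Lemma flux_density_bound g z : `|flux_density g z| <= C * speed_bound A B g.
Proof. by rewrite normrM ler_pM//; exact: coupled_speed_bound. Qed.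

Lemma measurable_dtail g :
  measurable_fun setT (fun z : mR * mR => tail M (dphi z.1) (X g z.1 z.2)).
Proof.
apply: (@measurable_Rintegral_section _ _ _ _ mR (leb_itv (- M) M)
  (fun z => dphi z.1.1 z.2 * (X g z.1.1 z.1.2 <= z.2)%R%:R) C).
  apply: measurable_funM.
    apply: measurable_continuous2; [exact: smooth_test_dcont st| |exact: measurable_snd].
    exact: (measurableT_comp measurable_fst measurable_fst).
  apply: measurable_leR; last exact: measurable_snd.
  exact: (measurableT_comp (mX g) measurable_fst).
by move=> z; exact: indic_le_bound.
Qed.

End measurable_path.

Variables (Xn : nat -> 'I_d -> R -> R -> R) (X : 'I_d -> R -> R -> R) (G : set R) (L : R).
Hypothesis mXn : forall n g, measurable_fun setT (fun z : mR * mR => Xn n g z.1 z.2).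
Hypothesis mX : forall g, measurable_fun setT (fun z : mR * mR => X g z.1 z.2).
Hypothesis aeG : {ae @unit_law R, forall v, G v}.
Hypothesis conv : forall v, G v -> forall t, 0 <= t -> forall g,
  Xn n g t v @[n --> \oo] --> X g t v.
Hypothesis L0 : 0 < L.
Hypothesis sep : forall (g h : 'I_d) v w a b, (g < h)%N -> G v -> G w -> 0 <= a -> a <= b ->
  X g a v - X h a w + L * (b - a) <= X g b v - X h b w.

Lemma meet_once (g h : 'I_d) v w a b : h != g -> G v -> G w -> 0 <= a -> 0 <= b ->
  X h a w = X g a v -> X h b w = X g b v -> a = b.
Proof.
move=> hg Gv Gw.
have key (g' h' : 'I_d) v' w' a' b' : (g' < h')%N -> G v' -> G w' -> 0 <= a' -> a' < b' ->
    X g' a' v' = X h' a' w' -> X g' b' v' = X h' b' w' -> False.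
  move=> gh Gv' Gw' a0 ab Ea Eb; have := sep gh Gv' Gw' a0 (ltW ab).
  rewrite Ea Eb !subrr add0r leNgt => /negP; apply.
  by rewrite mulr_gt0// subr_gt0.
have [gh|hg'|E] := ltngtP g h; last by rewrite (val_inj E) eqxx in hg.
- move=> a0 b0 Ea Eb; have [ab|ba|//] := ltgtP a b; exfalso.
    exact: (key g h v w a b).
  exact: (key g h v w b a).
- move=> a0 b0 Ea Eb; have [ab|ba|//] := ltgtP a b; exfalso.
    exact: (key h g w v a b).
  exact: (key h g w v b a).
Qed.

(** Fubini in [(t, w)] with [v] fixed: each [w] meets [v] at one time at most, so almost every [t]
    sees only a null set of such [w]. *)
Lemma no_common_atom (g h : 'I_d) v : h != g -> G v ->
  {ae leb_itv 0 M, forall t, {ae @unit_law R, forall w, X h t w != X g t v}}.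
Proof.
move=> hg Gv.
pose f (z : mR * mR) : R := (X h z.1 z.2 == X g z.1 v)%R%:R.
have mf : measurable_fun setT f.
  apply: measurable_boolR; apply: measurable_fun_eqr; first exact: mX.
  by apply: measurable_path_comp => //; exact: measurable_fst.
have f1 z : `|f z| <= 1 by exact: norm_boolR.
have I0 : \int[leb_itv 0 M]_t \int[unit_law]_w f (t, w) = 0.
  rewrite (@Rintegral_swap _ _ _ _ _ (leb_itv 0 M) unit_law f 1 mf f1).
  apply: ae_Rintegral0.
    apply: (@measurable_Rintegral_section _ _ _ mR mR (leb_itv 0 M) (fun z => f (z.2, z.1)) 1) => //.
    exact: (measurableT_comp mf (measurable_fun_pair measurable_snd measurable_fst)).
  apply: filterS aeG => w Gw.
  apply: ae_Rintegral0; first exact: (measurableT_comp mf (pair2_measurable _)).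
  have [[c [c0 Ec]]|nc] := pselect (exists c, 0 <= c /\ X h c w = X g c v).
    have H1 := leb_itv_neq 0 M c.
    have H2 : {ae leb_itv 0 M, forall t, 0 <= t <= M} by exact: leb_itv_ae.
    apply: filterS2 H1 H2 => t tc /andP[t0 tM]; rewrite /f/=.
    case: eqP => // Et; move/eqP : tc; case.
    exact: (meet_once hg Gv Gw).
  apply: (leb_itv_ae (a := 0) (b := M)) => t /andP[t0 tM]; rewrite /f/=.
  by case: eqP => // Et; exfalso; apply: nc; exists t.
have mI : measurable_fun setT (fun t : mR => \int[unit_law]_w f (t, w)).
  exact: (measurable_Rintegral_section unit_law mf f1).
have mft t : measurable_fun setT (fun w : mR => f (t, w)).
  exact: (measurableT_comp mf (pair1_measurable _)).
have f0 z : 0 <= f z by rewrite /f; case: (_ == _).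
have := @ae_of_Rintegral0 _ _ _ (leb_itv 0 M) (fun t => \int[unit_law]_w f (t, w)) 1 mI.
move=> /(_ _ _ I0) H; apply: (filterS _ (H _ _)).
- move=> t Et; have := ae_of_Rintegral0 (mft t) (fun w => f0 (t, w)) (fun w => f1 (t, w)) Et.
  apply: filterS => w; rewrite /f/=; case: (X h t w == X g t v) => //.
  by move=> /eqP; rewrite oner_eq0.
- by move=> t; apply: Rintegral_ge0.
- move=> t; have := bounded_Rintegral_le (@unit_law R) (mft t) (fun w => f1 (t, w)).
  move/le_trans; apply; rewrite mul1r.
  by rewrite (congr1 fine (probability_setT (@unit_law R))).
Qed.

(** The rank of [v] within another type is an integral over [w] of indicators, each of them
    eventually constant unless [w] sits exactly at the limit position of [v]; such [w] are
    negligible by assumption. *)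
Lemma flux_density_cvg g v t : G v -> 0 <= t ->
  (forall h, h != g -> {ae @unit_law R, forall w, X h t w != X g t v}) ->
  flux_density (Xn n) g (t, v) @[n --> \oo] --> flux_density X g (t, v).
Proof.
move=> Gv t0 atom.
have Hp : phi t (Xn n g t v) @[n --> \oo] --> phi t (X g t v).
  apply: (@cvg_comp _ _ _ (fun n => Xn n g t v) (phi t) \oo (nbhs (X g t v))).
    exact: conv.
  exact: cphi.
suff Hs : coupled_speed F (Xn n ^~ t) g v @[n --> \oo] --> coupled_speed F (X ^~ t) g v.
  exact: (cvgM Hp Hs).
suff H : ((\row_h (if h == g then v else law_cdf (Xn n h t) (Xn n g t v))) : 'rV[R]_d)
    @[n --> \oo] --> ((\row_h (if h == g then v else law_cdf (X h t) (X g t v))) : 'rV[R]_d).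
  exact: (cvg_comp _ _ H (@F_cont g _)).
apply: (@cvg_row _ _ (fun n h => if h == g then v else law_cdf (Xn n h t) (Xn n g t v))
  (fun h => if h == g then v else law_cdf (X h t) (X g t v))) => h.
have [_|hg] := eqVneq h g; first exact: cvg_cst.
apply: (@bounded_cvg _ _ _ _ _ _ 1).
- move=> n; apply: measurable_leR => //.
  by apply: (measurable_path_comp (mXn n)) => //; exact: measurable_id.
- apply: measurable_leR => //.
  by apply: (measurable_path_comp mX) => //; exact: measurable_id.
- by move=> n w; exact: norm_boolR.
- apply: filterS2 aeG (atom h hg) => w Gw ne.
  by apply: cvg_leR => //; exact: conv.
Qed.

Lemma coupled_weak_identity_limit g :
  (forall n, coupled_weak_identity F phi dphi M g (Xn n)) ->
  coupled_weak_identity F phi dphi M g X.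
Proof.
move=> weak.
have aet : {ae leb_itv 0 M, forall t, 0 <= t} by apply: leb_itv_ae => t /andP[].
have mtail Y t : (forall g, measurable_fun setT (fun z : mR * mR => Y g z.1 z.2)) ->
    forall f, continuous f -> (forall z, `|f z| <= C) -> (forall z, M <= `|z| -> f z = 0) ->
    measurable_fun setT (fun v : mR => tail M f (Y g t v)).
  move=> mY f cf fC supp.
  have mY' : measurable_fun setT (fun v : mR => Y g t v : mR).
    by apply: (measurable_path_comp mY) => //; exact: measurable_id.
  apply: (@measurableT_comp _ _ _ _ _ _ (tail M f) _ (fun v => Y g t v)) => //.
  by apply: continuous_measurableR; exact: (tail_continuous M0 cf fC supp).
have cvg_tail t f : 0 <= t -> continuous f -> (forall z, `|f z| <= C) ->
    (forall z, M <= `|z| -> f z = 0) ->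
    \int[unit_law]_v tail M f (Xn n g t v) @[n --> \oo] --> \int[unit_law]_v tail M f (X g t v).
  move=> t0 cf fC supp; apply: (@bounded_cvg _ _ _ _ _ _ (C * (2 * M))).
  - by move=> n; exact: mtail.
  - exact: mtail.
  - by move=> n v; exact: tail_bound.
  - apply: filterS aeG => v Gv.
    apply: (@cvg_comp _ _ _ (fun n => Xn n g t v) (tail M f) \oo (nbhs (X g t v))).
      exact: conv.
    exact: (tail_continuous M0 cf fC supp).
have H1 : \int[leb_itv 0 M]_t \int[unit_law]_v tail M (dphi t) (Xn n g t v) @[n --> \oo] -->
    \int[leb_itv 0 M]_t \int[unit_law]_v tail M (dphi t) (X g t v).
  apply: (@bounded_cvg _ _ _ _ _ _ (C * (2 * M))).
  - move=> n; apply: (measurable_Rintegral_section unit_law (measurable_dtail (mXn n) g)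
      (M := C * (2 * M))).
    by move=> z; exact: tail_bound.
  - apply: (measurable_Rintegral_section unit_law (measurable_dtail mX g) (M := C * (2 * M))).
    by move=> z; exact: tail_bound.
  - move=> n t.
    have := @bounded_Rintegral_le _ _ _ (@unit_law R) (fun v => tail M (dphi t) (Xn n g t v))
      (C * (2 * M)).
    rewrite (congr1 fine (probability_setT (@unit_law R))) mulr1; apply.
      by apply: (mtail (Xn n)) => // z; exact: dphi_supp.
    by move=> v; exact: tail_bound.
  - by apply: filterS aet => t t0; apply: cvg_tail => // z; exact: dphi_supp.
have H2 : \int[unit_law]_v tail M (phi 0) (Xn n g 0 v) @[n --> \oo] -->
    \int[unit_law]_v tail M (phi 0) (X g 0 v).
  by apply: cvg_tail => // z; exact: phi_supp.
(* For fixed [v] the bad times form a null set that depends on [v]. Exchanging the integrals permits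
   dominated convergence first in [t], then in [v]. *)
have swapE Y : (forall g, measurable_fun setT (fun z : mR * mR => Y g z.1 z.2)) ->
    \int[leb_itv 0 M]_t \int[unit_law]_v (phi t (Y g t v) * coupled_speed F (Y ^~ t) g v) =
    \int[unit_law]_v \int[leb_itv 0 M]_t flux_density Y g (t, v).
  move=> mY; rewrite -(@Rintegral_swap _ _ _ _ _ (leb_itv 0 M) unit_law (flux_density Y g)
    (C * speed_bound A B g))//; first exact: measurable_flux_density.
  by move=> z; exact: flux_density_bound.
have mfl Y v : (forall g, measurable_fun setT (fun z : mR * mR => Y g z.1 z.2)) ->
    measurable_fun setT (fun t : mR => flux_density Y g (t, v)).
  by move=> mY; exact: (measurableT_comp (measurable_flux_density mY g) (pair2_measurable _)).
have H3 : \int[unit_law]_v \int[leb_itv 0 M]_t flux_density (Xn n) g (t, v) @[n --> \oo] -->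
    \int[unit_law]_v \int[leb_itv 0 M]_t flux_density X g (t, v).
  have mswap Y : (forall g, measurable_fun setT (fun z : mR * mR => Y g z.1 z.2)) ->
      measurable_fun setT (fun v : mR => \int[leb_itv 0 M]_t flux_density Y g (t, v)).
    move=> mY; apply: (@measurable_Rintegral_section _ _ _ mR mR (leb_itv 0 M)
      (fun z => flux_density Y g (z.2, z.1)) (C * speed_bound A B g)).
      exact: (measurableT_comp (measurable_flux_density mY g)
        (measurable_fun_pair measurable_snd measurable_fst)).
    by move=> z; exact: flux_density_bound.
  apply: (@bounded_cvg _ _ _ _ _ _ (C * speed_bound A B g * fine (leb_itv 0 M setT))).
  - by move=> n; exact: mswap.
  - exact: mswap.
  - move=> n v; apply: bounded_Rintegral_le; first exact: mfl.
    by move=> t; exact: flux_density_bound.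
  - apply: filterS aeG => v Gv.
    apply: (@bounded_cvg _ _ _ _ _ _ (C * speed_bound A B g)).
    + by move=> n; exact: mfl.
    + exact: mfl.
    + by move=> n t; exact: flux_density_bound.
    + have H : {ae leb_itv 0 M, forall t, forall h, h != g ->
          {ae @unit_law R, forall w, X h t w != X g t v}}.
        apply: (@filter_forall _ 'I_d (fun h t => h != g ->
          {ae @unit_law R, forall w, X h t w != X g t v})) => h.
        have [->|hg] := eqVneq h g; first by apply: nearW.
        by apply: filterS (no_common_atom hg Gv) => t Ht _.
      by apply: filterS2 aet H => t t0 Ht; exact: flux_density_cvg.
have H4 : (\int[leb_itv 0 M]_t \int[unit_law]_v tail M (dphi t) (Xn n g t v) +
    \int[unit_law]_v tail M (phi 0) (Xn n g 0 v)) @[n --> \oo] -->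
    \int[leb_itv 0 M]_t \int[unit_law]_v tail M (dphi t) (X g t v) +
    \int[unit_law]_v tail M (phi 0) (X g 0 v).
  exact: (cvgD H1 H2).
rewrite /coupled_weak_identity (swapE X mX).
have E n := etrans (weak n) (swapE (Xn n) (mXn n)).
move: H4; rewrite (funext E) => H4.
exact: (cvg_unique _ H4 H3).
Qed.

End limit.

(** * Averaging over the atoms *)

Section affine_substitution.
Context {R : realType}.
Notation mu := (@lebesgue_measure R).

Lemma affine_substitution (g : R -> R) (p q : R) : continuous g -> p < q ->
  \int[mu]_(w in `[p, q]) g w = (q - p) * \int[mu]_(a in `[0, 1]) g ((1 - a) * p + a * q).
Proof.
move=> cg pq; pose f (a : R) := p + a * (q - p).
have df (a : R) : is_derive a (1 : R) f (q - p).
  rewrite /f; apply: is_derive_eq.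
  by rewrite scaler0 !add0r mul1r /GRing.scale/= mulr1.
have f' : derive1 f = cst (q - p).
  by apply/funext => a; rewrite derive1E; have [_ ->] := df a.
have cf : continuous f.
  move=> a; apply: cvgD; first exact: cvg_cst.
  by apply: cvgM; [exact: cvg_id|exact: cvg_cst].
have cgf : continuous (fun a : R => g ((1 - a) * p + a * q)).
  have -> : (fun a : R => g ((1 - a) * p + a * q)) = g \o f.
    by apply/funext => a /=; congr g; rewrite /f; ring.
  by move=> a; apply: continuous_comp; [exact: cf|exact: cg].
rewrite -RintegralZl//; last exact: continuous_itv_integrable.
have := @integration_by_substitution_increasing R f g 0 1 ler01.
have f0 : f 0 = p by rewrite /f mul0r addr0.
have f1 : f 1 = q by rewrite /f mul1r addrC subrK.
rewrite f0 f1 /Rintegral => -> //.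
- congr fine; apply: eq_integral => a _; congr EFin.
  rewrite f' /= mulrC; congr (_ * g _).
  by rewrite /f; ring.
- move=> a b _ _ ab; rewrite /f ltrD2l ltr_pM2r ?subr_gt0//.
- by rewrite f' => a _; exact: cvg_cst.
- by rewrite f'; exact: is_cvg_cst.
- by rewrite f'; exact: is_cvg_cst.
- split.
  + by move=> a _; have [] := df a.
  + by apply: cvg_at_right_filter; exact: cf.
  + by apply: cvg_at_left_filter; exact: cf.
- by apply: continuous_subspaceT.
Qed.

End affine_substitution.

Section atoms.
Context {R : realType}.
Notation mR := (measurableTypeR R).
Notation mu := (@lebesgue_measure R).

Lemma norm_boolM (b : bool) (x C : R) : `|x| <= C -> `|b%:R * x| <= C.
Proof. by case: b => xC; rewrite ?mul1r// mul0r normr0 (le_trans _ xC). Qed.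

Lemma le_Rintegral_ae (b1 b2 : mR -> bool) : measurable_fun setT b1 -> measurable_fun setT b2 ->
  {ae @unit_law R, forall w, b1 w ==> b2 w} ->
  \int[unit_law]_w ((b1 w)%:R : R) <= \int[unit_law]_w ((b2 w)%:R : R).
Proof.
move=> m1 m2 H.
have i (b : mR -> bool) : measurable_fun setT b ->
    (@unit_law R).-integrable setT (EFin \o (fun w => (b w)%:R : R)).
  move=> mb; apply: (@bounded_integrable _ _ _ _ _ 1); first exact: measurable_boolR.
  by move=> w; exact: norm_boolR.
have m12 : measurable_fun setT (fun w => b1 w && b2 w) by exact: measurable_and.
rewrite (@ae_eq_Rintegral _ _ _ unit_law _ (fun w => (b1 w && b2 w)%:R : R)).
- apply: le_Rintegral => //; [exact: i|exact: i|].
  by move=> w _; case: (b1 w) (b2 w) => -[].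
- exact: measurable_boolR.
- exact: measurable_boolR.
- by apply: filterS H => w; case: (b1 w) (b2 w) => -[].
Qed.

Lemma unit_law_neq (c : R) : {ae @unit_law R, forall t, t != c}.
Proof.
exists [set c]; split => //.
- rewrite [LHS]unit_lawE; apply/eqP; rewrite eq_le measure_ge0 andbT.
  rewrite -(lebesgue_measure_set1 c); apply: le_measure; rewrite ?inE//.
  by apply: measurableI => //; exact: measurable_itv.
- by move=> t /= /negP; rewrite negbK => /eqP.
Qed.

Lemma unit_law_itv (p q : R) (g : mR -> R) C : 0 <= p -> q <= 1 ->
  measurable_fun setT g -> (forall w, `|g w| <= C) ->
  \int[unit_law]_w ((p <= w <= q)%R%:R * g w) = \int[mu]_(w in `[p, q]) g w.
Proof.
move=> p0 q1 mg gC.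
have mb : measurable_fun setT (fun w : mR => (p <= w <= q)%R%:R : R).
  by apply: measurable_boolR; apply: measurable_and; apply: measurable_fun_ler.
have ms : measurable_fun setT (fun w : mR => (p <= w <= q)%R%:R * g w).
  exact: measurable_funM.
have sC w : `|(p <= w <= q)%R%:R * g w| <= C.
  exact: norm_boolM.
have i := @bounded_itv_integrable R 0 1 _ C ms sC.
rewrite unit_law_integral// Rintegral_itv_obnd_cbnd; last first.
  by apply: integrableS i => // w /=; rewrite !in_itv/= => /andP[h1 h2]; rewrite !ltW.
rewrite Rintegral_itv_bndo_bndc; last first.
  by apply: integrableS i => // w /=; rewrite !in_itv/= => /andP[-> /ltW].
rewrite Rintegral_mkcond [RHS]Rintegral_mkcond; apply: eq_Rintegral => w _.
rewrite !patchE !mem_setE !in_itv/=.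
case: ifPn => w01; case: ifPn => pwq; rewrite ?mul1r ?mul0r//.
by case/andP: pwq w01 => h1 h2; rewrite (le_trans p0 h1) (le_trans h2 q1).
Qed.

Lemma unit_law_le (w : R) : 0 < w < 1 -> \int[unit_law]_v ((v <= w)%R%:R : R) = w.
Proof.
move=> /andP[w0 w1].
transitivity (\int[unit_law]_v ((0 <= v <= w)%R%:R * 1 : R)).
  apply: ae_eq_Rintegral.
  - exact: measurable_leR.
  - apply: measurable_funM => //; apply: measurable_boolR; apply: measurable_and;
      exact: measurable_fun_ler.
  - by apply: unit_law_ae => v /andP[v0 _]; rewrite (ltW v0) mulr1.
rewrite (@unit_law_itv 0 w (fun=> 1) 1)//; [|exact: ltW|by move=> _; rewrite normr1].
by rewrite Rintegral_cst//= lebesgue_measure_itv/= lte_fin w0 sube0 mul1r.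
Qed.

Variables (X : mR -> R) (G : set R).
Hypothesis mX : measurable_fun setT X.
Hypothesis aeG : {ae @unit_law R, forall v, G v}.
Hypothesis G01 : forall v, G v -> 0 < v < 1.
Hypothesis X_nd : forall v w, G v -> G w -> v <= w -> X v <= X w.

Definition left_law_cdf (y : R) : R := \int[unit_law]_w (X w < y)%R%:R.

Let p v := left_law_cdf (X v).
Let q v := law_cdf X (X v).

Let mle y : measurable_fun setT (fun w => X w <= y).
Proof. exact: measurable_fun_ler. Qed.
Let mlt y : measurable_fun setT (fun w => X w < y).
Proof. exact: measurable_fun_ltr. Qed.

Lemma unit_Rintegral01 (b : mR -> bool) : measurable_fun setT b ->
  0 <= \int[unit_law]_w ((b w)%:R : R) <= 1.
Proof.
move=> mb; rewrite Rintegral_ge0//=.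
have := @bounded_Rintegral_le _ _ _ (@unit_law R) _ 1 (measurable_boolR (R := R) mb)
  (fun w => @norm_boolR R (b w)).
rewrite (congr1 fine (probability_setT (@unit_law R))) mulr1.
by apply: le_trans; exact: ler_norm.
Qed.

Lemma law_cdf01 y : 0 <= law_cdf X y <= 1.
Proof. exact: unit_Rintegral01. Qed.

Lemma left_law_cdf01 y : 0 <= left_law_cdf y <= 1.
Proof. exact: unit_Rintegral01. Qed.

Lemma left_law_cdf_le y w : G w -> y <= X w -> left_law_cdf y <= w.
Proof.
move=> Gw yw; rewrite -[leRHS](unit_law_le (G01 Gw)).
apply: le_Rintegral_ae => //; first exact: measurable_fun_ler.
apply: filterS aeG => v Gv; apply/implyP => Xv.
rewrite leNgt; apply/negP => wv.
by have := X_nd Gw Gv (ltW wv); rewrite leNgt (lt_le_trans Xv yw).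
Qed.

Lemma law_cdf_ge y w : G w -> X w <= y -> w <= law_cdf X y.
Proof.
move=> Gw wy; rewrite -[leLHS](unit_law_le (G01 Gw)).
apply: le_Rintegral_ae => //; first exact: measurable_fun_ler.
apply: filterS aeG => v Gv; apply/implyP => vw.
by apply: le_trans wy; exact: X_nd.
Qed.

Lemma left_law_cdf_ge y w : G w -> X w < y -> w <= left_law_cdf y.
Proof.
move=> Gw wy; rewrite -[leLHS](unit_law_le (G01 Gw)).
apply: le_Rintegral_ae => //; first exact: measurable_fun_ler.
apply: filterS aeG => v Gv; apply/implyP => vw.
by apply: le_lt_trans wy; exact: X_nd.
Qed.

Lemma law_cdf_le y w : G w -> y < X w -> law_cdf X y <= w.
Proof.
move=> Gw yw; rewrite -[leRHS](unit_law_le (G01 Gw)).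
apply: le_Rintegral_ae => //; first exact: measurable_fun_ler.
apply: filterS aeG => v Gv; apply/implyP => Xv.
rewrite leNgt; apply/negP => wv.
by have := X_nd Gw Gv (ltW wv); rewrite leNgt (le_lt_trans Xv yw).
Qed.

(** By monotonicity the level set of [X] through [v] is an interval, whose end points are the left
    and right distribution functions at [X v]. Whether these two points belong to it is undecided,
    so they are discarded as null. *)
Lemma level_set v : G v ->
  {ae @unit_law R, forall w, (X w == X v) = (p v <= w <= q v)}.
Proof.
move=> Gv.
have Hp := unit_law_neq (p v); have Hq := unit_law_neq (q v).
have Hpq : {ae @unit_law R, forall w, w != p v /\ w != q v}.
  by apply: filterS2 Hp Hq.
apply: filterS2 aeG Hpq => w Gw [wp wq]; apply/eqP/idP => [E|/andP[h1 h2]].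
  by rewrite /p /q -E left_law_cdf_le//= law_cdf_ge.
apply/eqP; rewrite eq_le; apply/andP; split; rewrite leNgt; apply/negP => lt.
  have h := law_cdf_le Gw lt; move/eqP : wq; apply.
  by apply/eqP; rewrite eq_le h2.
have h := left_law_cdf_ge Gw lt; move/eqP : wp; apply.
by apply/eqP; rewrite eq_le h1 andbT.
Qed.

Lemma level_set_mass y : \int[unit_law]_w ((X w == y)%:R : R) = law_cdf X y - left_law_cdf y.
Proof.
have i (b : mR -> bool) : measurable_fun setT b ->
    (@unit_law R).-integrable setT (EFin \o (fun w => (b w)%:R : R)).
  move=> mb; apply: (@bounded_integrable _ _ _ _ _ 1); first exact: measurable_boolR.
  by move=> w; exact: norm_boolR.
rewrite /law_cdf /left_law_cdf -RintegralB//; [|exact: i|exact: i].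
apply: eq_Rintegral => w _; case: (ltgtP (X w) y) => _; rewrite ?subrr//.
by rewrite subr0.
Qed.

Variables (f : R -> R -> R) (C : R).
Hypothesis mf : measurable_fun setT (fun z : mR * mR => f z.1 z.2).
Hypothesis cf : forall y, continuous (f y).
Hypothesis fC : forall y w, `|f y w| <= C.

Let mean v := \int[mu]_(a in `[0, 1]) f (X v) ((1 - a) * p v + a * q v).

Let C0 : 0 <= C. Proof. exact: le_trans (fC 0 0). Qed.

Let mp : measurable_fun setT p.
Proof.
apply: (@measurable_Rintegral_section _ _ _ mR mR unit_law (fun z => (X z.2 < X z.1)%R%:R) 1).
  apply: measurable_boolR; apply: measurable_fun_ltr.
    exact: (measurableT_comp mX measurable_snd).
  exact: (measurableT_comp mX measurable_fst).
by move=> z; exact: norm_boolR.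
Qed.

Let mq : measurable_fun setT q.
Proof.
apply: (@measurable_Rintegral_section _ _ _ mR mR unit_law (fun z => (X z.2 <= X z.1)%R%:R) 1).
  apply: measurable_leR; first exact: (measurableT_comp mX measurable_snd).
  exact: (measurableT_comp mX measurable_fst).
by move=> z; exact: norm_boolR.
Qed.

Let mfX (u w : mR * mR -> mR) : measurable_fun setT u -> measurable_fun setT w ->
  measurable_fun setT (fun z => f (u z) (w z)).
Proof. by move=> mu_ mw; exact: (measurableT_comp mf (measurable_fun_pair mu_ mw)). Qed.

Let mean_leb v : mean v = \int[leb_itv 0 1]_a f (X v) ((1 - a) * p v + a * q v).
Proof.
rewrite leb_itv_integral//; apply: continuous_measurableR.
move=> a; apply: (@continuous_comp _ _ _ (fun a : R => (1 - a) * p v + a * q v) (f (X v)));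
  last exact: cf.
apply: cvgD; apply: cvgM; try exact: cvg_cst; last exact: cvg_id.
by apply: cvgB; [exact: cvg_cst|exact: cvg_id].
Qed.

Lemma measurable_mean : measurable_fun setT mean.
Proof.
rewrite (_ : mean = fun v => \int[leb_itv 0 1]_a f (X v) ((1 - a) * p v + a * q v)); last first.
  by apply/funext => v; exact: mean_leb.
apply: (@measurable_Rintegral_section _ _ _ mR mR (leb_itv 0 1)
  (fun z => f (X z.1) ((1 - z.2) * p z.1 + z.2 * q z.1)) C) => //.
apply: mfX; first exact: (measurableT_comp mX measurable_fst).
apply: measurable_funD; apply: measurable_funM.
- by apply: measurable_funB => //; exact: measurable_snd.
- exact: (measurableT_comp mp measurable_fst).
- exact: measurable_snd.
- exact: (measurableT_comp mq measurable_fst).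
Qed.

Lemma mean_bound v : `|mean v| <= C.
Proof.
have cg : continuous (fun a : R => f (X v) ((1 - a) * p v + a * q v)).
  move=> a; apply: (@continuous_comp _ _ _ (fun a : R => (1 - a) * p v + a * q v) (f (X v)));
    last exact: cf.
  apply: cvgD; apply: cvgM; try exact: cvg_cst; last exact: cvg_id.
  by apply: cvgB; [exact: cvg_cst|exact: cvg_id].
have := @itv_integral_bounds _ _ 0 1 (- C) C cg ler01.
rewrite subr0 !mulr1 ler_norml; apply => a _.
by rewrite -ler_norml.
Qed.

(* Truncated density of the uniform law on the level set of [X] through [v]. *)
Let kappa (m : nat) v :=
  (m.+1%:R^-1 <= q v - p v)%R%:R * (Num.max (q v - p v) m.+1%:R^-1)^-1.

Let invn_gt0 m : 0 < m.+1%:R^-1 :> R. Proof. by rewrite invr_gt0. Qed.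

Let kappaE m v : (q v - p v) * kappa m v = (m.+1%:R^-1 <= q v - p v)%R%:R.
Proof.
rewrite /kappa; case: (boolP (_ <= q v - p v)) => h; last by rewrite mul0r mulr0.
by rewrite mul1r (max_idPl h) divff// gt_eqF// (lt_le_trans (invn_gt0 m) h).
Qed.

Let kappa_bound m v : `|kappa m v| <= m.+1%:R.
Proof.
have D0 : 0 < Num.max (q v - p v) m.+1%:R^-1 by rewrite lt_max invn_gt0 orbT.
rewrite normrM -[leRHS]mul1r ler_pM//; first exact: norm_boolR.
rewrite ger0_norm ?invr_ge0 ?(ltW D0)// -[leRHS]invrK lef_pV2// ?posrE//.
by rewrite le_max lexx orbT.
Qed.

Let mkappa m : measurable_fun setT (kappa m).
Proof.
have mD : measurable_fun setT (fun v => q v - p v) by exact: measurable_funB.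
apply: measurable_funM; first exact: measurable_leR.
have ci : continuous (fun z : R => (Num.max z m.+1%:R^-1)^-1).
  move=> z; apply: cvgV.
    by rewrite gt_eqF// lt_max invn_gt0 orbT.
  apply: (@max_fun_continuous _ _ R id (fun=> m.+1%:R^-1)).
    by move=> ?; exact: cvg_id.
  exact: cst_continuous.
exact: (measurableT_comp (continuous_measurableR ci) mD).
Qed.

(** Both sides are iterated integrals of one kernel [h]. Integrated over the point that carries the
    density, the mass of the level set cancels [kappa] and leaves the value at the other point;
    integrated over that other point first, the affine substitution on the level interval gives the
    mean. The truncation keeps [h] bounded, so the order may be exchanged. *)
Lemma truncated_mean m :
  \int[unit_law]_v ((m.+1%:R^-1 <= q v - p v)%R%:R * f (X v) v) =
  \int[unit_law]_v ((m.+1%:R^-1 <= q v - p v)%R%:R * mean v).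
Proof.
pose h (z : mR * mR) : R := kappa m z.1 * ((X z.2 == X z.1)%:R * f (X z.1) z.2).
have mh : measurable_fun setT h.
  apply: measurable_funM; first exact: (measurableT_comp (mkappa m) measurable_fst).
  apply: measurable_funM.
    apply: measurable_boolR; apply: measurable_fun_eqr.
      exact: (measurableT_comp mX measurable_snd).
    exact: (measurableT_comp mX measurable_fst).
  by apply: mfX => //; exact: (measurableT_comp mX measurable_fst).
have hC z : `|h z| <= m.+1%:R * C.
  rewrite normrM ler_pM// normrM -[leRHS]mul1r ler_pM//.
  exact: norm_boolR.
have mD : measurable_fun setT (fun v => q v - p v) by exact: measurable_funB.
have mJ : measurable_fun setT (fun v => (m.+1%:R^-1 <= q v - p v)%R%:R : R).
  exact: measurable_leR.
have mfd : measurable_fun setT (fun v : mR => f (X v) v).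
  exact: (measurableT_comp mf (measurable_fun_pair mX (@measurable_id _ _ setT))).
transitivity (\int[unit_law]_w \int[unit_law]_v h (v, w)).
  apply: ae_eq_Rintegral.
  - exact: measurable_funM.
  - apply: (@measurable_Rintegral_section _ _ _ mR mR unit_law (fun z => h (z.2, z.1)) (m.+1%:R * C)) => //.
    exact: (measurableT_comp mh (measurable_fun_pair measurable_snd measurable_fst)).
  - apply: filterS aeG => w Gw; rewrite -kappaE.
    transitivity (kappa m w * f (X w) w * \int[unit_law]_v ((X v == X w)%:R : R)).
      by rewrite level_set_mass -/(p w) -/(q w); ring.
    rewrite -RintegralZl//; last first.
      apply: (@bounded_integrable _ _ _ _ _ 1) => [|v]; last exact: norm_boolR.
      by apply: measurable_boolR; apply: measurable_fun_eqr.
    apply: eq_Rintegral => v _; rewrite /h/= eq_sym.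
    case: eqP => [E|_]; last by rewrite mul0r !mulr0.
    by rewrite mulr1 mul1r /kappa /p /q E.
rewrite -(@Rintegral_swap _ _ _ _ _ unit_law unit_law h _ mh hC).
apply: ae_eq_Rintegral.
- exact: (measurable_Rintegral_section unit_law mh hC).
- by apply: measurable_funM => //; exact: measurable_mean.
- apply: filterS aeG => v Gv; rewrite -kappaE.
  have mg : measurable_fun setT (fun w : mR => f (X v) w).
    exact: continuous_measurableR.
  have me : measurable_fun setT (fun w => (X w == X v)%:R * f (X v) w).
    apply: measurable_funM => //; apply: measurable_boolR; exact: measurable_fun_eqr.
  rewrite /h/= RintegralZl//; last first.
    apply: (@bounded_integrable _ _ _ _ _ C) => // w.
    exact: norm_boolM.
  have [k0|k0] := eqVneq (kappa m v) 0; first by rewrite k0 mul0r mulr0 mul0r.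
  rewrite [RHS]mulrAC [RHS]mulrC; congr (_ * _).
  have D0 : 0 < q v - p v.
    move: k0; rewrite /kappa; case: (boolP (_ <= q v - p v)) => h0; last by rewrite mul0r eqxx.
    by move=> _; exact: lt_le_trans (invn_gt0 m) h0.
  transitivity (\int[unit_law]_w ((p v <= w <= q v)%R%:R * f (X v) w)).
    apply: ae_eq_Rintegral => //.
      apply: measurable_funM => //; apply: measurable_boolR; apply: measurable_and;
        exact: measurable_fun_ler.
    by apply: filterS (level_set Gv) => w ->.
  have /andP[p0 _] := left_law_cdf01 (X v); have /andP[_ q1] := law_cdf01 (X v).
  rewrite (@unit_law_itv _ _ _ C)//.
  by rewrite affine_substitution// -subr_gt0.
Qed.

(** As [m] grows the truncation is eventually inactive wherever [p v < q v]. Where [p v = q v] there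
    is no atom, both equal [v] since [p v <= v <= q v], and the mean is already the value at [v]. *)
Lemma mean_identity : \int[unit_law]_v f (X v) v = \int[unit_law]_v mean v.
Proof.
have mD : measurable_fun setT (fun v => q v - p v) by exact: measurable_funB.
have mJ m : measurable_fun setT (fun v => (m.+1%:R^-1 <= q v - p v)%R%:R : R).
  exact: measurable_leR.
have mfd : measurable_fun setT (fun v : mR => f (X v) v).
  exact: (measurableT_comp mf (measurable_fun_pair mX (@measurable_id _ _ setT))).
have mm := measurable_mean.
have mg : measurable_fun setT (fun v => f (X v) v - mean v) by exact: measurable_funB.
have gC v : `|f (X v) v - mean v| <= C + C.
  by rewrite (le_trans (ler_normB _ _))// lerD//; exact: mean_bound.
have intf : (@unit_law R).-integrable setT (EFin \o (fun v => f (X v) v)).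
  exact: (@bounded_integrable _ _ _ _ _ C).
have intm : (@unit_law R).-integrable setT (EFin \o mean).
  by apply: (@bounded_integrable _ _ _ _ _ C) => // v; exact: mean_bound.
have lim0 : \int[unit_law]_v ((m.+1%:R^-1 <= q v - p v)%R%:R * (f (X v) v - mean v))
    @[m --> \oo] --> \int[unit_law]_v (f (X v) v - mean v).
  apply: (@bounded_cvg _ _ _ _ _ _ (C + C)).
  - by move=> m; exact: measurable_funM.
  - exact: mg.
  - by move=> m v; exact: norm_boolM.
  - apply: filterS aeG => v Gv.
    have pv : p v <= v by exact: left_law_cdf_le.
    have vq : v <= q v by exact: law_cdf_ge.
    have [pq|pq] := eqVneq (p v) (q v).
      have E : v = q v by apply/eqP; rewrite eq_le vq -pq pv.
      have -> : f (X v) v - mean v = 0.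
        apply/eqP; rewrite subr_eq0; apply/eqP; rewrite /mean.
        transitivity (\int[mu]_(a in `[0, 1]) (cst (f (X v) v) a)).
          by rewrite Rintegral_cst//= lebesgue_measure_itv/= lte_fin ltr01 sube0 mulr1.
        apply: eq_Rintegral => a _ /=; congr f.
        by rewrite pq -E; ring.
      by under eq_fun do rewrite mulr0; exact: cvg_cst.
    have D0 : 0 < q v - p v by rewrite subr_gt0 lt_neqAle pq (le_trans pv vq).
    apply: cvg_near_cst; near=> m.
    have -> : m.+1%:R^-1 <= q v - p v.
      by apply: ltW; near: m; exact: near_infty_natSinv_lt (PosNum D0).
    by rewrite mul1r.
have E m : \int[unit_law]_v ((m.+1%:R^-1 <= q v - p v)%R%:R * (f (X v) v - mean v)) = 0.
  transitivity (\int[unit_law]_v ((m.+1%:R^-1 <= q v - p v)%R%:R * f (X v) v -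
      (m.+1%:R^-1 <= q v - p v)%R%:R * mean v)).
    by apply: eq_Rintegral => v _; rewrite mulrBr.
  rewrite RintegralB ?truncated_mean ?subrr//.
  - apply: (@bounded_integrable _ _ _ _ _ C); first exact: measurable_funM.
    by move=> v; exact: norm_boolM.
  - apply: (@bounded_integrable _ _ _ _ _ C); first exact: measurable_funM.
    by move=> v; apply: norm_boolM; exact: mean_bound.
apply/eqP; rewrite -subr_eq0; apply/eqP; rewrite -RintegralB//.
move: lim0; rewrite (funext E) => lim0.
by rewrite (cvg_unique _ lim0 (cvg_cst 0)).
Unshelve. all: by end_near. Qed.

End atoms.

(** * The limit coupling and its law *)

Section tightness.
Context {R : realType}.
Notation mR := (measurableTypeR R).

Lemma max0_continuous : continuous (fun t : R => Num.max 0 t).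
Proof.
by apply: (@max_fun_continuous _ _ R (fun=> 0) id) => ?; [exact: cvg_cst|exact: cvg_id].
Qed.

Definition plateau (K y : R) : R := Num.max 0 (Num.min 1 (K + 1 - `|y|)).

Lemma plateau_continuous K : continuous (plateau K).
Proof.
apply: (@max_fun_continuous _ _ R (fun=> 0) (fun y => Num.min 1 (K + 1 - `|y|))).
  exact: cst_continuous.
apply: (@min_fun_continuous _ _ R (fun=> 1) (fun y => K + 1 - `|y|)).
  exact: cst_continuous.
by move=> y; apply: cvgB; [exact: cvg_cst|exact: norm_continuous].
Qed.

Lemma plateau01 K y : 0 <= plateau K y <= 1.
Proof. by rewrite le_max lexx/= ge_max ler01 ge_min lexx. Qed.

Lemma plateau_norm K y : `|plateau K y| <= 1.
Proof. by have /andP[h1 h2] := plateau01 K y; rewrite ger0_norm. Qed.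

Lemma plateau_out K y : K + 1 <= `|y| -> plateau K y = 0.
Proof.
by move=> h; apply/max_idPl; rewrite ge_min; apply/orP; right; rewrite subr_le0.
Qed.

Lemma plateau_in K y : `|y| <= K -> plateau K y = 1.
Proof.
move=> h; rewrite /plateau; have -> : Num.min 1 (K + 1 - `|y|) = 1 by apply/min_idPl; lra.
by apply/max_idPr.
Qed.

Lemma empirical_coupling n (a : 'I_n.+1 -> R) (f : R -> R) C : continuous f ->
  (forall y, `|f y| <= C) ->
  \int[empirical (R := R) a]_y f y = \int[unit_law]_v f (a (@idx R n v)).
Proof.
move=> cf fC; rewrite (idx_average (fun k => f (a k))) (empirical_integral _ _ fC)//.
exact: continuous_measurableR.
Qed.

(** Tightness at a fixed quantile. If the particle of rank [v0] were far to the right, so would all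
    those of larger rank, and a mass [1 - v0] would escape the plateau; on the left a mass [v0]
    would. *)
Lemma quantile_bounded (P : probability R R) (a : forall n, 'I_n.+1 -> R) :
  (forall n (i j : 'I_n.+1), (i <= j)%N -> a n i <= a n j) ->
  weak_cvg (@bounded_continuous R R) (fun n => empirical (a n)) P ->
  forall v, 0 < v < 1 -> exists M, forall n, `|a n (@idx R n v)| <= M.
Proof.
move=> ox xP v0 /andP[v00 v01].
have mpl K : measurable_fun setT (plateau K : mR -> R).
  by apply: continuous_measurableR; exact: plateau_continuous.
(* Less than the mass on either side of [v0], so that losing one whole side contradicts a plateau
   integral above [1 - e]. *)
pose e := Num.min v0 (1 - v0) / 2.
have e0 : 0 < e by rewrite divr_gt0// lt_min v00 subr_gt0.
have ev : e <= v0 / 2 by rewrite ler_pM2r ?invr_gt0// ge_min lexx.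
have e1v : e <= (1 - v0) / 2 by rewrite ler_pM2r ?invr_gt0// ge_min lexx orbT.
have : \int[P]_y plateau k%:R y @[k --> \oo] --> \int[P]_y (fun=> 1 : R) y.
  apply: (@bounded_cvg _ _ _ _ _ _ 1).
  - by move=> k; exact: mpl.
  - exact: measurable_cst.
  - by move=> k y; exact: plateau_norm.
  - apply: nearW => y; apply: cvg_near_cst; near=> k; apply: plateau_in.
    by near: k; exact: nbhs_infty_ger.
rewrite Rintegral_cst// mul1r (congr1 fine (probability_setT P)) => Pcv.
have [k Hk] : exists k : nat, 1 - e < \int[P]_y plateau k%:R y.
  have : \forall k \near \oo, 1 - e < \int[P]_y plateau k%:R y.
    by apply: (cvgr_gt _ Pcv); rewrite ltrBlDr ltrDl.
  by move=> [k _ H]; exists k; apply: H => /=.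
have bc : bounded_continuous (plateau k%:R : R -> R).
  by split; [exact: plateau_continuous|exists 1 => y; exact: plateau_norm].
have : \forall n \near \oo, 1 - e < \int[empirical (R := R) (a n)]_y plateau k%:R y.
  exact: (cvgr_gt _ (xP _ bc)).
move=> [N _ HN].
have mi n : (@unit_law R).-integrable setT
    (EFin \o (fun v : mR => plateau k%:R (a n (@idx R n v)))).
  apply: (@bounded_integrable _ _ _ _ _ 1); last by move=> v; exact: plateau_norm.
  by apply: (measurable_idx_fun (f := fun k' _ => plateau k%:R (a n k'))) => k'.
have mv : measurable_fun setT (fun v : mR => (v <= v0)%R%:R : R) by exact: measurable_leR.
have iv : (@unit_law R).-integrable setT (EFin \o (fun v : mR => (v <= v0)%R%:R : R)).
  by apply: (@bounded_integrable _ _ _ _ _ 1) => // v; exact: norm_boolR.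
have i1 : (@unit_law R).-integrable setT (EFin \o (fun v : mR => 1 : R)).
  by apply: (@bounded_integrable _ _ _ _ _ 1) => // v; rewrite normr1.
have i1v : (@unit_law R).-integrable setT (EFin \o (fun v : mR => 1 - (v <= v0)%R%:R : R)).
  exact: (integrableB _ i1 iv).
have large n : (N <= n)%N -> `|a n (@idx R n v0)| <= k%:R + 1.
  move=> Nn; have := HN n Nn => /=.
  rewrite (empirical_coupling _ (@plateau_continuous _) (plateau_norm _)) => H.
  rewrite leNgt; apply/negP => big; move: H; apply/negP; rewrite -leNgt.
  have [xp|xn] := leP 0 (a n (@idx R n v0)).
    rewrite ger0_norm// in big.
    apply: (@le_trans _ _ (\int[unit_law]_v ((v <= v0)%R%:R : R))); last first.
      by rewrite unit_law_le ?v00// ; lra.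
    apply: le_Rintegral => // v _; have [vv|vv] := leP v v0.
      by case/andP : (plateau01 k%:R (a n (@idx R n v))).
    rewrite plateau_out//; apply: le_trans (ler_norm _).
    by apply: (le_trans (ltW big)); apply: ox; apply: idx_le; exact: ltW.
  rewrite ltr0_norm// in big.
  apply: (@le_trans _ _ (\int[unit_law]_v (1 - (v <= v0)%R%:R : R))); last first.
    rewrite RintegralB// Rintegral_cst// unit_law_le ?v00//.
    by rewrite (congr1 fine (probability_setT (@unit_law R))) /=; lra.
  apply: le_Rintegral => // v _; have [vv|vv] := leP v v0; last first.
    by rewrite subr0; case/andP : (plateau01 k%:R (a n (@idx R n v))).
  rewrite subrr plateau_out// -normrN; apply: le_trans (ler_norm _).
  apply: (le_trans (ltW big)); rewrite lerN2; apply: ox; exact: idx_le.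
(* Weak convergence controls only [n >= N]; the sum absorbs the finitely many earlier terms. *)
exists (k%:R + 1 + \sum_(i < N) `|a i (@idx R i v0)|) => n.
have [nN|Nn] := ltnP n N; last first.
  by apply: (le_trans (large n Nn)); rewrite lerDl sumr_ge0.
rewrite (bigD1 (Ordinal nN))//= addrCA lerDl addr_ge0// ?addr_ge0//.
by rewrite sumr_ge0.
Unshelve. all: by end_near. Qed.

End tightness.

Section coupling.
Context {R : realType} {d : nat}.
Notation mR := (measurableTypeR R).
Variables (lam : 'rV[R]_d -> 'rV[R]_d) (F : 'I_d -> 'rV[R]_d -> R).
Variables (A B : 'I_d -> R) (L : R).
Hypothesis F_cont : forall g, continuous (F g).
Hypothesis F_lam : forall g u, unit_cube u -> F g u = lam u 0 g.
Hypothesis F_bd : forall g u, A g <= F g u <= B g.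
Hypothesis L0 : 0 < L.
Hypothesis AB_sep : forall g h : 'I_d, (g < h)%N -> B h + L <= A g.
Variables (x : forall n : nat, 'M[R]_(d, n.+1)).
Hypothesis x_conf : forall n, configuration (x n).
Variable m : 'I_d -> probability R R.
Hypothesis x_cvg : forall g, weak_cvg (@bounded_continuous R R)
  (fun n => empirical (x n g)) (m g).

(** Negative times are frozen at the initial position, which makes paths Lipschitz on the whole
    line. *)
Definition position n g (t v : R) : R := mspd lam (x n) (Num.max 0 t) g (@idx R n v).

Definition lipschitz_bound : R := \big[Num.max/0]_g speed_bound A B g.

Let K := lipschitz_bound.

Lemma lipschitz_bound_ge0 : 0 <= K.
Proof. exact: bigmax_ge_id. Qed.

Lemma max0_ge (t : R) : 0 <= Num.max 0 t.
Proof. by rewrite le_max lexx. Qed.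

Lemma position_lipschitz n g s t v :
  `|position n g t v - position n g s v| <= K * `|t - s|.
Proof.
wlog st : s t / s <= t.
  move=> W; have [st|ts] := leP s t; first exact: W.
  by rewrite distrC (distrC t); apply: W; exact: ltW.
have mst : Num.max 0 s <= Num.max 0 t.
  by rewrite ge_max !le_max lexx st orbT.
have /andP[H1 H2] :=
  mspd_increment F_cont F_lam F_bd L0 AB_sep g (@idx R n v) (@x_conf n) (max0_ge s) mst.
have ba : Num.max 0 t - Num.max 0 s <= t - s.
  by have [t0|t0] := leP 0 t; have [s0|s0] := leP 0 s; lra.
have ba0 : 0 <= Num.max 0 t - Num.max 0 s by rewrite subr_ge0.
have sB : speed_bound A B g <= K by exact: le_bigmax_cond.
rewrite (ger0_norm (x := t - s)) ?subr_ge0//.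
apply: (@le_trans _ _ (speed_bound A B g * (Num.max 0 t - Num.max 0 s))); last first.
  apply: (@le_trans _ _ (K * (Num.max 0 t - Num.max 0 s))); first exact: ler_wpM2r.
  by apply: ler_wpM2l => //; exact: lipschitz_bound_ge0.
have lA : - speed_bound A B g <= A g.
  by rewrite lerNl (le_trans (ler_norm _))// normrN le_max lexx.
have lB : B g <= speed_bound A B g by rewrite (le_trans (ler_norm _))// le_max lexx orbT.
rewrite ler_norml -mulNr; apply/andP; split.
  by apply: le_trans H1; exact: ler_wpM2r.
by apply: (le_trans H2); exact: ler_wpM2r.
Qed.

Lemma position_nd n g t v w : v <= w -> position n g t v <= position n g t w.
Proof.
move=> vw; have [c _] := mspd_local F_cont F_lam F_bd L0 AB_sep (@x_conf n) (max0_ge t).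
by have := c g _ _ (@idx_le R n _ _ vw); rewrite !mxE.
Qed.

Lemma position_separate n (g h : 'I_d) v w a b : (g < h)%N -> 0 <= a -> a <= b ->
  position n g a v - position n h a w + L * (b - a) <= position n g b v - position n h b w.
Proof.
move=> gh a0 ab; have b0 := le_trans a0 ab.
have ea : Num.max 0 a = a by exact/max_idPr.
have eb : Num.max 0 b = b by exact/max_idPr.
by rewrite /position ea eb; apply: (mspd_separate F_cont F_lam F_bd L0 AB_sep).
Qed.

Lemma measurable_position n g :
  measurable_fun setT (fun z : mR * mR => position n g z.1 z.2).
Proof.
rewrite /position; pose f k (z : R) := mspd lam (x n) (Num.max 0 z) g k.
have E : (fun z : mR * mR => mspd lam (x n) (Num.max 0 z.1) g (@idx R n z.2)) =
    fun z => \sum_k (@idx R n z.2 == k)%:R * f k z.1.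
  by apply/funext => z; rewrite -(idx_sumE f).
rewrite E; apply: measurable_sum => k; apply: measurable_funM.
  exact: (measurableT_comp (measurable_idx_indic k) measurable_snd).
apply: (@measurableT_comp _ _ _ _ _ _ (f k) _ (fun z : mR * mR => z.1)); last exact: measurable_fst.
apply: continuous_measurableR => t.
rewrite /f; apply: (@continuous_comp R R R (fun z : R => Num.max 0 z) (fun t : R => mspd lam (x n) t g k)).
  exact: max0_continuous.
exact: mspd_continuous.
Qed.

Lemma position_bounded g t v : 0 < v < 1 -> exists M, forall n, `|position n g t v| <= M.
Proof.
move=> v01; have [|M HM] := quantile_bounded _ (@x_cvg g) v01.
  by move=> n i j ij; have := @x_conf n g i j ij; rewrite !mxE.
exists (M + K * `|t|) => n.
have := position_lipschitz n g 0 t v; rewrite subr0 => H.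
rewrite -(subrK (position n g 0 v) (position n g t v)) addrC.
apply: (le_trans (ler_normD _ _)); apply: lerD => //.
by rewrite /position maxxx mspd0.
Qed.

End coupling.

Section coupling_limit.
Context {R : realType} {d : nat}.
Notation mR := (measurableTypeR R).

Lemma cvg_le_le (u w : nat -> R) (a b : R) : u @ \oo --> a -> w @ \oo --> b ->
  (forall n, u n <= w n) -> a <= b.
Proof.
move=> ua wb uw; rewrite -(cvg_lim _ ua)// -(cvg_lim _ wb)//.
by apply: ler_lim; [apply/cvg_ex; exists a|apply/cvg_ex; exists b|exact: nearW].
Qed.

Lemma cvg_dist_le (u w : nat -> R) (a b c : R) : u @ \oo --> a -> w @ \oo --> b ->
  (forall n, `|u n - w n| <= c) -> `|a - b| <= c.
Proof.
move=> ua wb uw.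
apply: (@cvg_le_le (fun n => `|u n - w n|) (fun=> c)); last exact: uw.
  by apply: cvg_norm; exact: cvgB.
exact: cvg_cst.
Qed.

Lemma measurable_curry (f : R -> R -> R) t :
  measurable_fun setT (fun z : mR * mR => f z.1 z.2) -> measurable_fun setT (f t : mR -> R).
Proof.
move=> mf.
exact: (measurableT_comp mf (measurable_fun_pair (measurable_cst t) (@measurable_id _ mR setT))).
Qed.

(** [G] is a measurable set of good quantiles, of full measure and independent of time and type. The
    last clause, continuity in [v] along [G], serves the measurability of the random path. *)
Definition coupling_limit (p : nat -> 'I_d -> R -> R -> R) (X : 'I_d -> R -> R -> R) (G : set R) :=
  [/\ measurable (G : set mR), (forall v, G v -> 0 < v < 1),
      {ae @unit_law R, forall v, G v},
      (forall g, measurable_fun setT (fun z : mR * mR => X g z.1 z.2)) &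
      (forall v, G v -> forall t g, p n g t v @[n --> \oo] --> X g t v) /\
      forall v, G v -> forall t g e, 0 < e -> exists q q', q < v < q' /\
        forall w, G w -> q < w < q' -> `|X g t w - X g t v| <= e].

Variables (p : nat -> 'I_d -> R -> R -> R) (K : R).
Hypothesis K0 : 0 <= K.
Hypothesis p_lip : forall n g s t v, `|p n g t v - p n g s v| <= K * `|t - s|.
Hypothesis p_nd : forall n g t v w, v <= w -> p n g t v <= p n g t w.
Hypothesis p_bd : forall g t v, 0 < v < 1 -> exists M, forall n, `|p n g t v| <= M.
Hypothesis p_meas : forall n g, measurable_fun setT (fun z : mR * mR => p n g z.1 z.2).

Let rat_near (t e : R) : 0 < e -> exists q : rat, K * `|t - ratr q| < e.
Proof.
move=> e0; have K1 : 0 < K + 1 by rewrite ltr_wpDl.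
have de0 : 0 < e / (K + 1) by rewrite divr_gt0.
have [|q /andP[q1 q2]] := @rat_between R (t - e / (K + 1)) (t + e / (K + 1)); first lra.
exists q; apply: (@le_lt_trans _ _ ((K + 1) * `|t - ratr q|)).
  by rewrite ler_wpM2r// lerDl.
by rewrite mulrC -ltr_pdivlMr// ltr_norml; lra.
Qed.

(** Selection takes place at rational times. The uniform Lipschitz bound makes the sequences Cauchy
    at every time and transfers the continuity in [v], with one third of [e] spent on each change of
    time. *)
Lemma coupling_limit_exists : exists r : nat -> nat,
  {homo r : i j / (i < j)%N >-> (i < j)%N} /\
  exists X G, coupling_limit (fun n => p (r n)) X G.
Proof.
have [||r [r_incr [N [cN HN]]]] :=
  @helly R (rat * 'I_d)%type (fun j n v => p n j.2 (ratr j.1) v).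
- by move=> [q g] n v w _ vw _; exact: p_nd.
- by move=> [q g] v v01; exact: p_bd.
exists r; split => //.
pose G : set R := [set v | 0 < v < 1 /\ ~ N v].
have mN : measurable (N : set mR) by exact: countable_measurable.
have mG : measurable (G : set mR).
  have -> : G = `]0, 1[ `&` ~` N.
    by apply/seteqP; split => v /=; rewrite in_itv.
  by apply: measurableI; [exact: measurable_itv|exact: measurableC].
(* Multiplying by the indicator of [G] makes the sequence converge at every point, so [X] is a
   pointwise limit of measurable functions. *)
pose X g t v := lim ((\1_G v * p (r n) g t v : R) @[n --> \oo]).
have conv v : G v -> forall t g, p (r n) g t v @[n --> \oo] --> X g t v.
  move=> Gv t g; have [v01 Nv] := Gv.
  have E : (fun n => \1_G v * p (r n) g t v : R) = (fun n => p (r n) g t v).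
    by apply/funext => n; rewrite indicE mem_set// mul1r.
  rewrite /X E; apply: cauchy_cvg; apply: cauchy_exP => e e0.
  have e20 : 0 < e / 2 by rewrite divr_gt0.
  have [q Kq] := rat_near t e20.
  have [cq _] := HN v v01 Nv (q, g).
  exists (lim (p (r n) g (ratr q) v @[n --> \oo])).
  have /cvgrPdist_lt/(_ _ e20) := cq.
  apply: filterS => n /= H; rewrite /ball/=.
  have := p_lip (r n) g t (ratr q) v; rewrite distrC (distrC (ratr q)) => H2.
  rewrite -(subrK (p (r n) g (ratr q) v) (lim _)) -addrA.
  apply: (le_lt_trans (ler_normD _ _)).
  rewrite (splitr e); apply: ltrD => //.
  by rewrite distrC; exact: le_lt_trans Kq.
have Xlip v : G v -> forall s t g, `|X g t v - X g s v| <= K * `|t - s|.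
  by move=> Gv s t g; apply: (cvg_dist_le (conv v Gv t g) (conv v Gv s g)).
exists X, G; split => //.
- by move=> v [].
- have [N0 mN0] : (@unit_law R) (~` G) = 0%E /\ measurable (~` G : set mR).
    split; last exact: measurableC.
    rewrite [LHS]unit_lawE.
    apply/eqP; rewrite eq_le measure_ge0 andbT -(countable_lebesgue_measure0 cN).
    apply: le_measure; rewrite ?inE//.
      by apply: measurableI; [exact: measurableC|exact: measurable_itv].
    move=> v /= [nG]; rewrite in_itv/= => v01; apply: contrapT => nN.
    exact: nG.
  by exists (~` G); split.
- move=> g.
  apply: (@measurable_fun_cvg _ _ _ setT (fun n (z : mR * mR) => \1_G z.2 * p (r n) g z.1 z.2 : R)).
  + move=> n; apply: measurable_funM; last exact: p_meas.
    exact: (measurableT_comp (measurable_indic mG) measurable_snd).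
  + move=> z _; rewrite /X; have [Gv|nGv] := pselect (G z.2).
      have := conv _ Gv z.1 g; rewrite /X.
      rewrite (_ : (fun n => p (r n) g z.1 z.2) = (fun n => \1_G z.2 * p (r n) g z.1 z.2 : R))//.
      by apply/funext => n; rewrite indicE mem_set// mul1r.
    rewrite (_ : (fun n => \1_G z.2 * p (r n) g z.1 z.2 : R) = fun=> 0).
      rewrite lim_cst//; exact: cvg_cst.
    by apply/funext => n; rewrite indicE memNset// mul0r.
- split => // v Gv t g e e0; have [v01 Nv] := Gv.
  have e30 : 0 < e / 3 by rewrite divr_gt0.
  have [q Kq] := rat_near t e30.
  have [cq Hq] := HN v v01 Nv (q, g).
  have [a [b [avb H]]] := Hq _ e30.
  exists a, b; split => // w Gw awb; have [w01 Nw] := Gw.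
  have := H w w01 Nw awb => /=.
  rewrite (cvg_lim _ (conv _ Gw (ratr q) g))// (cvg_lim _ (conv _ Gv (ratr q) g))//.
  have := Xlip _ Gw (ratr q) t g; have := Xlip _ Gv (ratr q) t g.
  rewrite !ler_norml => /andP[h1 h2] /andP[h3 h4] /andP[h5 h6].
  by apply/andP; split; lra.
Qed.

Variables (X : 'I_d -> R -> R -> R) (G : set R).
Hypothesis pX : coupling_limit p X G.

Lemma coupling_limit_lipschitz v : G v ->
  forall s t g, `|X g t v - X g s v| <= K * `|t - s|.
Proof.
move=> Gv s t g; have [_ _ _ _ [conv _]] := pX.
exact: (cvg_dist_le (conv v Gv t g) (conv v Gv s g)).
Qed.

Lemma coupling_limit_nd g t v w : G v -> G w -> v <= w -> X g t v <= X g t w.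
Proof.
move=> Gv Gw vw; have [_ _ _ _ [conv _]] := pX.
by apply: (cvg_le_le (conv v Gv t g) (conv w Gw t g)) => n; exact: p_nd.
Qed.

Variable L : R.
Hypothesis p_sep : forall n (g h : 'I_d) v w a b, (g < h)%N -> 0 <= a -> a <= b ->
  p n g a v - p n h a w + L * (b - a) <= p n g b v - p n h b w.

Lemma coupling_limit_separate (g h : 'I_d) v w a b : (g < h)%N -> G v -> G w ->
  0 <= a -> a <= b ->
  X g a v - X h a w + L * (b - a) <= X g b v - X h b w.
Proof.
move=> gh Gv Gw a0 ab; have [_ _ _ _ [conv _]] := pX.
apply: (@cvg_le_le (fun n => p n g a v - p n h a w + L * (b - a))
  (fun n => p n g b v - p n h b w)); last by move=> n; exact: p_sep.
  by apply: cvgD; [exact: cvgB (conv v Gv a g) (conv w Gw a h)|exact: cvg_cst].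
exact: cvgB (conv v Gv b g) (conv w Gw b h).
Qed.

End coupling_limit.

(** * The random limit path and its law *)

Section limit_law.
Context {R : realType} {d : nat}.
Notation mR := (measurableTypeR R).

Lemma measurable_trajectory_fun (f : trajectory R d -> R) :
  continuous f -> measurable_fun setT f.
Proof.
move=> cf; apply: (@measurability _ _ (trajectory R d) R setT f
  (@measurable_realfun.RGenOpens.G R)).
  exact: measurable_realfun.RGenOpens.measurableE.
move=> _ [_ [a [b ->]] <-]; rewrite setTI; apply: sub_sigma_algebra.
by move/continuousP : cf; apply; exact: interval_open.
Qed.

Variables (p : nat -> 'I_d -> R -> R -> R) (K : R).
Hypothesis K0 : 0 <= K.
Hypothesis p_lip : forall n g s t v, `|p n g t v - p n g s v| <= K * `|t - s|.
Variables (X : 'I_d -> R -> R -> R) (G : set R).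
Hypothesis pX : coupling_limit p X G.

(** Outside [G] the path is set to zero, so that it is a Lipschitz path for every [v]. *)
Definition limit_path (v : R) (t : halfline R) : 'rV[R]_d :=
  \row_g (\1_G v * X g (\val t) v).

Lemma limit_path_in v t g : G v -> limit_path v t 0 g = X g (\val t) v.
Proof. by move=> Gv; rewrite mxE indicE mem_set// mul1r. Qed.

Lemma limit_path_out v t : ~ G v -> limit_path v t = 0.
Proof. by move=> Gv; apply/rowP => g; rewrite !mxE indicE memNset// mul0r. Qed.

Lemma limit_path_lipschitz v (s t : halfline R) g :
  `|limit_path v s 0 g - limit_path v t 0 g| <= K * `|\val s - \val t|.
Proof.
have [Gv|nGv] := pselect (G v); last by rewrite !limit_path_out// subrr normr0 mulr_ge0.
by rewrite !limit_path_in//; exact: (coupling_limit_lipschitz p_lip pX).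
Qed.

Lemma limit_path_continuous v : continuous (limit_path v).
Proof.
apply: mx_continuous => i g t; rewrite (ord1 i).
have FF : Filter (nbhs t) := @nbhs_filter (halfline R) t.
apply/cvgrPdist_lt => e e0; have K1 : 0 < K + 1 by rewrite ltr_wpDl.
have eK : 0 < e / (K + 1) by rewrite divr_gt0.
have /cvgrPdist_lt/(_ _ eK) := @val_halfline_continuous R t.
apply: (@filterS _ (nbhs t) (nbhs_filter t)) => s st; apply: (le_lt_trans (limit_path_lipschitz _ _ _ _)).
apply: (@le_lt_trans _ _ ((K + 1) * `|\val t - \val s|)).
  by rewrite ler_wpM2r// lerDl.
by rewrite mulrC -ltr_pdivlMr.
Qed.

Definition limit_trajectory (v : mR) : trajectory R d := mkcts (@limit_path_continuous v).

(** At each time, continuity along [G] comes from [coupling_limit]; the common Lipschitz constant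
    upgrades it to locally uniform convergence of whole paths. *)
Lemma limit_trajectory_cvg v : G v ->
  limit_trajectory @ within G (nbhs v) --> limit_trajectory v.
Proof.
move=> Gv; have FF : ProperFilter (within G (nbhs (v : R))).
  by apply: Build_ProperFilter => /= /nbhs_singleton; apply.
apply: (@trajectory_cvg R d R _ FF _ _ K).
  by move=> w s t g; apply: (limit_path_lipschitz w s t g).
move=> t g; apply/cvgrPdist_le => e e0 /=; have [_ _ _ _ [_ H]] := pX.
have [q [q' [/andP[qv vq'] Hq]]] := H v Gv (\val t) g e e0.
suff : \forall w \near (v : R), G w -> `|limit_trajectory v t 0 g - limit_trajectory w t 0 g| <= e.
  by [].
near=> w => Gw.
rewrite [limit_trajectory v t 0 g]limit_path_in// [limit_trajectory w t 0 g]limit_path_in//.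
rewrite distrC; apply: Hq => //.
apply/andP; split; near: w.
  exact: lt_nbhsr.
exact: lt_nbhsl.
Unshelve. all: by end_near. Qed.

Lemma measurable_limit_trajectory : measurable_fun setT limit_trajectory.
Proof.
have [mG _ _ _ _] := pX.
apply: (@measurability _ _ mR (trajectory R d) setT limit_trajectory (@open (trajectory R d))).
  by [].
move=> _ [U oU <-]; rewrite setTI.
(* By continuity along [G], the preimage of [U] within [G] is the trace of this open union of
   intervals; outside [G] the path is constant in [v]. *)
pose O : set R := \bigcup_(I in [set I : R * R |
  forall w, G w -> I.1 < w < I.2 -> U (limit_trajectory w)]) `]I.1, I.2[%classic.
have -> : limit_trajectory @^-1` U = (G `&` O) `|`
    (~` G `&` [set _ | U (mkcts (@cst_continuous (halfline R) 'rV[R]_d 0) : trajectory R d)]).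
  have outE w : ~ G w ->
      limit_trajectory w = mkcts (@cst_continuous (halfline R) 'rV[R]_d 0) :> trajectory R d.
    move=> nGw; apply/continuousEP => t; exact: limit_path_out.
  apply/seteqP; split => [v Uv|v].
    have [Gv|nGv] := pselect (G v); last first.
      by right; split => //=; rewrite -(outE v).
    left; split => //.
    have /(_ U) := @limit_trajectory_cvg v Gv; have oUv : nbhs (limit_trajectory v) U.
      by apply: open_nbhs_nbhs.
    move=> /(_ oUv); rewrite /= /within/= => -[r /= r0 Hr].
    exists (v - r, v + r) => /=; last by rewrite in_itv/=; apply/andP; split; lra.
    move=> w Gw wr; apply: Hr => //=.
    by rewrite ltr_distlC.
  case=> [[Gv [I HI]]|[nGv /=]]; first by rewrite /= in_itv/= => vI; exact: HI.
  by rewrite -(outE v).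
apply: measurableU; apply: measurableI => //.
- apply: open_measurable; apply: bigcup_open => I _; exact: interval_open.
- exact: measurableC.
- have [H|H] := pselect (U (mkcts (@cst_continuous (halfline R) 'rV[R]_d 0) : trajectory R d)).
    by rewrite (_ : [set _ | _] = setT)//; apply/seteqP; split.
  by rewrite (_ : [set _ | _] = set0)//; apply/seteqP; split.
Qed.

HB.instance Definition _ := isMeasurableFun.Build _ _ mR (trajectory R d)
  limit_trajectory measurable_limit_trajectory.

Definition limit_law : probability (trajectory R d) R :=
  distribution (@unit_law R) limit_trajectory.

Lemma limit_law_integral (f : trajectory R d -> R) C : measurable_fun setT f ->
  (forall w, `|f w| <= C) ->
  \int[limit_law]_w f w = \int[unit_law]_v f (limit_trajectory v).
Proof.
move=> mf fC; congr fine; rewrite integral_distribution//.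
  exact/measurable_EFinP.
apply: (@bounded_integrable _ _ _ _ _ C) => //.
exact: measurableT_comp.
Qed.

(** Empirical and limit measures are images of the same uniform law, so weak convergence reduces to
    convergence of the path attached to almost every [v] and dominated convergence. *)
Lemma limit_law_cvg (k : nat -> nat) (a : forall n, 'I_(k n).+1 -> trajectory R d) :
  (forall n v t g, a n (@idx R (k n) v) t 0 g = p n g (\val t) v) ->
  weak_cvg (@bounded_continuous R (trajectory R d)) (fun n => empirical (a n)) limit_law.
Proof.
move=> aE f [cf [C fC]]; have mf := measurable_trajectory_fun cf.
have [_ _ aeG _ [conv _]] := pX.
rewrite (limit_law_integral mf fC).
have -> : (fun n => \int[empirical (R := R) (a n)]_w f w) =
    fun n => \int[unit_law]_v f (a n (@idx R (k n) v)).
  apply/funext => n.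
  by rewrite (idx_average (fun j => f (a n j))) (empirical_integral _ mf fC).
apply: (@bounded_cvg _ _ _ _ _ _ C).
- by move=> n; apply: (measurable_idx_fun (f := fun j _ => f (a n j))) => j; exact: measurable_cst.
- by apply: measurableT_comp => //; exact: measurable_limit_trajectory.
- by [].
- apply: filterS aeG => v Gv.
  apply: (@cvg_comp _ _ _ (fun n => a n (@idx R (k n) v)) f \oo (nbhs (limit_trajectory v)));
    last exact: cf.
  apply: (@trajectory_cvg R d nat \oo _ _ _ K).
    by move=> n s t g; rewrite !aE; exact: p_lip.
  move=> t g; rewrite [X in _ --> X]limit_path_in//.
  by under eq_fun do rewrite aE; exact: conv.
Qed.

End limit_law.

(** * Distribution functions and Stieltjes integrals *)

Section distribution_functions.
Context {R : realType}.
Notation mR := (measurableTypeR R).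

Section probability_on_the_line.
Variable P : probability R R.

(* [R] and [measurableTypeR R] have the same measurable sets but distinct displays. *)
Let to_mR : R -> mR := idfun.

Let measurable_to_mR : measurable_fun setT to_mR.
Proof. by move=> _ A mA; rewrite setTI. Qed.

#[local] HB.instance Definition _ := @isMeasurableFun.Build _ _ R mR to_mR measurable_to_mR.

Let P' : probability mR R := distribution P to_mR.

(** Both measures give a half-open interval the increment of the distribution function, and these
    intervals determine the measure. *)
Lemma lebesgue_stieltjes_distribution (A : set mR) : measurable A ->
  lebesgue_stieltjes_measure (distribution_function P) A = P' A.
Proof.
move=> mA; apply: lebesgue_stieltjes_measure_unique => [I [[a b]]/= _ <- | //].
rewrite /lebesgue_stieltjes_measure /measure_extension/=.
rewrite measurable_mu_extE/=; last exact: is_ocitv.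
have [ab | ba] := leP a b; last first.
  by rewrite set_itv_ge ?wlength0 ?measure0// bnd_simp -leNgt ltW.
rewrite wlength_itv_bnd// EFinB /distribution_function !fineK ?fin_num_measure//.
rewrite /P' /distribution /pushforward preimage_id.
have -> : `]a, b]%classic = `]-oo, b] `\` `]-oo, a].
  by rewrite -[RHS]setCK setCD setCitvl setUC -[LHS]setCK setCitv.
rewrite measureD ?setIidr//; first exact: subset_itvl.
by rewrite -ge0_fin_numE// fin_num_measure.
Qed.

Lemma lebesgue_stieltjes_integral (f : mR -> R) C : measurable_fun setT f ->
  (forall x, `|f x| <= C) ->
  \int[lebesgue_stieltjes_measure (distribution_function P)]_x f x = \int[P]_x f x.
Proof.
move=> mf fC; transitivity (\int[P']_x f x).
  by congr fine; apply: eq_measure_integral => A mA _; exact: lebesgue_stieltjes_distribution.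
congr fine; rewrite integral_distribution//.
  exact/measurable_EFinP.
exact: (@bounded_integrable _ _ _ _ _ C).
Qed.

Lemma Rintegral_bool (b : R -> bool) : measurable_fun setT b ->
  \int[P]_y ((b y)%:R : R) = fine (P [set y | b y]).
Proof.
move=> mb; congr fine; rewrite -[in RHS](setIT [set y | b y]) -integral_indic//; last exact: measurable_bool_set.
apply: eq_integral => y _; rewrite indicE; congr (_%:R%:E).
by apply/esym; case: (boolP (b y)) => h; [rewrite mem_set|rewrite memNset//; exact/negP].
Qed.

Lemma Rintegral_le_cdf x : \int[P]_y ((y <= x)%R%:R : R) = distribution_function P x.
Proof.
rewrite (@Rintegral_bool (fun y => y <= x)); last exact: measurable_fun_ler.
by rewrite /distribution_function set_itvNyc.
Qed.

Lemma distribution_function_left x :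
  lim (distribution_function P y @[y --> x^'-]) = \int[P]_y ((y < x)%R%:R : R).
Proof.
apply: cvg_lim => //; apply/cvg_at_leftP => u [ux cu].
have -> : (fun n => distribution_function P (u n)) = fun n => \int[P]_y ((y <= u n)%R%:R : R).
  by apply/funext => n; rewrite Rintegral_le_cdf.
apply: (@bounded_cvg _ _ _ _ _ _ 1).
- by move=> n; exact: measurable_leR.
- by apply: measurable_boolR; exact: measurable_fun_ltr.
- by move=> n y; exact: norm_boolR.
- apply: nearW => y; apply: cvg_near_cst; have [yx|xy] := ltP y x.
    near=> n; suff -> : y <= u n by [].
    by near: n; exact: (cvgr_ge _ cu).
  by apply: nearW => n; rewrite leNgt (lt_le_trans (ux n) xy).
Unshelve. all: by end_near. Qed.

Lemma distribution_function_determined (Z : mR -> R) : measurable_fun setT Z ->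
  (forall f, bounded_continuous f -> \int[P]_y f y = \int[unit_law]_v f (Z v)) ->
  forall x, distribution_function P x = law_cdf Z x.
Proof.
move=> mZ H x; rewrite -Rintegral_le_cdf /law_cdf.
(* Continuous approximation of the indicator of [y <= x]: 1 up to [x], then decreasing with slope
   [- n] down to 0. *)
pose f n (y : R) : R := plateau 0 (n%:R * Num.max 0 (y - x)).
have cf n : continuous (f n).
  move=> y; rewrite /f; apply: (@continuous_comp R R R (fun y => n%:R * Num.max 0 (y - x)) (plateau 0));
    last exact: plateau_continuous.
  apply: cvgM; first exact: cvg_cst.
  have := @max_fun_continuous _ _ R (fun=> 0) (fun y => y - x); apply.
    exact: cst_continuous.
  by move=> z; apply: cvgB; [exact: cvg_id|exact: cvg_cst].
have mf n : measurable_fun setT (f n : mR -> R) by apply: continuous_measurableR; exact: cf.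
have fcv y : f n y @[n --> \oo] --> ((y <= x)%R%:R : R).
  apply: cvg_near_cst; have [yx|xy] := leP y x.
    apply: nearW => n; rewrite /f; have -> : Num.max 0 (y - x) = 0 by apply/max_idPl; lra.
    by rewrite mulr0 plateau_in// normr0.
  near=> n; rewrite /f; have -> : Num.max 0 (y - x) = y - x by apply/max_idPr; lra.
  apply: plateau_out; rewrite add0r.
  apply: le_trans (ler_norm _); rewrite -ler_pdivrMr ?subr_gt0//.
  by near: n; exact: nbhs_infty_ger.
have b n : bounded_continuous (f n).
  by split; [exact: cf|exists 1 => y; exact: plateau_norm].
have c1 : \int[P]_y f n y @[n --> \oo] --> \int[P]_y ((y <= x)%R%:R : R).
  apply: (@bounded_cvg _ _ _ _ _ _ 1).
  - by move=> n; exact: mf.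
  - exact: measurable_leR.
  - by move=> n y; exact: plateau_norm.
  - exact: nearW.
have c2 : \int[unit_law]_v f n (Z v) @[n --> \oo] --> \int[unit_law]_v ((Z v <= x)%R%:R : R).
  apply: (@bounded_cvg _ _ _ _ _ _ 1).
  - by move=> n; exact: (measurableT_comp (mf n) mZ).
  - exact: measurable_leR.
  - by move=> n y; exact: plateau_norm.
  - by apply: nearW => v; exact: fcv.
have E : (fun n => \int[P]_y f n y) = fun n => \int[unit_law]_v f n (Z v).
  by apply/funext => n; exact: H.
by rewrite E in c1; exact: (cvg_unique _ c1 c2).
Unshelve. all: by end_near. Qed.

End probability_on_the_line.

End distribution_functions.

Section marginals_of_the_limit.
Context {R : realType} {d : nat}.
Notation mR := (measurableTypeR R).
Variables (p : nat -> 'I_d -> R -> R -> R) (K : R).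
Hypothesis K0 : 0 <= K.
Hypothesis p_lip : forall n g s t v, `|p n g t v - p n g s v| <= K * `|t - s|.
Variables (X : 'I_d -> R -> R -> R) (G : set R).
Hypothesis pX : coupling_limit p X G.

Let mu := limit_law K0 p_lip pX.

Let mX g t : measurable_fun setT (X g t : mR -> R).
Proof.
by have [_ _ _ mX _] := pX; exact: measurable_curry.
Qed.

Lemma marginal_integral g t (f : mR -> R) C : measurable_fun setT f ->
  (forall y, `|f y| <= C) ->
  \int[marginal mu g t]_y f y = \int[unit_law]_v f (X g (\val t) v).
Proof.
move=> mf fC; have mc := @measurable_coordinate R d g t.
transitivity (\int[mu]_w f (coordinate g t w)).
  congr fine; rewrite integral_distribution//.
    exact/measurable_EFinP.
  apply: (@bounded_integrable _ _ _ _ _ C) => //.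
  exact: (measurableT_comp mf mc).
rewrite (@limit_law_integral _ _ _ _ _ _ _ _ _ _ C)//; last exact: (measurableT_comp mf mc).
have [_ _ aeG _ _] := pX; apply: ae_eq_Rintegral.
- apply: (measurableT_comp (measurableT_comp mf mc)); exact: measurable_limit_trajectory.
- exact: (measurableT_comp mf (mX g (\val t))).
- by apply: filterS aeG => v Gv; rewrite /coordinate [X in f X]limit_path_in.
Qed.

Lemma marginal_cdf g t : distribution_function (marginal mu g t) =1 law_cdf (X g (\val t)).
Proof.
move=> x; rewrite -Rintegral_le_cdf (marginal_integral _ _ (C := 1))//.
  exact: measurable_leR.
by move=> y; exact: norm_boolR.
Qed.

Lemma marginal_left_cdf g t x :
  lim (distribution_function (marginal mu g t) y @[y --> x^'-]) = left_law_cdf (X g (\val t)) x.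
Proof.
rewrite distribution_function_left (marginal_integral _ _ (C := 1))//.
  by apply: measurable_boolR; exact: measurable_fun_ltr.
by move=> y; exact: norm_boolR.
Qed.

End marginals_of_the_limit.

(** * The limit equation *)

Section test_functions.
Context {R : realType}.

Lemma val_to_halfline (t : R) : \val (to_halfline t) = Num.max 0 t.
Proof.
have tE : (t \in (`[(0 : R), +oo[%classic : set R)) = (0 <= t).
  by apply/idP/idP; rewrite inE/= in_itv/= andbT.
by rewrite /to_halfline val_insubd [X in if X then _ else _]tE; case: (leP 0 t).
Qed.

Lemma val_halfline_ge0 (t : halfline R) : 0 <= \val t.
Proof. by have := valP t; rewrite inE/= in_itv/= andbT. Qed.

Lemma val_halflineK (t : halfline R) : to_halfline (\val t) = t.
Proof. exact: valKd. Qed.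

Lemma to_halfline_continuous : continuous (@to_halfline R).
Proof.
apply: continuous_comp_initial.
have -> : (set_val \o (@to_halfline R)) = fun t : R => Num.max 0 t.
  by apply/funext => t; exact: val_to_halfline.
exact: max0_continuous.
Qed.

Variables phi dphi : halfline R -> R -> R.
Hypothesis tphi : test_function phi dphi.

Let S := closure [set z : halfline R * R | phi z.1 z.2 != 0].

Let cphi : continuous (fun z : halfline R * R => phi z.1 z.2).
Proof. by case: tphi. Qed.
Let cdphi : continuous (fun z : halfline R * R => dphi z.1 z.2).
Proof. by case: tphi. Qed.
Let cS : compact S. Proof. by case: tphi. Qed.

Let extend_continuous (f : halfline R -> R -> R) :
  continuous (fun z : halfline R * R => f z.1 z.2) ->
  continuous (fun z : R * R => f (to_halfline z.1) z.2).
Proof.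
move=> cf z; apply: (@continuous_comp _ _ _
  (fun z : R * R => (to_halfline z.1, z.2)) (fun z => f z.1 z.2)); last exact: cf.
apply: pair_continuous => y; last exact: cvg_snd.
by apply: (@continuous_comp _ _ _ fst (@to_halfline R)); [exact: cvg_fst|exact: to_halfline_continuous].
Qed.

Let bounded_on_S (f : halfline R * R -> R) : continuous f ->
  exists2 M, 0 < M & forall z, S z -> `|f z| < M.
Proof.
move=> cf; have := @continuous_compact _ _ f S (continuous_subspaceT cf) cS.
move=> /compact_bounded[M [_ HM]].
exists (`|M| + 2) => [|z Sz]; first by rewrite ltr_wpDl.
apply: (@le_lt_trans _ _ (`|M| + 1)); last by rewrite ltrD2l ltr1n.
apply: HM; last by exists z.
by rewrite (le_lt_trans (ler_norm _))// ltrDl.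
Qed.

Let phi_out z : ~ S z -> phi z.1 z.2 = 0.
Proof.
move=> nSz; apply/eqP; apply: contrapT => /negP nz; apply: nSz.
exact: subset_closure.
Qed.

(** The filter is left general: the punctured one gives the derivative at positive times, the right
    one also covers time 0. *)
Let difference_quotient (t x : R) (F : set_system R) : Filter F -> 0 <= t ->
  F `=>` 0^' -> (\forall h \near F, 0 <= t + h) ->
  h^-1 * (phi (to_halfline (t + h)) x - phi (to_halfline t) x) @[h --> F]
    --> dphi (to_halfline t) x.
Proof.
move=> FF t0 F0 Ft; have [_ _ D _] := tphi.
have F1 : to_halfline (t + h) @[h --> F] --> (to_halfline t)^'.
  move=> A; rewrite /dnbhs/within/= => HA.
  have cA : (fun h => to_halfline (t + h)) @ (0 : R) --> to_halfline (t + 0).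
    apply: (@continuous_comp _ _ _ (fun h : R => t + h) (@to_halfline R)); last exact: to_halfline_continuous.
    by apply: cvgD; [exact: cvg_cst|exact: cvg_id].
  rewrite addr0 in cA; have {}HA : \forall h \near (0 : R),
      to_halfline (t + h) != to_halfline t -> A (to_halfline (t + h)) := cA _ HA.
  have HA' : 0^' (fun h : R => to_halfline (t + h) != to_halfline t -> A (to_halfline (t + h))).
    by apply: (@filterS _ (nbhs (0 : R)) _ _ _ _ HA) => h H _.
  have nz : F (fun h : R => h != 0) by apply: F0; apply: (@filterE _ (nbhs (0 : R))).
  apply: filterS3 (F0 _ HA') Ft nz => h /= H th h0; apply: H.
  apply/negP => /eqP/(congr1 (\val : halfline R -> R)); rewrite !val_to_halfline.
  by rewrite !(max_idPr _)// => /eqP; rewrite -subr_eq0 addrAC subrr add0r (negbTE h0).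
have := @cvg_comp _ _ _ (fun h : R => to_halfline (t + h))
  (fun s => (phi s x - phi (to_halfline t) x) / (\val s - \val (to_halfline t)))
  F (to_halfline t)^' _ F1 (D (to_halfline t) x).
apply: cvg_trans.
apply: near_eq_cvg; apply: filterS Ft => h th /=.
by rewrite !val_to_halfline !(max_idPr _)// [t + h]addrC addrK mulrC.
Qed.

(** Compact support is assumed of [phi] only. The complement of its closed support is open, so the
    right difference quotients there are eventually 0, at time 0 included. *)
Let dphi_out (t x : R) : 0 <= t -> ~ S (to_halfline t, x) -> dphi (to_halfline t) x = 0.
Proof.
move=> t0 nS.
have right : h^-1 * (phi (to_halfline (t + h)) x - phi (to_halfline t) x) @[h --> 0^'+]
    --> dphi (to_halfline t) x.
  apply: difference_quotient => //.
    by move=> U HU; apply: (@filterS _ (nbhs (0 : R)) _ _ _ _ HU) => h /= H h0; apply: H; rewrite gt_eqF.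
  by near=> h; rewrite addr_ge0//; near: h; exact: nbhs_right_ge.
have : h^-1 * (phi (to_halfline (t + h)) x - phi (to_halfline t) x) @[h --> 0^'+] --> (0 : R).
  apply: cvg_near_cst.
  have : \forall h \near (0 : R), ~ S (to_halfline (t + h), x).
    have c : continuous (fun h : R => (to_halfline (t + h), x)).
      apply: pair_continuous => [h|h]; last exact: cvg_cst.
      apply: (@continuous_comp _ _ _ (fun h : R => t + h) (@to_halfline R)); last exact: to_halfline_continuous.
      by apply: cvgD; [exact: cvg_cst|exact: cvg_id].
    have oS : nbhs (to_halfline (t + 0), x) (~` S).
      by rewrite addr0; apply: open_nbhs_nbhs; split => //; apply: closed_openC; exact: closed_closure.
    exact: (c 0 _ oS).
  move=> H; have {}H : \forall h \near 0^'+, ~ S (to_halfline (t + h), x).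
    by apply: (@filterS _ (nbhs (0 : R)) _ _ _ _ H).
  apply: filterS H => h /= /phi_out/= ->; have /= -> := phi_out nS.
  by rewrite subrr mulr0.
by move/(cvg_unique _ right) => ->.
Unshelve. all: by end_near. Qed.

Lemma test_function_smooth : exists M C,
  smooth_test (fun t => phi (to_halfline t)) (fun t => dphi (to_halfline t)) M C.
Proof.
have toh_max (t : R) : to_halfline t = to_halfline (Num.max 0 t).
  by rewrite -{1}(val_halflineK (to_halfline t)) val_to_halfline.
have [M1 M10 HM1] := @bounded_on_S (fun z => \val z.1)
  (fun z => @continuous_comp _ _ _ fst (\val : halfline R -> R) z (cvg_fst) (@val_halfline_continuous R z.1)).
have [M2 M20 HM2] := @bounded_on_S snd (fun z => cvg_snd).
have [C1 C10 HC1] := bounded_on_S cphi.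
have [C2 C20 HC2] := bounded_on_S cdphi.
have phiC t x : `|phi t x| <= C1 + C2.
  have [St|nSt] := pselect (S (t, x)); last by rewrite (phi_out nSt) normr0 addr_ge0// ltW.
  by rewrite (le_trans (ltW (HC1 _ St)))// lerDl ltW.
have dout t x : ~ S (to_halfline t, x) -> dphi (to_halfline t) x = 0.
  by rewrite toh_max => nS; apply: dphi_out => //; rewrite le_max lexx.
exists (M1 + M2), (C1 + C2); split.
- by rewrite addr_gt0.
- exact: extend_continuous.
- exact: extend_continuous.
- move=> t x Mtx; have nS : ~ S (to_halfline t, x).
    move=> St; have /= h1 := HM1 _ St; have /= h2 := HM2 _ St.
    case: Mtx => [Mt|Mx]; last by lra.
    by move: h1; rewrite val_to_halfline => /(le_lt_trans (ler_norm _)); rewrite gt_max => /andP[]; lra.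
  by rewrite dout//; have /= -> := phi_out nS.
- move=> t x; split; first exact: phiC.
  have [St|nSt] := pselect (S (to_halfline t, x)).
    by rewrite (le_trans (ltW (HC2 _ St)))// lerDr ltW.
  by rewrite dout// normr0 addr_ge0// ltW.
- move=> t x t0.
  have D : h^-1 *: (((fun t => phi (to_halfline t) x) \o shift t) (h *: 1) -
      phi (to_halfline t) x) @[h --> 0^'] --> dphi (to_halfline t) x.
    have -> : (fun h : R => h^-1 *: (((fun t => phi (to_halfline t) x) \o shift t) (h *: (1 : R)) -
        phi (to_halfline t) x)) =
      (fun h => h^-1 * (phi (to_halfline (t + h)) x - phi (to_halfline t) x)).
      by apply/funext => h /=; rewrite /shift/= [h%:A]mulr1 (addrC h t).
    apply: difference_quotient => //; first exact: ltW.
    have : \forall h \near (0 : R), 0 <= t + h.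
      exists t => //= h /=; rewrite sub0r normrN ltr_norml => /andP[h1 _]; lra.
    by move=> H; apply: (@filterS _ (nbhs (0 : R)) _ _ _ _ H).
  split; first by apply/cvg_ex; exists (dphi (to_halfline t) x).
  exact: cvg_lim.
Unshelve. all: by end_near. Qed.

End test_functions.

Section integrals_of_the_limit.
Context {R : realType}.
Notation mR := (measurableTypeR R).

Lemma Rintegral_support (D : set mR) (a b : R) (f : R -> R) (h : mR -> R) :
  `[a, b] `<=` D -> measurable_fun setT h ->
  (forall t, D t -> ~~ (a <= t <= b) -> f t = 0) ->
  (forall t, a <= t <= b -> f t = h t) ->
  \int[lebesgue_measure]_(t in D) f t = \int[leb_itv a b]_t h t.
Proof.
move=> abD mh f0 fh; rewrite leb_itv_integral// Rintegral_mkcond [RHS]Rintegral_mkcond.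
apply: eq_Rintegral => t _; rewrite !patchE.
have [tab|ntab] := boolP (a <= t <= b).
  have tI : `[a, b]%classic t by rewrite /= in_itv.
  by rewrite (mem_set tI) (mem_set (abD _ tI)) fh.
have tI : ~ `[a, b]%classic t by rewrite /= in_itv; exact/negP.
rewrite (memNset tI); case: ifPn => // /set_mem Dt; exact: f0.
Qed.

(** Fubini with the distribution function written as an integral of indicators over [v]. *)
Lemma Rintegral_law_cdf M C (f : R -> R) (Z : mR -> R) : continuous f ->
  (forall x, `|f x| <= C) -> (forall x, M <= `|x| -> f x = 0) -> measurable_fun setT Z ->
  \int[lebesgue_measure]_x (f x * law_cdf Z x) = \int[unit_law]_v tail M f (Z v).
Proof.
move=> cf fC supp mZ.
have mf : measurable_fun setT (f : mR -> R) by exact: continuous_measurableR.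
pose q (z : mR * mR) : R := f z.1 * (Z z.2 <= z.1)%R%:R.
have mq : measurable_fun setT q.
  apply: measurable_funM; first exact: (measurableT_comp mf measurable_fst).
  by apply: measurable_leR; [exact: (measurableT_comp mZ measurable_snd)|exact: measurable_fst].
have qC z : `|q z| <= C by exact: indic_le_bound.
rewrite (@Rintegral_support setT (- M) M _ (fun x => \int[unit_law]_v q (x, v)))//.
- by rewrite (Rintegral_swap _ _ mq qC).
- exact: (measurable_Rintegral_section _ mq qC).
- move=> x _ nx; rewrite supp ?mul0r// leNgt ltr_norml.
  by apply: contra nx => /andP[/ltW -> /ltW ->].
- move=> x _; rewrite /law_cdf -RintegralZl//.
  by apply: (@bounded_integrable _ _ _ _ _ 1); [exact: measurable_leR|move=> v; exact: norm_boolR].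
Qed.

End integrals_of_the_limit.

Section limit_equation.
Context {R : realType} {d : nat}.
Notation mR := (measurableTypeR R).
Variables (lam : 'rV[R]_d -> 'rV[R]_d) (F : 'I_d -> 'rV[R]_d -> R) (A B : 'I_d -> R).
Hypothesis F_cont : forall g, continuous (F g).
Hypothesis F_lam : forall g u, unit_cube u -> F g u = lam u 0 g.
Hypothesis F_bd : forall g u, A g <= F g u <= B g.
Variables (p : nat -> 'I_d -> R -> R -> R) (K : R).
Hypothesis K0 : 0 <= K.
Hypothesis p_lip : forall n g s t v, `|p n g t v - p n g s v| <= K * `|t - s|.
Hypothesis p_nd : forall n g t v w, v <= w -> p n g t v <= p n g t w.
Variables (X : 'I_d -> R -> R -> R) (G : set R).
Hypothesis pX : coupling_limit p X G.

Let u : 'I_d -> halfline R -> cumulativeBounded (0 : R) (1 : R) :=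
  fun g t => distribution_function (marginal (limit_law K0 p_lip pX) g t).

Let mX : forall g, measurable_fun setT (fun z : mR * mR => X g z.1 z.2).
Proof. by case: pX. Qed.

Let mXt g t : measurable_fun setT (X g t : mR -> R).
Proof. exact: measurable_curry. Qed.

Let uE g t x : u g t x = law_cdf (X g (\val t)) x.
Proof. exact: marginal_cdf. Qed.

Let mcdf g t : measurable_fun setT (law_cdf (X g t) : mR -> R).
Proof. exact: (measurable_law_cdf mX g (measurable_cst t) (@measurable_id _ mR setT)). Qed.

Let mlcdf g t : measurable_fun setT (left_law_cdf (X g t) : mR -> R).
Proof.
apply: (@measurable_Rintegral_section _ _ _ mR mR unit_law (fun z => (X g t z.2 < z.1)%R%:R) 1).
  apply: measurable_boolR; apply: measurable_fun_ltr; last exact: measurable_fst.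
  exact: (measurableT_comp (mXt g t) measurable_snd).
by move=> z; exact: norm_boolR.
Qed.

Lemma limit_measurable g :
  measurable_fun [set z : R * R | 0 <= z.1] (fun z : R * R => u g (to_halfline z.1) z.2).
Proof.
apply: measurable_funTS.
have -> : (fun z : R * R => u g (to_halfline z.1) z.2) =
    fun z => law_cdf (X g (Num.max 0 z.1)) z.2.
  by apply/funext => z; rewrite uE val_to_halfline.
apply: (measurable_law_cdf mX); last exact: measurable_snd.
apply: (@measurableT_comp _ _ _ _ _ _ (fun t : mR => Num.max 0 t : mR) _ fst); last exact: measurable_fst.
apply: continuous_measurableR.
exact: max0_continuous.
Qed.

Definition mean_row g t x (a : R) : 'rV[R]_d :=
  \row_h (if h == g then (1 - a) * left_law_cdf (X g t) x + a * law_cdf (X g t) x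
          else law_cdf (X h t) x).

Lemma mean_row_cube g t x a : 0 <= a <= 1 -> unit_cube (mean_row g t x a).
Proof.
move=> /andP[a0 a1] h; rewrite mxE; case: eqP => _; last exact: law_cdf01.
have /andP[l0 l1] := left_law_cdf01 (mXt g t) x; have /andP[r0 r1] := law_cdf01 (mXt g t) x.
apply/andP; split; nra.
Qed.

Let measurable_mean_row g t : measurable_fun setT (fun z : mR * mR => F g (mean_row g t z.1 z.2)).
Proof.
rewrite /mean_row; apply: (measurable_continuous_row (u := fun h (z : mR * mR) => if h == g then
  (1 - z.2) * left_law_cdf (X g t) z.1 + z.2 * law_cdf (X g t) z.1 else law_cdf (X h t) z.1)) => // h.
case: eqP => _; last exact: (measurableT_comp (mcdf h t) measurable_fst).
apply: measurable_funD; apply: measurable_funM.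
- by apply: measurable_funB; [exact: measurable_cst|exact: measurable_snd].
- exact: (measurableT_comp (mlcdf g t) measurable_fst).
- exact: measurable_snd.
- exact: (measurableT_comp (mcdf g t) measurable_fst).
Qed.

Let speedE g t x : speed lam u g t x = \int[leb_itv 0 1]_a F g (mean_row g (\val t) x a).
Proof.
rewrite leb_itv_integral; last first.
  exact: (measurableT_comp (measurable_mean_row g (\val t)) (pair1_measurable x)).
apply: eq_Rintegral => a; rewrite inE/= in_itv/= => a01.
rewrite F_lam; last exact: mean_row_cube.
have lE : lim (u g t y @[y --> x^'-]) = left_law_cdf (X g (\val t)) x.
  exact: marginal_left_cdf.
by congr (lam _ 0 g); apply/rowP => h; rewrite !mxE lE !uE.
Qed.

Let measurable_speed g t : measurable_fun setT (fun x : mR => speed lam u g t x).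
Proof.
rewrite (_ : (fun x => _) = fun x => \int[leb_itv 0 1]_a F g (mean_row g (\val t) x a)); last first.
  by apply/funext => x; exact: speedE.
exact: (measurable_Rintegral_section _ (measurable_mean_row g (\val t)) (fun z => F_norm F_bd g _)).
Qed.

Let speed_norm g t x : `|speed lam u g t x| <= speed_bound A B g.
Proof.
rewrite speedE; apply: le_trans (bounded_Rintegral_le (leb_itv 0 1) _ (fun z => F_norm F_bd g _)) _.
  exact: (measurableT_comp (measurable_mean_row g (\val t)) (pair1_measurable x)).
rewrite [X in fine X]leb_itvE setTI lebesgue_measure_itv/= lte_fin ltr01.
by rewrite -EFinB/= subr0 mulr1.
Qed.

(** The Stieltjes integral is pulled back to [v] through [X]. Over an atom, the averaged speed then
    has its own rank between the left and right distribution functions, the ends of the level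
    interval, and [mean_identity] replaces that average by the rank [v]. *)
Lemma limit_flux (phi : R -> R) C g (t : halfline R) : continuous phi ->
  (forall x, `|phi x| <= C) ->
  \int[lebesgue_stieltjes_measure (u g t)]_x (phi x * speed lam u g t x) =
  \int[unit_law]_v (phi (X g (\val t) v) * coupled_speed F (X ^~ (\val t)) g v).
Proof.
move=> cphi phiC; have [_ G01 aeG _ _] := pX; set s := \val t.
have mphi : measurable_fun setT (phi : mR -> R) by exact: continuous_measurableR.
have C0 : 0 <= C by exact: le_trans (phiC 0).
have mps : measurable_fun setT (fun x : mR => phi x * speed lam u g t x).
  exact: measurable_funM.
have psC x : `|phi x * speed lam u g t x| <= C * speed_bound A B g.
  by rewrite normrM ler_pM.
rewrite (lebesgue_stieltjes_integral _ mps psC) (@marginal_integral _ _ _ _ K0 p_lip _ _ pX g t _ _ mps psC).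
pose f y w := phi y * F g (\row_h if h == g then w else law_cdf (X h s) y).
have cf y : continuous (f y).
  by move=> w; apply: cvgM; [exact: cvg_cst|exact: F_replace_continuous].
have mf : measurable_fun setT (fun z : mR * mR => f z.1 z.2).
  apply: measurable_funM; first exact: (measurableT_comp mphi measurable_fst).
  apply: (measurable_continuous_row (u := fun h z =>
    if h == g then z.2 else law_cdf (X h s) z.1)) => // h.
  by case: eqP => _; [exact: measurable_snd|exact: (measurableT_comp (mcdf h s) measurable_fst)].
have fC y w : `|f y w| <= C * speed_bound A B g.
  by rewrite normrM ler_pM//; exact: F_norm.
have nd v w : G v -> G w -> v <= w -> X g s v <= X g s w.
  exact: (coupling_limit_nd p_nd pX).
have := mean_identity (mXt g s) aeG G01 nd mf cf fC; rewrite /f => ->.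
congr fine; apply: eq_integral => v _; congr EFin.
rewrite speedE leb_itv_integral; last first.
  exact: (measurableT_comp (measurable_mean_row g s) (pair1_measurable _)).
rewrite -RintegralZl//.
apply: (@bounded_itv_integrable _ _ _ _ (speed_bound A B g)) => [|a]; last exact: F_norm.
exact: (measurableT_comp (measurable_mean_row g s) (pair1_measurable _)).
Qed.

(** The time integrands vanish after [M], which reduces the half-line to a segment; in space, tails
    turn back into integrals against distribution functions. *)
Lemma limit_weak_equation (phi dphi : halfline R -> R -> R) g M C (u0 : R -> R) :
  let phi' := fun t : R => phi (to_halfline t) in
  let dphi' := fun t : R => dphi (to_halfline t) in
  smooth_test phi' dphi' M C -> coupled_weak_identity F phi' dphi' M g X ->
  (forall x, u0 x = law_cdf (X g 0) x) ->
  int_halfline (fun t => \int[lebesgue_measure]_x (dphi t x * u g t x)) +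
    \int[lebesgue_measure]_x (phi (halfline0 R) x * u0 x) =
  int_halfline (fun t =>
    \int[lebesgue_stieltjes_measure (u g t)]_x (phi t x * speed lam u g t x)).
Proof.
move=> phi' dphi' st weak u0E.
have M0 : 0 < M by case: st.
have cphi t : continuous (phi' t) by apply: curry_continuous2; exact: smooth_test_cont st.
have cdphi t : continuous (dphi' t) by apply: curry_continuous2; exact: smooth_test_dcont st.
have phiC t x : `|phi' t x| <= C by case: (smooth_test_bound st t x).
have dphiC t x : `|dphi' t x| <= C by case: (smooth_test_bound st t x).
have supp t x : M <= `|x| -> phi' t x = 0 /\ dphi' t x = 0.
  by move=> h; exact: (smooth_test_supp st (or_intror h)).
have suppt t x : 0 <= t -> ~~ (0 <= t <= M) -> phi' t x = 0 /\ dphi' t x = 0.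
  move=> ->; rewrite /= -ltNge => /ltW h; exact: (smooth_test_supp st (or_introl h)).
have D0 : `[0, M] `<=` `[0, +oo[.
  by move=> t /=; rewrite !in_itv/= => /andP[->].
have vt t : 0 <= t -> \val (to_halfline t) = t :> R.
  by move=> t0; rewrite val_to_halfline; exact/max_idPr.
have z0 (mu : {measure set mR -> \bar R}) : \int[mu]_x (0 : R) = 0.
  by rewrite Rintegral_cst// mul0r.
rewrite /int_halfline (Rintegral_support (h := fun t => \int[unit_law]_v tail M (dphi' t) (X g t v)) D0).
- have h0 : to_halfline 0 = halfline0 R by rewrite -[RHS]val_halflineK.
  have -> : \int[lebesgue_measure]_x (phi (halfline0 R) x * u0 x) =
      \int[unit_law]_v tail M (phi' 0) (X g 0 v).
    rewrite -(Rintegral_law_cdf (cphi 0) (phiC 0) (fun x h => (supp 0 x h).1) (mXt g 0)).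
    by congr fine; apply: eq_integral => x _; rewrite u0E /phi' h0.
  rewrite weak.
  rewrite (Rintegral_support (h := fun t => \int[unit_law]_v
    (phi' t (X g t v) * coupled_speed F (X ^~ t) g v)) D0)//.
  + exact: (measurable_Rintegral_section _ (measurable_flux_density F_cont st mX g)
      (flux_density_bound F_bd st X g)).
  + move=> t; rewrite /= in_itv/= andbT => t0 nt.
    rewrite -[RHS](z0 (lebesgue_stieltjes_measure (u g (to_halfline t)))).
    congr fine; apply: eq_integral => x _.
    by have [e _] := suppt t x t0 nt; rewrite /phi' in e; rewrite e mul0r.
  + move=> t /andP[t0 _]; rewrite (limit_flux g (to_halfline t) (cphi t) (phiC t)).
    by rewrite vt.
- exact: (measurable_Rintegral_section _ (measurable_dtail st mX g)
    (fun z => tail_bound M0 (X g z.1 z.2) (cdphi z.1) (dphiC z.1))).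
- move=> t; rewrite /= in_itv/= andbT => t0 nt.
  rewrite -[RHS](z0 lebesgue_measure); congr fine; apply: eq_integral => x _.
  by have [_ e] := suppt t x t0 nt; rewrite /dphi' in e; rewrite e mul0r.
- move=> t /andP[t0 _].
  rewrite -(Rintegral_law_cdf (cdphi t) (dphiC t) (fun x h => (supp t x h).2) (mXt g t)).
  by congr fine; apply: eq_integral => x _; rewrite uE vt.
Qed.

End limit_equation.


Lemma increasing_cvg_infty (s : nat -> nat) : {homo s : i j / (i < j)%N >-> (i < j)%N} ->
  s @ \oo --> \oo.
Proof.
move=> s_incr; have ge n : (n <= s n)%N.
  by elim: n => // n IH; apply: (leq_ltn_trans IH); exact: s_incr.
by apply/cvgnyPge => N; exists N => // n /= Nn; exact: leq_trans Nn (ge n).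
Qed.

(** Integrals of a bounded continuous function against the initial empirical measures have two
    limits along the subsequence: one by the weak convergence hypothesis, one by dominated
    convergence in [v]. Their equality determines the distribution function. *)
Lemma limit_initial_law (R : realType) d (lam : 'rV[R]_d -> 'rV[R]_d)
    (x : forall n, 'M[R]_(d, n.+1)) (m : probability R R) g (k : nat -> nat)
    (X : 'I_d -> R -> R -> R) (G : set R) :
  weak_cvg (@bounded_continuous R R) (fun n => empirical (x n g)) m ->
  k @ \oo --> \oo -> coupling_limit (fun n => position lam x (k n)) X G ->
  forall y, distribution_function m y = law_cdf (X g 0) y.
Proof.
move=> xm k_oo [_ _ aeG mX [conv _]].
have mX0 : measurable_fun setT (X g 0 : measurableTypeR R -> R) by exact: measurable_curry.
apply: distribution_function_determined => // f [cf [C fC]].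
have mf : measurable_fun setT (f : measurableTypeR R -> R) by exact: continuous_measurableR.
have bf : bounded_continuous f by split => //; exists C.
have c1 := @cvg_comp _ _ _ k (fun n => \int[empirical (R := R) (x n g)]_y f y) \oo \oo _ k_oo (xm f bf).
have E : (fun n => \int[empirical (R := R) (x n g)]_y f y) \o k =
    fun n => \int[unit_law]_v f (position lam x (k n) g 0 v).
  apply/funext => n /=; rewrite (empirical_coupling _ cf fC).
  by congr fine; apply: eq_integral => v _; rewrite /position maxxx mspd0.
rewrite E in c1.
suff c2 : \int[unit_law]_v f (position lam x (k n) g 0 v) @[n --> \oo] -->
  \int[unit_law]_v f (X g 0 v) by exact: (cvg_unique _ c1 c2).
apply: (@bounded_cvg _ _ _ _ _ _ C).
- move=> n; rewrite /position maxxx.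
  apply: (measurable_idx_fun (f := fun j _ => f (mspd lam (x (k n)) 0 g j))) => j.
  exact: measurable_cst.
- exact: (measurableT_comp mf mX0).
- by [].
- apply: filterS aeG => v Gv.
  apply: (@cvg_comp _ _ _ (fun n => position lam x (k n) g 0 v) f \oo (nbhs (X g 0 v))); last exact: cf.
  exact: conv.
Qed.

Theorem theorem2p4p5 (R : realType) (d : nat) (hd : (1 <= d)%N)
    (lam : 'rV[R]_d -> 'rV[R]_d)
    (lam_cont : {within unit_cube, continuous lam})
    (lam_ush : uniformly_strictly_hyperbolic lam)
    (m : 'I_d -> probability R R)
    (x : forall n : nat, 'M[R]_(d, n.+1))
    (x_conf : forall n, configuration (x n))
    (x_cvg : forall g, weak_cvg (@bounded_continuous R R)
               (fun n => empirical (x n g)) (m g))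
    (s : nat -> nat) (s_incr : {homo s : i j / (i < j)%N >-> (i < j)%N}) :
  exists r : nat -> nat, {homo r : i j / (i < j)%N >-> (i < j)%N} /\
  exists mubar : probability (trajectory R d) R,
    weak_cvg (@bounded_continuous R (trajectory R d))
      (fun l => empirical (mspd_trajectory lam (x (s (r l))))) mubar /\
    probabilistic_solution lam (fun g => distribution_function (m g))
      (fun g t => distribution_function (marginal mubar g t)).
Proof.
have [A [B [L [L0 lb AB_sep]]]] := hyperbolic_bounds lam_cont lam_ush.
pose F g u := lam (clamp u) 0 g.
have F_cont g : continuous (F g) by exact: clamp_extension.
have F_lam g u : unit_cube u -> F g u = lam u 0 g by move=> cu; rewrite /F clamp_id.
have F_bd g u : A g <= F g u <= B g by apply: lb; exact: clamp_cube.
have K0 := lipschitz_bound_ge0 A B.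
pose K := lipschitz_bound A B.
have p_lip n g t0 t v : `|position lam x n g t v - position lam x n g t0 v| <= K * `|t - t0|.
  exact: (position_lipschitz F_cont F_lam F_bd L0 AB_sep x_conf).
have p_nd n g t v w : v <= w -> position lam x n g t v <= position lam x n g t w.
  exact: (position_nd F_cont F_lam F_bd L0 AB_sep x_conf).
have p_bd g t v : 0 < v < 1 -> exists M, forall n, `|position lam x n g t v| <= M.
  exact: (position_bounded F_cont F_lam F_bd L0 AB_sep x_conf x_cvg).
have [r [r_incr [X [G pX]]]] := @coupling_limit_exists R d (fun n => position lam x (s n)) K K0
  (fun n => p_lip (s n)) (fun n => p_nd (s n))
  ltac:(by move=> g t v v01; have [M HM] := p_bd g t v v01; exists M)
  (fun n => measurable_position lam x (s n)).
exists r; split => //.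
pose k n := s (r n).
have k_oo : k @ \oo --> \oo.
  by apply: increasing_cvg_infty => i j ij; apply: s_incr; exact: r_incr.
have {}pX : coupling_limit (fun n => position lam x (k n)) X G by [].
have p_lipk n := p_lip (k n).
exists (limit_law K0 p_lipk pX); split.
  apply: (@limit_law_cvg _ _ _ _ _ _ _ _ _ k (fun n => mspd_trajectory lam (x (k n)))).
  move=> n v t g; rewrite /position (max_idPr (val_halfline_ge0 t)).
  by rewrite /= mxE.
split=> [g|phi dphi test]; first exact: limit_measurable.
(* The equation holds for each type separately, so the sums agree term by term. *)
apply: eq_bigr => g _; have [M [C st]] := test_function_smooth (test g).
apply: (limit_weak_equation F_cont F_lam F_bd K0 p_lipk _ pX st).
- by move=> n; exact: p_nd.
- have [_ _ aeG mX [conv _]] := pX.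
  apply: (@coupled_weak_identity_limit _ _ F A B F_cont F_bd _ _ M C st
    (fun n => position lam x (k n)) X G L) => //.
  + by move=> n h; exact: measurable_position.
  + by move=> v Gv t _ h; exact: conv.
  + move=> h h' v w a b hh' Gv Gw a0 ab.
    apply: (coupling_limit_separate pX _ hh' Gv Gw a0 ab).
    by move=> n; apply: (position_separate F_cont F_lam F_bd L0 AB_sep x_conf).
  (* Freezing negative times makes the path continuous on the whole line without changing it to the
     right of any [t >= 0]. *)
  + move=> n; pose y (t : R) := mspd lam (x (k n)) (Num.max 0 t).
    apply: (@discrete_coupled_weak_identity _ _ F A B F_cont F_bd _ y _ _ M C g _ st).
      move=> h j t; apply: (@continuous_comp R R R (fun z : R => Num.max 0 z)
        (fun t : R => mspd lam (x (k n)) t h j)); last exact: mspd_continuous.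
      exact: max0_continuous.
    move=> t t0; have [_] := mspd_local F_cont F_lam F_bd L0 AB_sep (x_conf (k n)) t0.
    apply: (@locally_characteristic_ext _ _ _ _ _ _ _ _ _ _ 1) => // z /andP[z0 _].
    by rewrite /y (max_idPr _)// addr_ge0.
- exact: (limit_initial_law (x_cvg g) k_oo pX).
Qed.
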